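(* Let $n\ge1$, let $a_1,\dots,a_n>0$ with $a_i\neq1$ for all $i$, and let $v$ denote the number of distinct values in the set $\{a_1,\dots,a_n\}$. Let $f:\mathbb{R}^n\to\mathbb{R}$ be mixed homogeneous of degree $(a_1,\dots,a_n)$, and let $g$ be a nonnegative locally integrable function on $\mathbb{R}^n$ that is mixed homogeneous of degree $(\rho a_1,\dots,\rho a_n)$ on $\mathbb{R}^n\setminus\{0\}$ for some $\rho\in\mathbb{R}$, with $g\in L^p([-1,1]^n)$ for some $1\le p\le\infty$; let $p'$ be the conjugate exponent, $\frac1p+\frac1{p'}=1$. For $\phi$ admissible for $g$ (as defined in the context) let $$T(\lambda_0,\lambda_1,\dots,\lambda_n)=\int_{\mathbb{R}^n}e^{i\lambda_0 f(x_1,\dots,x_n)+i\lambda_1x_1+\dots+i\lambda_nx_n}\,\phi(x_1,\dots,x_n)\,dx_1\cdots dx_n .$$ Let $\mu_g$ denote the measure $|g(x_1,\dots,x_n)|\,dx_1\cdots dx_n$. Suppose $0<\epsilon<\frac1{v+1}<\frac1{p'}$ and for some $B_{f,g,\epsilon}>0$, for all $t>0$ one has $$\mu_g(\{x\in[-1,1]^n:|f(x)|<t\})\le B_{f,g,\epsilon}\,t^{\epsilon}.\qquad(\ast)$$ Then there is $C_{f,g,\epsilon}>0$, independent of the admissible $\phi$, such that for all $\lambda=(\lambda_0,\dots,\lambda_n)\in\mathbb{R}^{n+1}$ $$|T(\lambda_0,\lambda_1,\dots,\lambda_n)|\le C_{f,g,\epsilon}(1+|\lambda|)^{-\epsilon}.$$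 If the supremum of the $\epsilon$ for which a constant $B_{f,g,\epsilon}$ as in $(\ast)$ exists is given by $\delta\le\frac1{v+1}$, then the exponent cannot be taken to be greater than $\delta$; that is, there is no $\eta>\delta$ for which an estimate $|T(\lambda)|\le C_{f,g,\eta}(1+|\lambda|)^{-\eta}$ holds for all admissible $\phi$ and all $\lambda$.
   Context: Mixed homogeneity: for positive $a_1,\dots,a_n$, a function $f:\mathbb{R}^n\to\mathbb{R}$ is mixed homogeneous of degree $(a_1,\dots,a_n)$ if $f(t^{1/a_1}x_1,\dots,t^{1/a_n}x_n)=t\,f(x_1,\dots,x_n)$ for all $t>0$ and all $x\in\mathbb{R}^n$; $f$ is understood to be Lebesgue measurable. For $\rho\in\mathbb{R}$ (possibly zero or negative), $g$ is mixed homogeneous of degree $(\rho a_1,\dots,\rho a_n)$ on $\mathbb{R}^n\setminus\{0\}$ if $g(t^{1/a_1}x_1,\dots,t^{1/a_n}x_n)=t^{\rho}g(x_1,\dots,x_n)$ for all $t>0$ and $x\neq0$. Admissible $\phi$: an integrable (real- or complex-valued) function $\phi$ on $\mathbb{R}^n$ supported on the unit ball such that $$|\phi(x)|\le g(x)\quad\text{and}\quad\Big|\sum_{i=1}^n\frac{x_i}{a_i}\frac{\partial\phi}{\partial x_i}(x)\Big|\le g(x)$$ for $x\ne 0$. No regularity of $f,g,\phi$ is assumed in directions other than along the curves $t\mapsto(t^{1/a_1}x_1,\dots,t^{1/a_n}x_n)$: the sum $\sum_i\frac{x_i}{a_i}\frac{\partial\phi}{\partial x_i}(x)$ is understood as $\frac{d}{dt}\big|_{t=1}\phi(t^{1/a_1}x_1,\dots,t^{1/a_n}x_n)$,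 where $t\mapsto\phi(t^{1/a_1}x_1,\dots,t^{1/a_n}x_n)$ is $C^1$ on $(0,\infty)$ for each $x\neq0$. $|\lambda|$ denotes the magnitude of the full vector $(\lambda_0,\dots,\lambda_n)$. Convention: $1/p'=0$ when $p=1$. *)

(* Defs.v *)
From HB Require Import structures.
From mathcomp Require Import all_boot all_order all_algebra.
From mathcomp Require Import all_classical all_reals all_analysis.
From mathcomp Require Import complex.
Import Order.TTheory GRing.Theory Num.Theory.
Import numFieldNormedType.Exports.

Set Implicit Arguments.
Unset Strict Implicit.
Unset Printing Implicit Defensive.

Local Open Scope classical_set_scope.
Local Open Scope ring_scope.

(* Lebesgue measure on R^n: the classical outer measure obtained from countable
   covers by half-open boxes, restricted to its Caratheodory sigma-algebra. *)
Section lebesgue_measure_rV.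
Context (R : realType) (n : nat).
Implicit Types (u v : 'rV[R]_n) (A : set 'rV[R]_n).

Definition box u v : set 'rV[R]_n :=
  [set x | forall i, u ord0 i < x ord0 i <= v ord0 i].

Definition box_volume u v : R := \prod_i Num.max 0 (v ord0 i - u ord0 i).

(* The boxes are indexed by a subset D of nat, so that a cover may be finite or
   empty (in dimension 0 no box is empty). *)
Definition box_covers A (D : pred nat) (lo hi : nat -> 'rV[R]_n) : Prop :=
  A `<=` \bigcup_(k in [set k | D k]) box (lo k) (hi k).

Definition leb A : \bar R := ereal_inf [set s | exists D lo hi,
  box_covers A D lo hi /\
  s = (\sum_(k <oo | D k) (box_volume (lo k) (hi k))%:E)%E].

Local Open Scope ereal_scope.

Let cost (c : bool * ('rV[R]_n * 'rV[R]_n)) : \bar R :=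
  if c.1 then (box_volume c.2.1 c.2.2)%:E else 0.

Let box_volume_ge0 u v : (0 <= box_volume u v)%R.
Proof. by apply: prodr_ge0 => i _; rewrite le_max lexx. Qed.

Let cost_ge0 c : 0 <= cost c.
Proof. by rewrite /cost; case: ifP => // _; rewrite lee_fin. Qed.

Let covers A (c : nat -> bool * ('rV[R]_n * 'rV[R]_n)) : Prop :=
  A `<=` \bigcup_(k in [set k | (c k).1]) box (c k).2.1 (c k).2.2.

Let lebE A :
  leb A = ereal_inf [set \sum_(k <oo) cost (c k) | c in covers A].
Proof.
congr ereal_inf; apply/seteqP; split => s /=.
- move=> [D [lo [hi [Ac ->]]]]; exists (fun k => (D k, (lo k, hi k))) => //.
  by rewrite [RHS]eseries_mkcond.
- move=> [c Ac <-].
  exists (fun k => (c k).1), (fun k => (c k).2.1), (fun k => (c k).2.2).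
  by split => //; rewrite [RHS]eseries_mkcond.
Qed.

Let leb_ge0 A : 0 <= leb A.
Proof.
by rewrite lebE; apply: le_ereal_inf_tmp => _ [c _ <-]; exact: nneseries_ge0.
Qed.

Let leb0 : leb set0 = 0.
Proof.
apply/eqP; rewrite eq_le leb_ge0 andbT lebE; apply: ereal_inf_lbound.
exists (fun=> (false, (0%R, 0%R))); first exact: sub0set.
by rewrite eseries0.
Qed.

Let le_leb : {homo leb : A B / A `<=` B >-> A <= B}.
Proof.
move=> A B AB; rewrite !lebE; apply/ereal_inf_le_tmp => _ [c Bc <-].
by exists c => //; exact: subset_trans Bc.
Qed.

Let leb_sigma_subadditive : sigma_subadditive leb.
Proof.
move=> A; have [[i ioo]|] := pselect (exists i, leb (A i) = +oo).
  rewrite (eseries_pinfty _ _ ioo) ?leey// => k _.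
  by rewrite -ltNye (lt_le_trans _ (leb_ge0 _)).
rewrite -forallNE => Aoo.
suff add2e (e : {posnum R}) :
    leb (\bigcup_n A n) <= \sum_(i <oo) leb (A i) + e%:num%:E.
  by apply/lee_addgt0Pr => _/posnumP[].
rewrite (le_trans _ (epsilon_trick _ _ _))//.
pose P m c := covers (A m) c /\
  \sum_(k <oo) cost (c k) <= leb (A m) + (e%:num / (2 ^ m.+1)%:R)%:E.
have [G PG] : {G & forall m, P m (G m)}.
  apply: (@choice _ _ P) => m; rewrite /P lebE.
  set S := (X in ereal_inf X); move infS : (ereal_inf S) => iS.
  case: iS infS => [r Sr|Soo|Soo].
  - have en1 : (0 < e%:num / (2 ^ m.+1)%:R)%R by [].
    have /(lb_ereal_inf_adherent en1) : ereal_inf S \is a fin_num by rewrite Sr.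
    move=> [x [B AnB muBx] xS].
    by exists B; split => //; rewrite muBx -Sr; exact/ltW.
  - by have := Aoo m; rewrite lebE Soo.
  - by have := leb_ge0 (A m); rewrite lebE Soo.
apply: (@le_trans _ _ (\esum_(i in setT) (cost \o uncurry G) i)).
  rewrite lebE; apply: ereal_inf_lbound => /=.
  have /card_esym/ppcard_eqP[f] := card_nat2.
  exists (uncurry G \o f).
    move=> t [i _] /(PG i).1 [j /= Dj Bijt].
    by exists (f^-1%FUN (i, j)); rewrite /= invK ?inE.
  rewrite -(esum_pred_image (cost \o uncurry G) _ xpredT) ?[fun=> _]set_true//.
    by rewrite image_eq.
  by move=> *; exact: cost_ge0.
rewrite (_ : esum _ _ = \sum_(i <oo) \sum_(j <oo ) cost (G i j)).
  apply: lee_lim.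
  - apply: is_cvg_nneseries => m *.
    by apply: nneseries_ge0 => *; exact: cost_ge0.
  - by apply: is_cvg_nneseries => m *; apply: adde_ge0.
  - by apply: nearW => m; apply: lee_sum => i _; exact: (PG i).2.
pose J : nat -> set (nat * nat) := fun i => [set (i, j) | j in setT].
rewrite (_ : setT = \bigcup_k J k); last first.
  by rewrite predeqE => -[a b]; split => // _; exists a => //; exists b.
rewrite esum_bigcupT /=; last 2 first.
  - apply/trivIsetP => i j _ _ ij.
    rewrite predeqE => -[a m] /=; split => //= -[] [_] _ [<-{a} _].
    by move=> [m' _] [] /esym/eqP; rewrite (negbTE ij).
  - by move=> [a m]; exact: cost_ge0.
rewrite -(image_id [set: nat]) -fun_true esum_pred_image//; last first.
  by move=> a _; exact: esum_ge0.
apply: eq_eseriesr => /= j _.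
rewrite -(esum_pred_image (cost \o uncurry G) (pair j) predT)//=.
- by congr esum; rewrite predeqE => -[a b]; split; move=> [i _ <-]; exists i.
- by move=> ? ? _ _; exact: (@can_inj _ _ _ snd).
Qed.

HB.instance Definition _ := isOuterMeasure.Build R 'rV[R]_n leb
  leb0 leb_ge0 le_leb leb_sigma_subadditive.

End lebesgue_measure_rV.

(* R^n with the sigma-algebra of Lebesgue measurable sets *)
Notation lebesgue_rV R n := (caratheodory_type (@leb R n)).

Definition lebesgue_measure_rV (R : realType) (n : nat) :
    {measure set (lebesgue_rV R n) -> \bar R} :=
  (@leb R n : {outer_measure set 'rV[R]_n -> \bar R}).

Section scaling.
Context (R : realType) (n : nat).

(* The library norm `|x| on 'rV[R]_m is the sup norm. *)
Definition euclid (m : nat) (x : 'rV[R]_m) : R :=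
  Num.sqrt (\sum_i x ord0 i ^+ 2).

Definition cube : set 'rV[R]_n := [set x | forall i, -1 <= x ord0 i <= 1].

Definition dilate (a : 'I_n -> R) (t : R) (x : 'rV[R]_n) : 'rV[R]_n :=
  \row_i (t `^ (a i)^-1 * x ord0 i).

Definition mixed_homogeneous (a : 'I_n -> R) (f : 'rV[R]_n -> R) : Prop :=
  forall (t : R) (x : 'rV[R]_n), 0 < t -> f (dilate a t x) = t * f x.

(* degree (rho a_1, ..., rho a_n) on R^n \ {0} *)
Definition mixed_homogeneous_off0 (a : 'I_n -> R) (rho : R)
    (g : 'rV[R]_n -> R) : Prop :=
  forall (t : R) (x : 'rV[R]_n), 0 < t -> x != 0 -> g (dilate a t x) = t `^ rho * g x.

End scaling.

Definition num_distinct (R : realType) (n : nat) (a : 'I_n -> R) : nat :=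
  size (undup (codom a)).

Section integration.
Context (R : realType) (n : nat).
Local Notation T := (lebesgue_rV R n).
Local Notation mu := (lebesgue_measure_rV R n).
Implicit Types f g : 'rV[R]_n -> R.

Definition lebesgue_measurable f : Prop := measurable_fun [set: T] f.

Definition locally_integrable_rV g : Prop :=
  lebesgue_measurable g /\
  forall K : set 'rV[R]_n, compact K -> (\int[mu]_(x in K) `|g x|%:E < +oo)%E.

Definition Lp_on_cube (p : \bar R) g : Prop :=
  measurable_fun (@cube R n : set T) g /\
  (Lnorm mu p (EFin \o (g \_ (@cube R n))) < +oo)%E.

Definition weighted_measure g (A : set 'rV[R]_n) : \bar R :=
  (\int[mu]_(x in A) `|g x|%:E)%E.

Definition sublevel f (t : R) : set 'rV[R]_n :=
  [set x | cube x /\ `|f x| < t].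

Definition sublevel_estimate f g (eps : R) : Prop :=
  exists2 B : R, 0 < B & forall t : R, 0 < t ->
    (weighted_measure g (sublevel f t) <= (B * t `^ eps)%:E)%E.

Definition complex_integrable (h : 'rV[R]_n -> R[i]) : Prop :=
  mu.-integrable setT (fun x => (complex.Re (h x))%:E) /\
  mu.-integrable setT (fun x => (complex.Im (h x))%:E).

Definition complex_integral (h : 'rV[R]_n -> R[i]) : R[i] :=
  Complex (\int[mu]_x complex.Re (h x)) (\int[mu]_x complex.Im (h x)).

End integration.

Section oscillatory.
Context (R : realType) (n : nat).
Local Open Scope complex_scope.
Implicit Types (a : 'I_n -> R) (f g : 'rV[R]_n -> R) (phi : 'rV[R]_n -> R[i]).

Definition C1_pos (h : R -> R) : Prop :=
  forall t : R, 0 < t -> derivable h t 1 /\ {for t, continuous (derive1 h)}.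

Definition C1_pos_complex (h : R -> R[i]) : Prop :=
  C1_pos (fun t => complex.Re (h t)) /\ C1_pos (fun t => complex.Im (h t)).

(* sum_i (x_i / a_i) d(phi)/d(x_i), read as the derivative at t = 1 of phi along
   the curve t |-> dilate a t x *)
Definition euler_derivative a phi (x : 'rV[R]_n) : R[i] :=
  derive1 (fun t => complex.Re (phi (dilate a t x))) 1 +i*
  derive1 (fun t => complex.Im (phi (dilate a t x))) 1.

Definition admissible a g phi : Prop :=
  [/\ complex_integrable phi,
      forall x : 'rV[R]_n, 1 < euclid x -> phi x = 0,
      forall x : 'rV[R]_n, x != 0 -> C1_pos_complex (fun t => phi (dilate a t x)),
      forall x : 'rV[R]_n, x != 0 -> `|phi x| <= (g x)%:C
    & forall x : 'rV[R]_n, x != 0 -> `|euler_derivative a phi x| <= (g x)%:C].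

Definition expi (theta : R) : R[i] := cos theta +i* sin theta.

Definition phase f (lambda : 'rV[R]_n.+1) (x : 'rV[R]_n) : R :=
  lambda ord0 ord0 * f x + \sum_i lambda ord0 (lift ord0 i) * x ord0 i.

Definition osc_integral f phi (lambda : 'rV[R]_n.+1) : R[i] :=
  complex_integral (fun x => expi (phase f lambda x) * phi x).

Definition uniform_decay a f g (eta : R) : Prop :=
  exists2 C : R, 0 < C & forall phi, admissible a g phi ->
    forall lambda : 'rV[R]_n.+1,
      `|osc_integral f phi lambda| <= (C * (1 + euclid lambda) `^ (- eta))%:C.

End oscillatory.

(* Main.v *)
(* Averaging over the dilations [x |-> (exp(s / a_i) x_i)], 0 <= s <= kappa,
   turns T(lambda) into an integral over the cube of one-dimensional oscillatory
   integrals. Along a curve the phase is an exponential sum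
   [sum_k c_k exp(beta_k s)] whose v + 1 exponents, 1 and the distinct 1 / a_i,
   are distinct and nonzero; a Lagrange interpolation argument bounds
   [sum_k |c_k|] by one of the derivatives of orders 1, ..., v + 1 at [s = 0].
   For kappa small that derivative stays large on [0, kappa], so van der Corput's
   lemma gives the gain [|c_k|^(-1/(v+1))]. Here [c_0 = lambda_0 f(x)] and the
   other c_k are linear forms in x. Splitting dyadically in |c_k|, the sublevel
   estimate for [f] (when lambda_0 is large) or the one for linear forms, which
   comes from Hoelder's inequality (when some lambda_i is large), yields the decay.
   The average is taken over Riemann sums in [s], so that only the scaling of
   Lebesgue measure and dominated convergence are needed, not Fubini's theorem.

   Conversely, a decay of order eta < 1 at the integer frequencies
   (k, 0, ..., 0), tested on [g] times a cutoff, bounds the integral of a Fejer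
   kernel in [f], hence the measure of small sublevel sets of [f] near the
   origin; mixed homogeneity transports this to the cube. *)
Require Import Defs.
From mathcomp Require Import all_boot all_order all_algebra.
From mathcomp Require Import all_classical all_reals all_analysis.
From mathcomp Require Import complex.
From mathcomp Require Import measurable_realfun ess_sup_inf ring lra.
Import Order.TTheory GRing.Theory Num.Theory.
Import numFieldNormedType.Exports.

Local Open Scope classical_set_scope.
Local Open Scope ring_scope.

Set Implicit Arguments.
Unset Strict Implicit.
Unset Printing Implicit Defensive.

(** * Van der Corput's lemma *)

Section calculus.
Context {R : realType}.
Implicit Types (a b s d K : R) (f E : R -> R).

(** The amplitude is regular only along the dilation curves, so integration by parts is possible in
    that direction alone; this forces the estimate to be one-dimensional. Only [s >= 0] is used:
    such dilations expand every coordinate, so a point outside the cube never reaches the support,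
    and everything happens on the cube, where the sublevel estimate and the [L^p] bound on [g] are
    available. The hypothesis [a i != 1] keeps the exponent 1 apart from the [1 / a i], so that
    [c_0] contains [f] and no linear term. The gain [min(1, |c_k|^(-1/(v+1)))], integrated against a
    measure whose sublevel sets have mass [O(t^eps)], produces a geometric series of ratio
    [2^(-(1 - (v+1) eps))]: this is where [eps < 1/(v+1)] enters, while [eps < 1/p'] is what
    Hoelder's inequality asks for on slabs. In the converse, [g] times a cutoff is admissible
    because along a curve [g] is an explicit power of the parameter. The sum of [k^(-eta)] over
    [k <= N] is [O(N^(1-eta))] for [eta < 1], and such an [eta] is at hand because
    [delta <= 1/2]. *)

Lemma is_derive_within_continuous f df a b :
  (forall x, a <= x <= b -> is_derive x 1 f (df x)) ->
  {within `[a, b], continuous f}.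
Proof.
move=> dfP; apply: derivable_within_continuous => x; rewrite in_itv/= => xab.
by have [] := dfP x xab.
Qed.

Lemma is_derive_MVT f df a b : a <= b ->
  (forall x, a <= x <= b -> is_derive x 1 f (df x)) ->
  exists2 c, a <= c <= b & f b - f a = df c * (b - a).
Proof.
move=> ab dfP.
have dfP' x : x \in `]a, b[%R -> is_derive x 1 f (df x).
  by rewrite in_itv/= => /andP[/ltW ax /ltW xb]; apply: dfP; rewrite ax.
have [c cab ->] := MVT_segment ab dfP' (is_derive_within_continuous dfP).
by exists c => //; move: cab; rewrite in_itv.
Qed.

Lemma is_derive_le f df a b : a <= b ->
  (forall x, a <= x <= b -> is_derive x 1 f (df x)) ->
  (forall x, a <= x <= b -> 0 <= df x) -> f a <= f b.
Proof.
move=> ab dfP df0; rewrite -subr_ge0; have [c cab ->] := is_derive_MVT ab dfP.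
by rewrite mulr_ge0 ?df0// subr_ge0.
Qed.

(** Both [E + f] and [E - f] are nondecreasing. The one-dimensional oscillatory integrals below are
    handled in this form, as increments of a primitive. *)
Lemma is_derive_increment_le f df E dE a b : a <= b ->
  (forall x, a <= x <= b -> is_derive x 1 f (df x)) ->
  (forall x, a <= x <= b -> is_derive x 1 E (dE x)) ->
  (forall x, a <= x <= b -> `|df x| <= dE x) -> `|f b - f a| <= E b - E a.
Proof.
move=> ab dfP dEP le_df; rewrite ler_norml; apply/andP; split.
- have : (f + E) a <= (f + E) b.
    apply: (@is_derive_le _ (fun x => df x + dE x)) => // x xab.
      by have ? := dfP x xab; have ? := dEP x xab; apply: is_deriveD.
    by rewrite -lerBlDr sub0r; have := le_df x xab; rewrite ler_norml => /andP[].
  by rewrite !fctE; lra.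
- have : (E - f) a <= (E - f) b.
    apply: (@is_derive_le _ (fun x => dE x - df x)) => // x xab.
      by have ? := dfP x xab; have ? := dEP x xab; apply: is_deriveB.
    by rewrite subr_ge0; have := le_df x xab; rewrite ler_norml => /andP[].
  by rewrite !fctE; lra.
Qed.

(** The phase is carried together with all its derivatives as a sequence, [H m] being the derivative
    of order [m] of [H 0]. *)
Definition derivatives (H : nat -> R -> R) :=
  forall m s, is_derive s 1 (H m) (H m.+1 s).

Lemma derivativesN H : derivatives H -> derivatives (fun m s => - H m s).
Proof. by move=> dH m s; have ? := dH m s; apply: is_deriveN. Qed.

(* Integration by parts: cos(H 0) is the derivative of sin(H 0) / H 1 up to the
   error sin(H 0) H 2 / (H 1)^2. *)
Lemma van_der_corput_parts H E G dG a b d : derivatives H -> a <= b -> 0 < d ->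
  (forall x, a <= x <= b -> is_derive x 1 E (cos (H 0 x))) ->
  (forall x, a <= x <= b -> 1 <= d * H 1%N x) ->
  (forall x, a <= x <= b -> is_derive x 1 G (dG x)) ->
  (forall x, a <= x <= b -> `|H 2%N x| / H 1%N x ^+ 2 <= dG x) ->
  `|E b - E a| <= 2 * d + (G b - G a).
Proof.
move=> dH ab d0 dE H1 dG' HG.
have H1gt0 x : a <= x <= b -> 0 < H 1%N x.
  by move=> /H1 h; rewrite -(pmulr_rgt0 _ d0) (lt_le_trans _ h).
have H1V x : a <= x <= b -> (H 1%N x)^-1 <= d.
  by move=> xab; rewrite -div1r ler_pdivrMr ?H1gt0 ?H1.
pose S x := sin (H 0 x) * (H 1%N x)^-1.
have dS x : a <= x <= b ->
    is_derive x 1 S (cos (H 0 x) - sin (H 0 x) * H 2%N x / H 1%N x ^+ 2).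
  move=> xab; have H1n0 := lt0r_neq0 (H1gt0 x xab).
  have ? := dH 0 x; have ? := dH 1%N x.
  have ? : is_derive x 1 (sin \o H 0) (cos (H 0 x) * H 1%N x).
    exact: is_derive1_comp.
  have dV := is_deriveV H1n0.
  have -> : S = (sin \o H 0) * (fun y => (H 1%N y)^-1) by [].
  apply: is_derive_eq.
  rewrite /= /GRing.scale/=; field; exact: H1n0.
have le_S x : a <= x <= b -> `|S x| <= d.
  move=> xab; rewrite normrM normfV (gtr0_norm (H1gt0 x xab)).
  rewrite -[leRHS]mul1r ler_pM ?invr_ge0 ?(ltW (H1gt0 _ xab)) ?H1V//.
  by rewrite ler_norml sin_geN1 sin_le1.
have : `|(E - S) b - (E - S) a| <= G b - G a.
  apply: (@is_derive_increment_le _ (fun x => sin (H 0 x) * H 2%N x / H 1%N x ^+ 2)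
    _ dG) => // x xab.
    have ? := dE x xab; have ? := dS x xab; apply: is_derive_eq.
    by rewrite opprB addrC subrK.
  rewrite !normrM normfV normrX.
  apply: le_trans (HG x xab); rewrite (gtr0_norm (H1gt0 x xab)) -mulrA.
  by rewrite ler_piMl ?divr_ge0 ?exprn_ge0 ?(ltW (H1gt0 x xab))// ler_norml sin_geN1 sin_le1.
have := le_S b; have := le_S a; rewrite !lexx ab => /(_ isT) + /(_ isT).
rewrite !fctE !ler_norml => /andP[? ?] /andP[? ?] /andP[? ?].
by apply/andP; split; lra.
Qed.

(** When [H 2] has constant sign, the error term is bounded by the derivative of [1 / H 1] up to
    sign. Since [1 / H 1] stays in [[0, d]], its variation adds at most [d] to the boundary terms
    [2 d]. *)
Lemma van_der_corput1 H E a b d : derivatives H -> a <= b -> 0 < d ->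
  (forall x, a <= x <= b -> is_derive x 1 E (cos (H 0 x))) ->
  (forall x, a <= x <= b -> 1 <= d * H 1%N x) ->
  (forall x, a <= x <= b -> 0 <= H 2%N x) \/
  (forall x, a <= x <= b -> H 2%N x <= 0) ->
  `|E b - E a| <= 3 * d.
Proof.
move=> dH ab d0 dE H1 H2.
have H1gt0 x : a <= x <= b -> 0 < H 1%N x.
  by move=> /H1 h; rewrite -(pmulr_rgt0 _ d0) (lt_le_trans _ h).
have dV x : a <= x <= b ->
    is_derive x 1 (fun y => (H 1%N y)^-1) (- (H 2%N x / H 1%N x ^+ 2)).
  move=> xab; have H1n0 := lt0r_neq0 (H1gt0 x xab); have ? := dH 1%N x.
  have dV := is_deriveV H1n0; apply: is_derive_eq.
  by rewrite /GRing.scale/= mulNr mulrC.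
have H1V x : a <= x <= b -> 0 <= (H 1%N x)^-1 <= d.
  move=> xab; rewrite invr_ge0 (ltW (H1gt0 _ xab))/=.
  by rewrite -div1r ler_pdivrMr ?H1gt0 ?H1.
have := H1V b; have := H1V a; rewrite !lexx ab => /(_ isT)/andP[a1 a2] /(_ isT)/andP[b1 b2].
case: H2 => H2.
- have := @van_der_corput_parts H E (fun x => - (H 1%N x)^-1) (fun x => H 2%N x / H 1%N x ^+ 2)
    a b d dH ab d0 dE H1.
  move=> h; apply: (le_trans (h _ _)).
  + by move=> x xab; rewrite -[X in is_derive _ _ _ X]opprK; have ? := dV x xab; apply: is_deriveN.
  + by move=> x xab; rewrite ger0_norm ?H2.
  + by lra.
- have := @van_der_corput_parts H E (fun x => (H 1%N x)^-1) (fun x => - (H 2%N x / H 1%N x ^+ 2))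
    a b d dH ab d0 dE H1 dV.
  move=> h; apply: (le_trans (h _)).
  + by move=> x xab; rewrite ler0_norm ?H2// mulNr.
  + by lra.
Qed.

End calculus.

Section van_der_corput.
Context {R : realType}.
Implicit Types (a b d C : R) (E : R -> R) (H : nat -> R -> R).

Lemma cos_primitive_lipschitz H E a b : a <= b ->
  (forall x, a <= x <= b -> is_derive x 1 E (cos (H 0 x))) ->
  `|E b - E a| <= b - a.
Proof.
move=> ab dE; apply: (@is_derive_increment_le _ _ _ id (fun=> 1) _ _ ab dE).
by move=> x _; rewrite ler_norml cos_geN1 cos_le1.
Qed.

(* The lower bound [H m >= d^(-m)] is multiplied out so that the conclusion is
   linear in [d]. The flag adds the monotonicity hypothesis that is needed in
   order one only. *)
Definition vdc_bound (monotone : bool) m C :=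
  forall H E a b d, derivatives H -> a <= b -> 0 < d ->
  (forall x, a <= x <= b -> is_derive x 1 E (cos (H 0 x))) ->
  (forall x, a <= x <= b -> 1 <= d ^+ m * H m x) ->
  (monotone -> (forall x, a <= x <= b -> 0 <= H m.+1 x) \/
               (forall x, a <= x <= b -> H m.+1 x <= 0)) ->
  `|E b - E a| <= C * d.

(** [H m] is increasing, hence has at most one zero. At distance [d] from it [|H m|] has reached
    [d^(-m)], so the bound of order [m] applies beyond; each side costs [C d] plus [d] for the
    interval next to the zero. *)
Lemma vdc_bound_step m C : 0 <= C -> vdc_bound true m C ->
  vdc_bound false m.+1 (2 * (1 + C)).
Proof.
move=> C0 IH H E a b d dH ab d0 dE Hm1 _.
have Hm1_ge0 x : a <= x <= b -> 0 <= H m.+1 x.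
  by move=> /Hm1 h; rewrite -(pmulr_rge0 _ (exprn_gt0 m.+1 d0)) (le_trans _ h).
have slope x y : a <= x -> x + d <= y -> y <= b -> 1 <= d ^+ m * (H m y - H m x).
  move=> ax xy yb; have xy' : x <= y by lra.
  have [c /andP[xc cy] ->] : exists2 c, x <= c <= y & H m y - H m x = H m.+1 c * (y - x).
    by apply: is_derive_MVT.
  have cab : a <= c <= b by apply/andP; split; lra.
  apply: le_trans (Hm1 c cab) _; rewrite exprSr -!mulrA ler_wpM2l ?exprn_ge0 ?(ltW d0)//.
  by rewrite mulrC ler_wpM2l ?Hm1_ge0//; lra.
have sub_dE x y : a <= x -> y <= b ->
    forall z, x <= z <= y -> is_derive z 1 E (cos (H 0 z)).
  by move=> ax yb z /andP[xz zy]; apply: dE; apply/andP; split; lra.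
have right x : a <= x <= b -> 0 <= H m x -> `|E b - E x| <= (1 + C) * d.
  move=> /andP[ax xb] Hx; have [bxd|xdb] := leP b (x + d).
    apply: le_trans (cos_primitive_lipschitz xb (sub_dE _ _ ax (lexx b))) _.
    have := mulr_ge0 C0 (ltW d0); lra.
  have ? : `|E (x + d) - E x| <= x + d - x.
    by apply: (@cos_primitive_lipschitz H); [lra | apply: sub_dE; [|apply: ltW]].
  have ? : `|E b - E (x + d)| <= C * d.
    apply: (IH H) => //; first exact: ltW.
    - by apply: sub_dE => //; lra.
    - move=> y /andP[xy yb]; apply: le_trans (slope x y ax xy yb) _.
      by rewrite ler_wpM2l ?exprn_ge0 ?(ltW d0)// gerBl.
    - by move=> _; left => y /andP[xy yb]; apply: Hm1_ge0; apply/andP; split; lra.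
  rewrite (_ : E b - E x = (E b - E (x + d)) + (E (x + d) - E x)); last by ring.
  by apply: le_trans (ler_normD _ _) _; lra.
have left x : a <= x <= b -> H m x <= 0 -> `|E x - E a| <= (1 + C) * d.
  move=> /andP[ax xb] Hx; have [xad|axd] := leP x (a + d).
    apply: le_trans (cos_primitive_lipschitz ax (sub_dE _ _ (lexx a) xb)) _.
    have := mulr_ge0 C0 (ltW d0); lra.
  have ? : `|E x - E (x - d)| <= x - (x - d).
    by apply: (@cos_primitive_lipschitz H); [lra | apply: sub_dE; [lra|]].
  have ? : `|E (x - d) - E a| <= C * d.
    (* To the left of the zero [H m] is negative; changing the sign of the whole phase leaves the
       cosine unchanged. *)
    apply: (IH (fun m x => - H m x)) => //; first exact: derivativesN.
    - by lra.
    - by move=> y ayx; rewrite cosN; apply: sub_dE ayx => //; lra.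
    - move=> y /andP[ay yx]; have := slope y x ay.
      rewrite -lerBrDr => /(_ yx xb) h; apply: le_trans h _.
      by rewrite ler_wpM2l ?exprn_ge0 ?(ltW d0)//; lra.
    - move=> _; right => y /andP[ay yx]; rewrite oppr_le0.
      by apply: Hm1_ge0; apply/andP; split; lra.
  rewrite (_ : E x - E a = (E x - E (x - d)) + (E (x - d) - E a)); last by ring.
  by apply: le_trans (ler_normD _ _) _; lra.
have Cd : 0 <= (1 + C) * d by rewrite mulr_ge0 ?addr_ge0// ltW.
have [Ha|Ha] := leP 0 (H m a).
  by have := right a; rewrite lexx ab => /(_ isT Ha); lra.
have [Hb|Hb] := leP (H m b) 0.
  by have := left b; rewrite lexx ab => /(_ isT Hb); lra.
have [||c] := @IVT _ (H m) a b 0 ab.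
- by apply: is_derive_within_continuous => x _; exact: dH.
- by rewrite minEle maxEle (ltW (lt_trans Ha Hb)) !ltW.
rewrite in_itv/= => cab Hc.
have := right c cab; have := left c cab; rewrite Hc lexx => /(_ isT) h1 /(_ isT) h2.
rewrite (_ : E b - E a = (E b - E c) + (E c - E a)); last by ring.
by apply: le_trans (ler_normD _ _) _; lra.
Qed.

Lemma vdc_bound1 : vdc_bound true 1 3.
Proof.
move=> H E a b d dH ab d0 dE H1 /(_ isT) H2.
by apply: (@van_der_corput1 _ H) => // x /H1; rewrite expr1.
Qed.

Lemma van_der_corput m : exists2 C, 0 < C & vdc_bound false m.+2 C.
Proof.
elim: m => [|m [C C0 IH]].
  exists (2 * (1 + 3)); first by lra.
  by apply: vdc_bound_step => //; exact: vdc_bound1.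
exists (2 * (1 + C)); first by lra.
apply: vdc_bound_step; first exact: ltW.
by move=> H E a b d dH ab d0 dE Hm _; apply: (IH H).
Qed.

End van_der_corput.

(** * Oscillation of exponential sums *)

Section exponential_sums.
Context {R : realType}.

Lemma continuous_primitive (f : R -> R) (a b : R) : a <= b -> continuous f ->
  exists E, forall x, a <= x <= b -> is_derive x 1 E (f x).
Proof.
move=> ab cf.
(* Integration starts at [a - 1] so that [a] is interior and the derivative there is two-sided. *)
exists (fun x => \int[lebesgue_measure]_(t in `[a - 1, x]) f t)%R => x /andP[ax xb].
have [] := @continuous_FTC1 R f (BLeft (a - 1)) x (b + 1).
- by lra.
- by apply: continuous_compact_integrable; [exact: segment_compact|exact: continuous_subspaceT].
- by rewrite lte_fin; lra.
- exact: cf.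
by move=> dF <-; rewrite derive1E; exact: derivableP.
Qed.

(** Integration by parts: [P - (E - E a) * psi] has derivative [- (E - E a) * psi'], of size at most
    [B A], and the boundary term is at most [B A]. *)
Lemma amplitude_parts (E P c psi dpsi : R -> R) (a b A B : R) : a <= b ->
  (forall x, a <= x <= b -> is_derive x 1 E (c x)) ->
  (forall x, a <= x <= b -> is_derive x 1 P (c x * psi x)) ->
  (forall x, a <= x <= b -> is_derive x 1 psi (dpsi x)) ->
  (forall x, a <= x <= b -> `|E x - E a| <= B) ->
  (forall x, a <= x <= b -> `|psi x| <= A) ->
  (forall x, a <= x <= b -> `|dpsi x| <= A) ->
  `|P b - P a| <= B * A * (1 + (b - a)).
Proof.
move=> ab dE dP dpsiP EB psiA dpsiA.
have aab : a <= a <= b by rewrite lexx.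
have abb : a <= b <= b by rewrite lexx andbT.
have A0 : 0 <= A := le_trans (normr_ge0 _) (psiA _ aab).
have B0 : 0 <= B := le_trans (normr_ge0 _) (EB _ aab).
pose D := P - (E - cst (E a)) * psi.
have : `|D b - D a| <= B * A * b - B * A * a.
  apply: (@is_derive_increment_le _ _ (fun x => - ((E x - E a) * dpsi x))
    (fun x => B * A * x) (fun=> B * A)) => // x xab.
  - have ? := dE x xab; have ? := dP x xab; have ? := dpsiP x xab.
    rewrite /D; apply: is_derive_eq; rewrite !fctE /GRing.scale/=; ring.
  - by rewrite -[X in is_derive _ _ _ X]mulr1; apply: is_deriveZ.
  - by rewrite normrN normrM ler_pM ?EB ?dpsiA.
rewrite /D !fctE subrr mul0r subr0 => h.
rewrite (_ : P b - P a = P b - (E b - E a) * psi b - P a + (E b - E a) * psi b); last by ring.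
apply: le_trans (ler_normD _ _) _; rewrite mulrDr mulr1 addrC lerD//.
  by rewrite normrM ler_pM ?EB ?psiA.
by apply: le_trans h _; rewrite -mulrBr.
Qed.

Variables (K : nat) (beta : 'I_K -> R).
Hypothesis beta_inj : injective beta.
Hypothesis beta_neq0 : forall k, beta k != 0.

Implicit Types c : 'I_K -> R.

(* Up to a factor, the polynomial X * prod_(j != k) (X - beta_j) extracts c_k
   from the moments of orders 1, ..., K. *)
Lemma moment_lower_bound : (0 < K)%N ->
  exists2 A, 0 < A & forall c, exists2 m, (0 < m <= K)%N &
    \sum_k `|c k| <= A * `|\sum_k c k * beta k ^+ m|.
Proof.
move=> K0.
pose p k : {poly R} := 'X * \prod_(j | j != k) ('X - (beta j)%:P).
pose q k := (p k).[beta k].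
have pE k j : j != k -> (p k).[beta j] = 0.
  move=> jk; rewrite /p hornerM horner_prod (bigD1 j)//=.
  by rewrite hornerXsubC subrr mul0r mulr0.
have q0 k : q k != 0.
  rewrite /q /p hornerM hornerX mulf_neq0// horner_prod.
  apply/prodf_neq0 => j jk; rewrite hornerXsubC subr_eq0.
  by apply: contra jk => /eqP/beta_inj ->.
have p_size k : (size (p k) <= K.+1)%N.
  rewrite /p mulrC size_mulX ?ltnS.
    rewrite (leq_trans (size_poly_prod_leq _ _))//.
    under eq_bigr do rewrite size_XsubC.
    rewrite sum_nat_const leq_subLR.
    have := cardC1 k; rewrite card_ord => ->.
    by case: (K) K0 => // n _; rewrite /= addnS muln2 addnn.
  by apply/prodf_neq0 => j _; rewrite polyXsubC_eq0.
pose B := \sum_k \sum_(m < K.+1) `|(p k)`_m| / `|q k|.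
have B0 : 0 <= B by do 2 (apply: sumr_ge0 => ? _); rewrite divr_ge0.
have B1 : 0 < B + 1 by lra.
exists (B + 1) => //.
(* If every moment were below [M / (B + 1)], where [M] is the sum of the [|c k|], the extraction
   would give [M <= B M / (B + 1) < M]. The moment of order 0 never occurs, thanks to the factor
   [X]. *)
move=> c; apply: contrapT => hc.
have {}hc m : (0 < m <= K)%N -> (B + 1) * `|\sum_k c k * beta k ^+ m| < \sum_k `|c k|.
  by move=> mK; rewrite ltNge; apply/negP => h; apply: hc; exists m.
pose M := \sum_k `|c k|.
have M0 : 0 < M by apply: le_lt_trans (hc 1%N _) => //; rewrite mulr_ge0//; lra.
have ckE k : c k * q k = \sum_(m < K.+1) (p k)`_m * \sum_j c j * beta j ^+ m.
  under eq_bigr do rewrite mulr_sumr.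
  rewrite exchange_big/= (bigD1 k)//= [X in _ = _ + X]big1 ?addr0; last first.
    move=> j jk; transitivity (c j * (p k).[beta j]); last by rewrite pE ?mulr0.
    rewrite (horner_coef_wide _ (p_size k)) mulr_sumr.
    by apply: eq_bigr => m _; ring.
  rewrite /q (horner_coef_wide _ (p_size k)) mulr_sumr.
  by apply: eq_bigr => m _; ring.
have : M <= B * (M / (B + 1)).
  rewrite /M /B mulr_suml; apply: ler_sum => k _.
  rewrite -/M.
  have -> : `|c k| = `|c k * q k| / `|q k| by rewrite normrM mulfK ?normr_eq0.
  rewrite ckE -mulr_suml mulrAC ler_wpM2r ?invr_ge0//.
  apply: le_trans (ler_norm_sum _ _ _) _; rewrite mulr_suml; apply: ler_sum => m _.
  rewrite normrM; case: (posnP m) => [->|m0].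
    by rewrite /p coefXM normr0 !mul0r.
  rewrite ler_wpM2l// ler_pdivlMr//.
  by rewrite mulrC ltW// hc// m0 -ltnS ltn_ord.
rewrite mulrCA -ler_pdivrMl// mulVf ?gt_eqF// ler_pdivlMr//; lra.
Qed.

End exponential_sums.

Section oscillation.
Context {R : realType}.
Variables (K : nat) (beta : 'I_K -> R).
Hypothesis beta_inj : injective beta.
Hypothesis beta_neq0 : forall k, beta k != 0.

Implicit Types c : 'I_K -> R.

(** The derivative of order [m] of an exponential sum; the constant survives in order 0 only. The
    shift [theta] lets cosines stand for sines as well. *)
Definition expsum (theta : R) c (m : nat) (s : R) : R :=
  (if m == 0%N then theta else 0) + \sum_k c k * beta k ^+ m * expR (beta k * s).

Lemma derivatives_expsum theta c : derivatives (expsum theta c).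
Proof.
move=> m s.
rewrite (_ : expsum _ _ m = cst (if m == 0%N then theta else 0) +
  \sum_(k < K) (fun s => c k * beta k ^+ m * expR (beta k * s))); last first.
  by apply/funext => x; rewrite fctE fct_sumE.
rewrite /expsum/=; apply: is_deriveD.
rewrite (_ : \sum_k _ = \sum_k (c k * beta k ^+ m.+1 * expR (beta k * s)))//.
apply: is_derive_sum => k.
have ? : is_derive s 1 (fun s => beta k * s) (beta k).
  by rewrite -[X in is_derive _ _ _ X]mulr1; apply: is_deriveZ.
have ? : is_derive s 1 (expR \o (fun s => beta k * s)) (expR (beta k * s) * beta k).
  exact: is_derive1_comp.
apply: (is_derive_eq (is_deriveZ _ _)).
by rewrite /GRing.scale/= exprSr; ring.
Qed.

(** [d] stands for [|c k|^(-1/K)] up to a constant. The order [m] of the dominant derivative depends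
    on [c], whereas [kappa], [C] and [C0] depend on the exponents alone. The bound is stated at
    every [x] because [amplitude_parts] consumes it in that form. *)
Lemma expsum_oscillation : (0 < K)%N ->
  exists kappa C C0 : R, [/\ 0 < kappa <= 1, 0 < C, 0 < C0 &
    forall c (theta d : R) (E : R -> R) k, 0 < d <= 1 -> C0 <= d ^+ K * `|c k| ->
    (forall x : R, 0 <= x <= kappa ->
      is_derive x 1 E (cos (theta + \sum_k c k * expR (beta k * x)))) ->
    forall x : R, 0 <= x <= kappa -> `|E x - E 0| <= C * d].
Proof.
move=> K0; have [A A0 HA] := moment_lower_bound beta_inj beta_neq0 K0.
have {}HA c : exists2 m, (0 < m <= K)%N &
    \sum_k `|c k| <= A * `|\sum_k c k * beta k ^+ m| by exact: HA.
pose D : R := 1 + \sum_k \sum_(m < K.+3) `|beta k| ^+ m * expR `|beta k|.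
have D0 : 0 < D.
  by rewrite ltr_pwDl// sumr_ge0// => ? _; rewrite sumr_ge0// => ? _; rewrite mulr_ge0 ?expR_ge0.
have HD c (theta : R) m (s : R) : (0 < m <= K.+2)%N -> 0 <= s <= 1 ->
    `|expsum theta c m s| <= D * \sum_k `|c k|.
  move=> /andP[m0 mK] /andP[s0 s1].
  rewrite /expsum gtn_eqF// add0r; apply: le_trans (ler_norm_sum _ _ _) _.
  rewrite mulr_sumr; apply: ler_sum => k _.
  rewrite -mulrA normrM mulrC ler_wpM2r// /D.
  apply: (@le_trans _ _ (`|beta k| ^+ m * expR `|beta k|)).
    rewrite normrM normrX ler_wpM2l ?exprn_ge0// ger0_norm ?expR_ge0// ler_expR.
    apply: le_trans (ler_norm _) _; rewrite normrM (ger0_norm s0).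
    by rewrite ler_piMr.
  rewrite (bigD1 k)//= (bigD1 (Ordinal (mK : (m < K.+3)%N)))//= !addrA.
  rewrite (addrC 1) -!addrA lerDl; do ! apply: addr_ge0 => //;
    by do ! (apply: sumr_ge0 => ? _); rewrite ?mulr_ge0 ?expR_ge0.
have [Cv Cv_gt0 HCv] : exists2 C : nat -> R,
    (forall m, 0 < C m) & forall m, @vdc_bound R false m.+2 (C m).
  have [C HC] := choice (fun m => let: ex_intro2 C C0 HC := @van_der_corput R m in
    ex_intro (fun C => 0 < C /\ vdc_bound false m.+2 C) C (conj C0 HC)).
  by exists C => m; have [] := HC m.
(* Over a length [kappa] the derivative of order [m + 1], at most [D M], moves the one of order [m]
   by at most [M / (2 A)], half of its lower bound [M / A] at 0. *)
pose kappa : R := Num.min 1 (2 * A * D)^-1.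
have AD0 : 0 < 2 * A * D by rewrite !mulr_gt0.
have kappa0 : 0 < kappa by rewrite lt_min ltr01 invr_gt0.
have kappa1 : kappa <= 1 by rewrite ge_min lexx.
have kappaAD : kappa * (2 * A * D) <= 1.
  by rewrite -ler_pdivlMr// div1r ge_min lexx orbT.
pose C := 2 + 4 * A ^+ 2 * D / (2 * A) + \sum_(m < K) Cv m.
have sCv : 0 <= \sum_(m < K) Cv m by apply: sumr_ge0 => m _; exact: ltW.
have fA : 0 <= 4 * A ^+ 2 * D / (2 * A).
  by rewrite divr_ge0 ?mulr_ge0 ?exprn_ge0// ltW.
exists kappa, C, (2 * A); split; [by rewrite kappa0|by rewrite /C; lra|by lra|].
move=> c theta d E k /andP[d0 d1] Hk dE x /andP[x0 xk].
set M := \sum_k `|c k| in HD; have M_ge : 2 * A <= d ^+ K * M.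
  apply: le_trans Hk _; rewrite ler_wpM2l ?exprn_ge0 ?(ltW d0)//.
  by rewrite /M (bigD1 k)//= lerDl sumr_ge0.
have M0 : 0 < M.
  by rewrite -(pmulr_rgt0 _ (exprn_gt0 K d0)); apply: lt_le_trans M_ge; lra.
have [m /andP[m0 mK] Hm] := HA c; rewrite -/M in Hm.
pose H := expsum theta c.
have Hm0 : H m 0 = \sum_k c k * beta k ^+ m.
  rewrite /H /expsum gtn_eqF// add0r; apply: eq_bigr => j _.
  by rewrite mulr0 expR0 mulr1.
have dH : derivatives H := derivatives_expsum theta c.
have near_H (y : R) : 0 <= y <= x -> `|H m y - H m 0| <= M / (2 * A).
  move=> /andP[y0 yx].
  have [z /andP[z0 zy] ->] : exists2 z, 0 <= z <= y & H m y - H m 0 = H m.+1 z * (y - 0).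
    by apply: is_derive_MVT.
  rewrite subr0 normrM (ger0_norm y0).
  have : `|H m.+1 z| <= D * M.
    by apply: HD; [rewrite /= ltnS; exact: leqW|apply/andP; split; lra].
  move=> /(ler_wpM2r y0) h; apply: le_trans h _.
  rewrite ler_pdivlMr ?mulr_gt0// (_ : D * M * y * (2 * A) = (y * (2 * A * D)) * M); last by ring.
  rewrite ler_piMl ?(ltW M0)//; apply: le_trans kappaAD.
  by rewrite ler_wpM2r ?(ltW AD0)//; lra.
(* The sign [e] makes the dominant derivative positive; multiplying the phase by it does not affect
   the cosine. *)
have [e [e1 He]] : exists e : R, (e = 1 \/ e = -1) /\ M / A <= e * H m 0.
  have : M / A <= `|H m 0| by rewrite ler_pdivrMr// mulrC Hm0.
  case: (leP 0 (H m 0)) => h.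
    by rewrite ger0_norm// => ?; exists 1; split; [left|rewrite mul1r].
  by rewrite ltr0_norm// => ?; exists (-1); split; [right|rewrite mulN1r].
have HM (y : R) : 0 <= y <= x -> M / (2 * A) <= e * H m y.
  have MA2 : M / A = M / (2 * A) + M / (2 * A) by field; rewrite gt_eqF.
  move=> /near_H; rewrite MA2 in He.
  rewrite ler_norml => /andP[? ?].
  by case: e1 => e1; rewrite e1 in He *; lra.
(* As [d <= 1] and [m <= K], the assumption made with [d ^+ K] covers whichever order [m] occurs. *)
have dmM (y : R) : 0 <= y <= x -> 1 <= d ^+ m * (e * H m y).
  move=> yx; apply: (@le_trans _ _ (d ^+ m * (M / (2 * A)))); last first.
    by rewrite ler_pM2l ?exprn_gt0// HM.
  rewrite mulrA ler_pdivlMr ?mulr_gt0// mul1r; apply: le_trans M_ge _.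
  by rewrite ler_wpM2r ?(ltW M0)// ler_wiXn2l// ?(ltW d0).
pose H' := fun m s => e * H m s.
have dH' : derivatives H'.
  by move=> i s; have ? := dH i s; apply: is_deriveZ.
have dE' (y : R) : 0 <= y <= x -> is_derive y 1 E (cos (H' 0%N y)).
  move=> /andP[y0 yx]; have -> : cos (H' 0%N y) = cos (H 0%N y).
    by rewrite /H'; case: e1 => ->; rewrite ?mul1r// mulN1r cosN.
  rewrite /H /expsum/=; under eq_bigr do rewrite expr0 mulr1.
  by apply: dE; rewrite y0 (le_trans yx).
(* In order one no sign of [H' 2] is known, so the error of the integration by parts is bounded
   through [|H' 2| <= D M] and [H' 1 >= M / (2 A)]: it is of size [1 / M], at most a multiple of
   [d]. *)
case: m m0 mK Hm near_H Hm0 He HM dmM => // -[|m] _ mK Hm near_H Hm0 He HM dmM.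
  have D_M : D * M / (M / (2 * A)) ^+ 2 = 4 * A ^+ 2 * D / M.
    by field; rewrite !gt_eqF.
  have := @van_der_corput_parts R H' E (fun s => D * M / (M / (2 * A)) ^+ 2 * s)
    (fun=> D * M / (M / (2 * A)) ^+ 2) 0 x d dH' x0 d0 dE'.
  move=> h; apply: le_trans (h _ _ _) _.
  - by move=> y /dmM; rewrite expr1.
  - by move=> y _; rewrite -[X in is_derive _ _ _ X]mulr1; apply: is_deriveZ.
  - move=> y yx; have H1 := HM y yx; have MA : 0 < M / (2 * A) by rewrite divr_gt0 ?mulr_gt0.
    rewrite ler_pM ?invr_ge0 ?exprn_ge0 ?(le_trans _ H1) ?(ltW MA)//.
      rewrite /H' normrM; have -> : `|e| = 1 by case: e1 => ->; rewrite ?normrN normr1.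
      by rewrite mul1r; apply: HD => //; case/andP: yx => y0 yx; apply/andP; split; lra.
    rewrite lef_pV2 ?posrE ?exprn_gt0 ?(lt_le_trans MA)//.
    by rewrite lerXn2r ?nnegrE ?(ltW MA) ?(le_trans (ltW MA)).
  - rewrite D_M mulr0 subr0.
    have : 4 * A ^+ 2 * D / M * x <= 4 * A ^+ 2 * D / (2 * A) * d.
      have le1 : M^-1 <= (2 * A)^-1 * d.
        rewrite ler_pdivlMl ?mulr_gt0// ler_pdivrMr//; apply: le_trans M_ge _.
        by rewrite ler_wpM2r ?(ltW M0)// -[leRHS]expr1 ler_wiXn2l// ?(ltW d0).
      have le2 : M^-1 * x <= (2 * A)^-1 * d.
        by apply: (le_trans _ le1); rewrite ler_piMr ?invr_ge0 ?(ltW M0)//; lra.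
      rewrite -(mulrA _ M^-1) -(mulrA _ _ d) ler_wpM2l//.
      by rewrite !mulr_ge0 ?exprn_ge0 ?(ltW A0) ?(ltW D0).
    have := mulr_ge0 sCv (ltW d0); rewrite /C; lra.
have := HCv m H' E 0 x d dH' x0 d0 dE' dmM (fun h => False_ind _ (notF h)).
move=> h; apply: le_trans h _; rewrite ler_wpM2r ?(ltW d0)//.
rewrite /C (bigD1 (Ordinal (ltnW mK)))//=.
have : 0 <= \sum_(i < K | i != Ordinal (ltnW mK)) Cv i by apply: sumr_ge0 => i _; exact: ltW.
lra.
Qed.

End oscillation.

(** * Riemann sums of oscillating integrands *)

Section riemann_sums.
Context {R : realType}.

Definition riemann_sum (F : R -> R) (kappa : R) (N : nat) : R :=
  kappa / N%:R * \sum_(k < N) F (kappa * k%:R / N%:R).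

(** On each subinterval the increment of [P] is [kappa / N] times a value of [F] at an intermediate
    point, which is within [kappa / N] of the left endpoint. *)
Lemma riemann_sum_lipschitz (F P : R -> R) (kappa L : R) (N : nat) :
  0 <= kappa -> (0 < N)%N ->
  (forall x : R, 0 <= x <= kappa -> is_derive x 1 P (F x)) ->
  (forall x y : R, 0 <= x <= kappa -> 0 <= y <= kappa -> `|F x - F y| <= L * `|x - y|) ->
  `|riemann_sum F kappa N - (P kappa - P 0)| <= L * kappa ^+ 2 / N%:R.
Proof.
move=> k0 N0 dP lipF.
have Nn0 : N%:R != 0 :> R by rewrite pnatr_eq0 -lt0n.
have NR0 : 0 < N%:R :> R by rewrite ltr0n.
pose t k : R := kappa * k%:R / N%:R.
have tS k : t k.+1 - t k = kappa / N%:R.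
  by rewrite /t -mulrBl -mulrBr -natrB ?leqnSn// subSnn mulr1.
have tk k : (k <= N)%N -> 0 <= t k <= kappa.
  move=> kN; rewrite divr_ge0 ?mulr_ge0//= ler_pdivrMr// ler_wpM2l//.
  by rewrite ler_nat.
have kN0 : 0 <= kappa / N%:R by rewrite divr_ge0.
rewrite (_ : P kappa - P 0 = \sum_(k < N) (P (t k.+1) - P (t k))); last first.
  by rewrite -(big_mkord xpredT (fun k => P (t k.+1) - P (t k))) telescope_sumr//
     /t mulfK// mulr0 mul0r.
rewrite /riemann_sum mulr_sumr -sumrB; apply: le_trans (ler_norm_sum _ _ _) _.
rewrite (_ : L * kappa ^+ 2 / N%:R = \sum_(k < N) L * (kappa / N%:R) ^+ 2); last first.
  rewrite sumr_const card_ord -[RHS]mulr_natr; field; exact: Nn0.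
apply: ler_sum => k _; rewrite -/(t k).
have le_t : t k <= t k.+1 by rewrite -subr_ge0 tS.
have /andP[tk0 _] := tk k (ltnW (ltn_ord k)).
have /andP[_ tk1] := tk k.+1 (ltn_ord k).
have [c /andP[c1 c2] ->] : exists2 c, t k <= c <= t k.+1 &
    P (t k.+1) - P (t k) = F c * (t k.+1 - t k).
  apply: is_derive_MVT => // x /andP[x1 x2]; apply: dP.
  by rewrite (le_trans tk0 x1) (le_trans x2 tk1).
rewrite tS mulrC -mulrBl normrM (ger0_norm kN0) expr2 mulrA ler_wpM2r//.
have tkk : 0 <= t k <= kappa by rewrite tk0 (le_trans le_t).
have ck : 0 <= c <= kappa by rewrite (le_trans tk0 c1) (le_trans c2 tk1).
have L0 : 0 <= L \/ kappa = 0.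
  have [->|kn0] := eqVneq kappa 0; [by right|left].
  have := lipF 0 kappa; rewrite !lexx k0 => /(_ isT isT)/(le_trans (normr_ge0 _)).
  by rewrite pmulr_lge0// normr_gt0 sub0r oppr_eq0.
apply: le_trans (lipF _ _ tkk ck) _.
case: L0 => [L0|kappa0].
  by rewrite ler_wpM2l// -(tS k) ler0_norm; lra.
by move: tkk ck; rewrite kappa0 mul0r -!eq_le => /eqP <- /eqP <-; rewrite subrr normr0.
Qed.

Lemma cos_lipschitz (x y : R) : `|cos x - cos y| <= `|x - y|.
Proof.
wlog xy : x y / x <= y.
  by move=> h; have [/h//|/ltW/h] := leP x y; rewrite distrC (distrC y).
rewrite distrC (distrC x).
have [c _ ->] : exists2 c, x <= c <= y & cos y - cos x = - sin c * (y - x).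
  by apply: is_derive_MVT.
by rewrite normrM normrN -[leRHS]mul1r ler_wpM2r// ler_norml sin_geN1 sin_le1.
Qed.

Variables (K : nat) (beta : 'I_K -> R).
Hypothesis beta_inj : injective beta.
Hypothesis beta_neq0 : forall k, beta k != 0.

(** The limit [I] is the integral over [[0, kappa]], obtained as the increment of a primitive. One
    [I] serves every [k] and [d], and the constants depend on [beta] only, so the estimate can be
    used at each point [x] of space with its own coefficients and amplitude. *)
Lemma averaged_oscillation : (0 < K)%N ->
  exists kappa C C0 : R, [/\ 0 < kappa <= 1, 0 < C, 0 < C0 &
    forall (c : 'I_K -> R) (theta A : R) (psi dpsi : R -> R),
    (forall s : R, is_derive s 1 psi (dpsi s)) ->
    (forall s : R, 0 <= s <= kappa -> `|psi s| <= A) ->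
    (forall s : R, 0 <= s <= kappa -> `|dpsi s| <= A) ->
    exists2 I : R,
      riemann_sum (fun s => cos (theta + \sum_k c k * expR (beta k * s)) * psi s)
        kappa N @[N --> \oo] --> I &
      forall k (d : R), 0 < d <= 1 -> C0 <= d ^+ K * `|c k| -> `|I| <= C * A * d].
Proof.
move=> K0; have [kappa [C [C0 [k01 Cp C0p osc]]]] :=
  expsum_oscillation beta_inj beta_neq0 K0.
have /andP[k0 k1] := k01.
exists kappa, (C * (1 + kappa)), C0; split => //.
  by rewrite mulr_gt0// addr_gt0.
move=> c theta A psi dpsi dpsiP psiA dpsiA.
pose h s : R := theta + \sum_k c k * expR (beta k * s).
have hE : h = expsum beta theta c 0.
  by apply/funext => s; rewrite /h /expsum/=; under [in RHS]eq_bigr do rewrite expr0 mulr1.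
have dh (s : R) : is_derive s 1 h (expsum beta theta c 1 s).
  by rewrite hE; apply: derivatives_expsum.
have der_cont (f df : R -> R) : (forall s : R, is_derive s 1 f (df s)) -> continuous (f : R -> R).
  by move=> dfP s; apply/differentiable_continuous/derivable1_diffP; have [] := dfP s.
have ch : continuous (cos \o h).
  by move=> s; apply: continuous_comp; [exact: der_cont dh _|exact: continuous_cos].
have cpsi : continuous psi := der_cont _ _ dpsiP.
have [E dE] := continuous_primitive (ltW k0) ch.
have [P dP] := @continuous_primitive _ (fun s => cos (h s) * psi s) _ _ (ltW k0)
  (fun s => continuousM (ch s) (cpsi s)).
have k00 : 0 <= (0 : R) <= kappa by rewrite lexx ltW.
have A0 : 0 <= A := le_trans (normr_ge0 _) (psiA _ k00).
exists (P kappa - P 0); last first.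
  move=> k d d01 Hk.
  have := @amplitude_parts _ E P (cos \o h) psi dpsi 0 kappa A (C * d) (ltW k0) dE dP.
  move=> /(_ (fun x _ => dpsiP x)) H; apply: le_trans (H _ psiA dpsiA) _.
    by move=> x xk; apply: (osc c theta d E k).
  by rewrite subr0 le_eqVlt; apply/orP; left; apply/eqP; ring.
pose Lh := \sum_k `|c k| * `|beta k| * expR `|beta k|.
have Lh0 : 0 <= Lh by apply: sumr_ge0 => k _; rewrite !mulr_ge0 ?expR_ge0.
have lip (f df : R -> R) (M : R) : (forall s : R, is_derive s 1 f (df s)) ->
    (forall s : R, 0 <= s <= kappa -> `|df s| <= M) ->
    forall x y : R, 0 <= x <= kappa -> 0 <= y <= kappa -> `|f x - f y| <= M * `|x - y|.
  move=> dfP dfM; suff wl (x y : R) : 0 <= x <= kappa -> 0 <= y <= kappa -> x <= y ->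
      `|f x - f y| <= M * `|x - y|.
    move=> x y xk yk; have [/wl|/ltW/wl] := leP x y; first exact.
    by rewrite distrC (distrC y); exact.
  move=> /andP[x0 xk] /andP[y0 yk] xy.
  have [z /andP[z1 z2]] : exists2 z, x <= z <= y & f y - f x = df z * (y - x).
    by apply: is_derive_MVT => // s _; exact: dfP.
  rewrite distrC => ->; rewrite normrM (distrC x) ler_wpM2r// dfM//.
  by rewrite (le_trans x0 z1) (le_trans z2 yk).
have liph (x y : R) : 0 <= x <= kappa -> 0 <= y <= kappa -> `|h x - h y| <= Lh * `|x - y|.
  apply: (lip _ _ _ dh) => s /andP[s0 sk].
  rewrite /expsum/= add0r; apply: le_trans (ler_norm_sum _ _ _) _.
  apply: ler_sum => k _; rewrite !normrM expr1 ler_wpM2l ?mulr_ge0//.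
  rewrite ger0_norm ?expR_ge0// ler_expR; apply: le_trans (ler_norm _) _.
  by rewrite normrM (ger0_norm s0) ler_piMr// (le_trans sk).
have lippsi := lip _ _ _ dpsiP dpsiA.
pose L := Lh * A + A.
have L0 : 0 <= L by rewrite addr_ge0// mulr_ge0.
apply/cvgrPdist_le => e e0.
near=> N.
have N0 : (0 < N)%N by near: N; exists 1%N.
rewrite distrC; apply: le_trans (@riemann_sum_lipschitz _ P _ L _ (ltW k0) N0 _ _) _.
- move=> x y xk yk /=.
  rewrite -/(h x) -/(h y) (_ : cos (h x) * psi x - _ =
    (cos (h x) - cos (h y)) * psi x + cos (h y) * (psi x - psi y)); last by ring.
  apply: le_trans (ler_normD _ _) _; rewrite /L [leRHS]mulrDl lerD//.
    rewrite normrM mulrAC ler_pM ?psiA//.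
    by apply: le_trans (cos_lipschitz _ _) _; exact: liph.
  rewrite normrM -[leRHS]mul1r ler_pM ?lippsi//.
  by rewrite ler_norml cos_geN1 cos_le1.
- rewrite ler_pdivrMr ?ltr0n// -ler_pdivrMl//.
  by near: N; exact: nbhs_infty_ger.
Unshelve. all: by end_near. Qed.

End riemann_sums.

(** * Lebesgue measure on R^n *)

Section lebesgue_rV_facts.
Context {R : realType} {n : nat}.
Local Notation T := (lebesgue_rV R n).
Local Notation mu := (lebesgue_measure_rV R n).
Local Notation leb := (@leb R n).
Implicit Types (u w v x : 'rV[R]_n) (A X : set 'rV[R]_n).

Definition diag_affine w v x : 'rV[R]_n := \row_i (w ord0 i * x ord0 i + v ord0 i).

Lemma box_volume_ge0 u v : 0 <= @box_volume R n u v.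
Proof. by apply: prodr_ge0 => i _; rewrite le_max lexx. Qed.

(** The preimage of a half-open box is again one, with volume divided by the product of the [w i];
    covers therefore pull back to covers. *)
Lemma leb_diag_affine_le w v A : (forall i, 0 < w ord0 i) ->
  ((\prod_i w ord0 i)%:E * leb (diag_affine w v @^-1` A) <= leb A)%E.
Proof.
move=> w0; have W0 : 0 < \prod_i w ord0 i by apply: prodr_gt0.
apply: le_ereal_inf_tmp => _ [D [lo [hi [cov ->]]]].
pose sh u : 'rV[R]_n := \row_i ((u ord0 i - v ord0 i) / w ord0 i).
have vol k : (box_volume (lo k) (hi k))%:E =
    ((\prod_i w ord0 i)%:E * (box_volume (sh (lo k)) (sh (hi k)))%:E)%E.
  rewrite -EFinM /box_volume -big_split/=; congr _%:E; apply: eq_bigr => i _.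
  rewrite !mxE -mulrBl opprB addrA subrK.
  rewrite maxr_pMr ?(ltW (w0 i))// mulr0 mulrCA divff ?mulr1// gt_eqF//.
rewrite (eq_eseriesr (fun k _ => vol k)) nneseriesZl; last first.
  by move=> k _; rewrite lee_fin box_volume_ge0.
rewrite lee_pmul2l ?lte_fin//; apply: ereal_inf_lbound.
exists D, (sh \o lo), (sh \o hi); split => // x /cov[k Dk hk]; exists k => // i.
have := hk i; rewrite !mxE.
by rewrite ltr_pdivrMr// ler_pdivlMr// ltrBlDr lerBrDr (mulrC (x _ _)).
Qed.

Lemma diag_affineK w v : (forall i, 0 < w ord0 i) ->
  let w' : 'rV[R]_n := \row_i (w ord0 i)^-1 in
  let v' : 'rV[R]_n := \row_i (- v ord0 i / w ord0 i) in
  cancel (diag_affine w v) (diag_affine w' v') /\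
  cancel (diag_affine w' v') (diag_affine w v).
Proof.
move=> w0 w' v'; split => x; apply/rowP => i; rewrite !mxE; field; by rewrite gt_eqF.
Qed.

(** The converse inequality is the previous one for the inverse map. *)
Lemma leb_diag_affine w v A : (forall i, 0 < w ord0 i) ->
  leb (diag_affine w v @^-1` A) = ((\prod_i w ord0 i)^-1%:E * leb A)%E.
Proof.
move=> w0; have W0 : 0 < \prod_i w ord0 i by apply: prodr_gt0.
have [/= _ vK] := diag_affineK v w0.
apply/eqP; rewrite eq_le; apply/andP; split.
  rewrite -(@lee_pmul2l _ (\prod_i w ord0 i)%:E)// ?lte_fin//.
  by rewrite muleA -EFinM divff ?gt_eqF// mul1e leb_diag_affine_le.
rewrite -prodfV (eq_bigr (fun i => (\row_i (w ord0 i)^-1) ord0 i)); last first.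
  by move=> i _; rewrite mxE.
set v' := \row_i (- v ord0 i / w ord0 i) in vK.
have -> : A = diag_affine (\row_i (w ord0 i)^-1) v' @^-1` (diag_affine w v @^-1` A).
  by apply/seteqP; split => x /=; rewrite vK.
rewrite {2}(_ : _ @^-1` (_ @^-1` A) = A); last by apply/seteqP; split => x /=; rewrite vK.
by apply: leb_diag_affine_le => i; rewrite mxE invr_gt0.
Qed.

(** Every test set is a preimage under the bijection, so the scaling factor comes out of the
    Caratheodory condition and leaves that of [A]. *)
Lemma diag_affine_measurable w v : (forall i, 0 < w ord0 i) ->
  measurable_fun [set: T] (diag_affine w v : T -> T).
Proof.
move=> w0 _ A mA; rewrite setTI.
change (caratheodory_measurable leb (diag_affine w v @^-1` A)) => X.
have [/= wK _] := diag_affineK v w0.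
set g := diag_affine (\row_i (w ord0 i)^-1) _ in wK.
have XE : X = diag_affine w v @^-1` (g @^-1` X).
  by apply/seteqP; split => x /=; rewrite wK.
rewrite XE preimage_setC -!preimage_setI !(@leb_diag_affine w v)//.
rewrite -ge0_muleDr ?outer_measure_ge0//; congr (_ * _)%E.
exact: (mA : caratheodory_measurable leb A).
Qed.

(** The interval []l, h]] is cut at [c]; either piece may be empty. *)
Lemma interval_length_split (l h c : R) :
  Num.max 0 (h - l) = Num.max 0 (Num.min h c - l) + Num.max 0 (h - Num.max l c).
Proof.
have [hl|lh] := leP h l.
  have h1 : h - l <= 0 by lra.
  have h2 : Num.min h c - l <= 0 by rewrite subr_le0 ge_min hl.
  have h3 : h - Num.max l c <= 0 by rewrite subr_le0 le_max hl.
  by rewrite (max_l h1) (max_l h2) (max_l h3) addr0.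
have [hc|ch] := leP h c.
  by rewrite (max_r (le_trans (ltW lh) hc)) [X in _ = _ + X]max_l ?addr0 ?subr_le0.
have [cl|lc] := leP c l.
  by rewrite [X in _ = X + _]max_l ?add0r ?subr_le0.
by rewrite !max_r ?subr_ge0 ?(ltW lc) ?(ltW lh) ?(ltW ch)//; ring.
Qed.

(** The hyperplane [x_i = c] cuts each half-open box into two half-open boxes whose volumes add up,
    so a cover of [X] splits into covers of its two parts with the same total volume. *)
Lemma halfspace_measurable i c :
  measurable ([set x | x ord0 i <= c] : set T).
Proof.
apply: le_caratheodory_measurable => X.
apply: le_ereal_inf_tmp => _ [D [lo [hi [cov ->]]]].
pose hi' k : 'rV[R]_n := \row_j (if j == i then Num.min (hi k ord0 j) c else hi k ord0 j).
pose lo' k : 'rV[R]_n := \row_j (if j == i then Num.max (lo k ord0 j) c else lo k ord0 j).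
have vol k : (box_volume (lo k) (hi k))%:E =
  ((box_volume (lo k) (hi' k))%:E + (box_volume (lo' k) (hi k))%:E)%E.
  rewrite -EFinD; congr _%:E; rewrite /box_volume.
  rewrite (bigD1 i)//= [X in _ = X + _](bigD1 i)//= [X in _ = _ + X](bigD1 i)//=.
  rewrite !mxE eqxx (interval_length_split _ _ c) mulrDl; congr (_ * _ + _ * _).
    by apply: eq_bigr => j /negbTE ji; rewrite mxE ji.
  by apply: eq_bigr => j /negbTE ji; rewrite mxE ji.
rewrite (eq_eseriesr (fun k _ => vol k)) nneseriesD; last 2 first.
  by move=> k _ _; rewrite lee_fin box_volume_ge0.
  by move=> k _ _; rewrite lee_fin box_volume_ge0.
apply: leeD; apply: ereal_inf_lbound.
- exists D, lo, hi'; split => // x [/cov[k Dk hk] xc]; exists k => // j.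
  rewrite mxE; have /andP[-> h] := hk j; case: ifP => //= /eqP ji.
  by rewrite le_min h ji.
- exists D, lo', hi; split => // x [/cov[k Dk hk] /= /negP]; rewrite -ltNge => xc.
  exists k => // j; rewrite mxE; have /andP[h ->] := hk j.
  by rewrite andbT; case: ifP => //= /eqP ji; rewrite gt_max h ji.
Qed.

Lemma coord_measurable i : measurable_fun [set: T] (fun x : T => x ord0 i).
Proof.
apply: (measurability _ (measurable_realfun.RGenOInfty.measurableE R)) => _ [_ [c ->] <-].
rewrite setTI [X in measurable X](_ : _ = ~` [set x : T | x ord0 i <= c]).
  exact: measurableC (halfspace_measurable i c).
by apply/seteqP; split => x /=; rewrite in_itv/= andbT ltNge => /negP.
Qed.

Lemma leb_box_le u v : (leb (box u v) <= (box_volume u v)%:E)%E.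
Proof.
apply: ereal_inf_lbound.
exists (pred1 0%N), (fun=> u), (fun=> v); split; first by move=> x uv; exists 0%N.
rewrite (nneseriesD1 (n := 0%N))//=; last by move=> k _; rewrite lee_fin box_volume_ge0.
by rewrite eseries_pred0 ?adde0// => k; case: k.
Qed.

Lemma leb_scaled_cube_le (M : R) : 0 <= M ->
  (leb [set x | forall i, (- M <= x ord0 i <= M)%R] <= ((2 * M + 1) ^+ n)%:E)%E.
Proof.
move=> M0.
(* Boxes are open on the left, so the closed cube is put in a box whose lower corner is moved by
   1. *)
have vol : (box_volume (const_mx (- M - 1) : 'rV[R]_n) (const_mx M)) = (2 * M + 1) ^+ n.
  rewrite /box_volume (eq_bigr (fun=> 2 * M + 1)); first by rewrite prodr_const card_ord.
  by move=> i _; rewrite !mxE max_r; lra.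
rewrite -vol; apply: le_trans (leb_box_le _ _); apply: le_outer_measure => x xM i.
by rewrite !mxE; have /andP[h ->] := xM i; rewrite andbT (lt_le_trans _ h)//; lra.
Qed.

Lemma cube_measurable : measurable (@cube R n : set T).
Proof.
rewrite (_ : @cube R n = \bigcap_i [set x | -1 <= x ord0 i <= 1]); last first.
  by apply/seteqP; split => x h i; [move=> _|]; apply: h.
apply: fin_bigcap_measurable => // i _.
rewrite [X in measurable X](_ : _ = [set: T] `&` (fun x : T => x ord0 i) @^-1` `[-1, 1]%classic).
  exact: coord_measurable.
by apply/seteqP; split => x /=; rewrite in_itv/=; [|case].
Qed.

Lemma leb_set1_0 : (0 < n)%N -> leb [set 0] = 0%E.
Proof.
move=> n0; apply/eqP; rewrite eq_le outer_measure_ge0 andbT.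
apply/lee_addgt0Pr => e e0; rewrite add0e.
pose d := Num.min e 1; have d0 : 0 < d by rewrite lt_min e0/=.
apply: (@le_trans _ _ (leb (box (const_mx (- d)) (const_mx 0 : 'rV[R]_n)))).
  by apply: le_outer_measure => x ->  i; rewrite !mxE lexx oppr_lt0 d0.
apply: le_trans (leb_box_le _ _) _; rewrite lee_fin /box_volume.
rewrite (eq_bigr (fun=> d)); last by move=> i _; rewrite !mxE opprK add0r max_r// ltW.
rewrite prodr_const card_ord -(prednK n0) exprS.
apply: (@le_trans _ _ (d * 1)).
  by rewrite ler_wpM2l ?(ltW d0)// exprn_ile1 ?(ltW d0)// ge_min lexx orbT.
by rewrite mulr1 ge_min lexx.
Qed.

End lebesgue_rV_facts.

(** * Change of variables under diagonal maps and dilations *)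

Section change_of_variables.
Context {R : realType} {n : nat}.
Local Notation T := (lebesgue_rV R n).
Local Notation mu := (lebesgue_measure_rV R n).

Lemma ge0_integral_diag_affine (w v : 'rV[R]_n) (F : T -> \bar R) :
  (forall i, 0 < w ord0 i) ->
  measurable_fun [set: T] F -> (forall x, (0 <= F x)%E) ->
  (\int[mu]_x F (diag_affine w v x) =
   ((\prod_i w ord0 i)^-1)%:E * \int[mu]_x F x)%E.
Proof.
move=> w0 mF F0; have W0 : 0 < \prod_i w ord0 i by apply: prodr_gt0.
have mg := diag_affine_measurable v w0.
have := @ge0_integral_pushforward _ _ T T R (diag_affine w v) mg mu setT F
  measurableT mF (fun x _ => F0 x).
rewrite preimage_setT => <-.
have Wi : 0 <= (\prod_i w ord0 i)^-1 by rewrite invr_ge0 ltW.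
rewrite -(@ge0_integral_mscale _ T R mu setT measurableT (NngNum Wi) F)//.
apply: eq_measure_integral => A mA _.
by rewrite /= /pushforward /mscale/=; exact: leb_diag_affine.
Qed.

Lemma integral_diag_affine (w v : 'rV[R]_n) (F : T -> R) :
  (forall i, 0 < w ord0 i) -> mu.-integrable setT (EFin \o F) ->
  mu.-integrable setT (EFin \o (fun x => F (diag_affine w v x))) /\
  \int[mu]_x F (diag_affine w v x) = (\prod_i w ord0 i)^-1 * \int[mu]_x F x.
Proof.
move=> w0 iF; have /integrableP[mF Foo] := iF.
have mFw : measurable_fun [set: T] (fun x : T => (F (diag_affine w v x))%:E).
  by apply: (measurableT_comp mF); exact: diag_affine_measurable.
have iFw : mu.-integrable setT (EFin \o (fun x => F (diag_affine w v x))).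
  apply/integrableP; split; first exact: mFw.
  rewrite (ge0_integral_diag_affine v (F := fun x => `|(F x)%:E|%E))//; last exact: measurableT_comp.
  by rewrite lte_mul_pinfty// lee_fin invr_ge0 ltW// prodr_gt0.
split=> //; rewrite /Rintegral integralE [in RHS]integralE.
rewrite (_ : (fun x => (F (diag_affine w v x))%:E) = (EFin \o F) \o diag_affine w v)//.
rewrite funepos_comp funeneg_comp.
rewrite (ge0_integral_diag_affine v (F := (EFin \o F)^\+%E))//; last exact: measurable_funepos.
rewrite (ge0_integral_diag_affine v (F := (EFin \o F)^\-%E))//; last exact: measurable_funeneg.
have fp := integrable_pos_fin_num measurableT iF.
have fn := integrable_neg_fin_num measurableT iF.
rewrite -muleBr//; last by rewrite fin_num_adde_defr// fin_numN.
by rewrite fineM// fin_numB fp fn.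
Qed.

(** The dilation of parameter [exp s] multiplies Lebesgue measure by [exp(Q s)], where [Q] is this
    number. *)
Definition homogeneous_dim (a : 'I_n -> R) : R := \sum_i (a i)^-1.

Lemma expR_powR (s y : R) : expR s `^ y = expR (y * s).
Proof. by rewrite /powR gt_eqF ?expR_gt0// expRK. Qed.

Lemma dilate_diag_affine (a : 'I_n -> R) (s : R) :
  dilate a (expR s) = diag_affine (\row_i expR ((a i)^-1 * s)) 0.
Proof. by apply/funext => x; apply/rowP => i; rewrite !mxE expR_powR addr0. Qed.

Lemma prod_dilate (a : 'I_n -> R) (s : R) :
  \prod_i (\row_i expR ((a i)^-1 * s) : 'rV[R]_n) ord0 i = expR (homogeneous_dim a * s).
Proof.
rewrite /homogeneous_dim mulr_suml expR_sum; apply: eq_bigr => i _; by rewrite mxE.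
Qed.

Lemma dilate_measurable (a : 'I_n -> R) (s : R) :
  measurable_fun [set: T] (dilate a (expR s) : T -> T).
Proof.
by rewrite dilate_diag_affine; apply: diag_affine_measurable => i; rewrite mxE expR_gt0.
Qed.

Lemma ge0_integral_dilate (a : 'I_n -> R) (s : R) (F : T -> \bar R) :
  measurable_fun [set: T] F -> (forall x, (0 <= F x)%E) ->
  (\int[mu]_x F x =
   (expR (homogeneous_dim a * s))%:E * \int[mu]_x F (dilate a (expR s) x))%E.
Proof.
move=> mF F0; rewrite dilate_diag_affine ge0_integral_diag_affine//; last first.
  by move=> i; rewrite mxE expR_gt0.
by rewrite prod_dilate muleA -EFinM divff ?mul1e// gt_eqF// expR_gt0.
Qed.

Lemma integral_dilate (a : 'I_n -> R) (s : R) (F : T -> R) :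
  mu.-integrable setT (EFin \o F) ->
  mu.-integrable setT (EFin \o (fun x => F (dilate a (expR s) x) * expR (homogeneous_dim a * s))) /\
  \int[mu]_x (F (dilate a (expR s) x) * expR (homogeneous_dim a * s)) = \int[mu]_x F x.
Proof.
move=> iF; rewrite dilate_diag_affine.
have w0 i : 0 < (\row_i expR ((a i)^-1 * s) : 'rV[R]_n) ord0 i by rewrite mxE expR_gt0.
have [iFw eF] := integral_diag_affine 0 w0 iF.
split; first exact: (integrableZr measurableT (expR (homogeneous_dim a * s)) iFw).
rewrite RintegralZr// eF prod_dilate mulrAC mulVf ?mul1r//.
by rewrite gt_eqF// expR_gt0.
Qed.

End change_of_variables.

(** * Sublevel sets *)

Lemma measurable_sublevel d (T : measurableType d) (R : realType) (u : T -> R) (t : R) :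
  measurable_fun [set: T] u -> measurable [set x | u x < t].
Proof.
move=> mu_; rewrite -[X in measurable X]setTI.
by apply: (measurable_fun_ltr mu_ (measurable_cst t)).
Qed.

Section dyadic.
Context d {T : measurableType d} {R : realType}.
Variable mu : {measure set T -> \bar R}.
Variable D : set T.
Hypothesis mD : measurable D.
Implicit Types (g u W : T -> R).

(** The positive part [E N] of [|S N| - W] tends to 0 pointwise and is dominated by [g], and
    [|S N| <= W + E N]. The limits [I] are only compared with [W] pointwise, never integrated. *)
Lemma le_integral_limit (S : nat -> T -> R) g W (T0 : R) :
  measurable_fun [set: T] W -> (forall x, 0 <= W x) ->
  mu.-integrable D (EFin \o g) ->
  (forall N, measurable_fun [set: T] (S N)) ->
  (forall N x, D x -> `|S N x| <= g x) ->
  (forall x, D x -> exists2 I : R, S N x @[N --> \oo] --> I & `|I| <= W x) ->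
  (forall N, (0 < N)%N -> (T0%:E <= \int[mu]_(x in D) `|S N x|%:E)%E) ->
  (T0%:E <= \int[mu]_(x in D) (W x)%:E)%E.
Proof.
move=> mW W0 ig mS Sg SI T0_le.
pose E N x := Num.max (`|S N x| - W x) 0.
have mE N : measurable_fun [set: T] (E N).
  apply: measurable_maxr => //; apply: measurable_funB => //.
  exact: measurableT_comp.
have E0 N x : 0 <= E N x by rewrite le_max lexx orbT.
have W0e x : (0 <= (W x)%:E)%E by rewrite lee_fin.
have E0e N x : (0 <= (E N x)%:E)%E by rewrite lee_fin.
have mEe N : measurable_fun D (EFin \o E N).
  by apply/measurable_EFinP; exact: measurable_funTS.
have mWe : measurable_fun D (EFin \o W).
  by apply/measurable_EFinP; exact: measurable_funTS.
have Ecvg x : D x -> (E N x)%:E @[N --> \oo] --> 0%E.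
  move=> Dx; have [I SxI IW] := SI x Dx.
  suff h : E ^~ x @ \oo --> (0 : R) by apply/fine_cvgP; split => //; exact: nearW.
  have cvgSx : `|S N x| @[N --> \oo] --> `|I| by exact: cvg_norm.
  apply/cvgrPdist_le => e e0; near=> N.
  rewrite sub0r normrN ger0_norm// ge_max (ltW e0) andbT.
  have : `| `|I| - `|S N x| | <= e.
    by near: N; move/cvgrPdist_le : cvgSx; exact.
  by rewrite ler_norml => /andP[]; lra.
have Eg N x : D x -> (`|(EFin \o E N) x| <= (EFin \o g) x)%E.
  move=> Dx; rewrite /= lee_fin ger0_norm// ge_max (le_trans (normr_ge0 _) (Sg N x Dx)) andbT.
  by apply: le_trans (Sg N x Dx); rewrite gerBl.
have [_ _ Ei] := @dominated_convergence _ T R mu D mD (fun N => EFin \o E N) (cst 0)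
  (EFin \o g) mEe (measurable_cst _) (aeW _ Ecvg) ig (aeW _ (fun x N => Eg N x)).
rewrite integral_cst// mul0e in Ei.
have : (\int[mu]_(x in D) (W x)%:E + \int[mu]_(x in D) (E N x)%:E)%E
    @[N --> \oo] --> (\int[mu]_(x in D) (W x)%:E + 0)%E.
  exact: (cvgeD (fin_num_adde_defl _ _) (cvg_cst _) Ei).
rewrite adde0 => h; apply: (cvge_to_ge h).
near=> N; have N0 : (0 < N)%N by near: N; exists 1%N.
apply: le_trans (T0_le N N0) _.
rewrite -(ge0_integralD mu mD (fun x _ => W0e x) mWe (fun x _ => E0e N x) (mEe N)).
apply: ge0_le_integral => //.
- by apply/measurable_EFinP; apply: measurableT_comp => //; exact: measurable_funTS.
- by apply/measurable_EFinP/measurable_funD; exact: measurable_funTS.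
- by move=> x Dx; rewrite lee_fin -lerBlDl le_max lexx.
Unshelve. all: by end_near. Qed.

(** The thresholds [t j] are such that the hypothesis with [r = 2^(-j-1)] applies off [U j].
    Integrated, the layers give [2^(-j) B (t j)^eps], that is [L^(-eps)] times a geometric series of
    ratio [2^(-(1 - K eps))], convergent because [K eps < 1]. *)
Lemma dyadic_average (S : nat -> T -> R) g u (A B C C0 L G eps T0 : R) (K : nat) :
  measurable_fun [set: T] g -> (forall x, 0 <= g x) ->
  measurable_fun [set: T] u ->
  (\int[mu]_(x in D) (g x)%:E <= G%:E)%E ->
  (forall t : R, 0 < t ->
    (\int[mu]_(x in D `&` [set x | (u x < t)%R]) (g x)%:E <= (B * t `^ eps)%:E)%E) ->
  0 < eps -> K%:R * eps < 1 -> 0 <= A -> A <= C -> 0 <= B -> 0 < C0 -> 0 < L ->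
  (forall N, measurable_fun [set: T] (S N)) ->
  (forall N x, D x -> `|S N x| <= A * g x) ->
  (forall x, D x -> exists2 I : R, S N x @[N --> \oo] --> I &
    forall r : R, 0 < r <= 1 -> C0 <= r ^+ K * (L * u x) -> `|I| <= C * g x * r) ->
  (forall N, (0 < N)%N -> (T0%:E <= \int[mu]_(x in D) `|S N x|%:E)%E) ->
  T0 <= C * (B * (C0 * 2 ^+ K) `^ eps / (1 - 2^-1 `^ (1 - K%:R * eps)) + 1) * L `^ (- eps).
Proof.
move=> mg g0 mu_ gG guB eps0 Keps A0 AC B0 C00 L0 mS SA SI T0_le.
pose h : R := 2^-1.
have h0 : 0 < h by rewrite invr_gt0.
have h1 : h < 1 by rewrite invf_lt1// ltr1n.
pose t j : R := C0 * 2 ^+ (j.+1 * K) / L.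
have t0 j : 0 < t j by rewrite divr_gt0// mulr_gt0// exprn_gt0.
pose U j := [set x | u x < t j].
have mU j : measurable (U j).
  exact: measurable_sublevel.
(* Dyadic majorant of [|I|]: on [U j] minus the smaller ones the bound with
   [r = 2^-j] applies. *)
pose W J x : R := C * g x * (\sum_(j < J) h ^+ j * \1_(U j) x + h ^+ J).
have C_ge0 : 0 <= C := le_trans A0 AC.
have W0 J x : 0 <= W J x.
  rewrite !mulr_ge0// addr_ge0// ?exprn_ge0 ?(ltW h0)//.
  by apply: sumr_ge0 => j _; rewrite mulr_ge0 ?exprn_ge0 ?(ltW h0).
have mW J : measurable_fun [set: T] (W J).
  apply: measurable_funM; first exact: measurable_funM.
  apply: measurable_funD => //; apply: measurable_sum => j.
  by apply: measurable_funM => //; exact: measurable_indic.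
have ig : mu.-integrable D (EFin \o (fun x => A * g x)).
  suff ig : mu.-integrable D (EFin \o g) by exact: (integrableZl mD A ig).
  apply/integrableP; split.
    by apply/measurable_EFinP; exact: measurable_funTS.
  rewrite (eq_integral (fun x => (g x)%:E)); last by move=> x _; rewrite /= ger0_norm.
  by apply: le_lt_trans gG _; rewrite ltry.
have SW J x : D x -> exists2 I : R, S N x @[N --> \oo] --> I & `|I| <= W J x.
  move=> Dx; have [I SxI HI] := SI x Dx; exists I => //.
  have IA : `|I| <= A * g x.
    apply: (cvgr_to_le (cvg_norm SxI)); apply: nearW => N; exact: SA.
  (* On [U J] the new indicator term replaces the old remainder [h ^+ J]; off [U J] the bound with
     [r = h ^+ J.+1] is the new remainder. *)
  elim: J => [|J IH].
    rewrite /W big_ord0 add0r expr0 mulr1; apply: le_trans IA _.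
    by rewrite ler_wpM2r.
  rewrite /W; have [xU|xU] := boolP (x \in U J).
    apply: le_trans IH _; rewrite /W ler_wpM2l ?mulr_ge0// big_ord_recr/= -addrA lerD2l.
    by rewrite indicE xU mulr1 lerDl exprn_ge0// ltW.
  have : `|I| <= C * g x * h ^+ J.+1.
    apply: HI; first by rewrite exprn_gt0//= exprn_ile1// ltW.
    move: xU; rewrite notin_setE /U/= => /negP; rewrite -leNgt /t => tu.
    rewrite ler_pdivrMr// in tu; rewrite -exprM (mulrC L).
    apply: (@le_trans _ _ (h ^+ (J.+1 * K) * (C0 * 2 ^+ (J.+1 * K)))); last first.
      by rewrite ler_wpM2l// exprn_ge0// ltW.
    by rewrite exprVn mulrCA mulVf ?mulr1// expf_neq0.
  move=> hI; apply: le_trans hI _; rewrite ler_wpM2l ?mulr_ge0// lerDr.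
  by apply: sumr_ge0 => j _; rewrite mulr_ge0 ?exprn_ge0 ?(ltW h0).
have intU j : (\int[mu]_(x in D) (g x * \1_(U j) x)%:E <= (B * t j `^ eps)%:E)%E.
  apply: le_trans (guB _ (t0 j)); rewrite le_eqVlt; apply/orP; left; apply/eqP.
  rewrite [RHS]integral_mkcondr; apply: eq_integral => x _.
  rewrite patchE indicE; case: ifP => _; first by rewrite mulr1.
  by rewrite mulr0.
pose r := 2^-1 `^ (1 - K%:R * eps) : R.
have r0 : 0 <= r by exact: powR_ge0.
have r1 : r < 1.
  rewrite /r -/h /powR gt_eqF// expR_lt1 nmulr_llt0 ?subr_gt0//.
  by rewrite ln_lt0// h0.
have tE j : h ^+ j * t j `^ eps = (C0 * 2 ^+ K) `^ eps * L `^ (- eps) * r ^+ j.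
  have e1 (x y : R) : 0 < x -> x `^ y = expR (y * ln x) by move=> x0; rewrite /powR gt_eqF.
  have e2 (m : nat) (x : R) : 0 < x -> x ^+ m = expR (m%:R * ln x).
    by move=> x0; rewrite expRM_natl lnK.
  have two : 2 = h^-1 :> R by rewrite invrK.
  rewrite /t /r -/h two exprM !e1 ?divr_gt0 ?mulr_gt0 ?exprn_gt0 ?invr_gt0//.
  rewrite -(expRM_natl j ((1 - K%:R * eps) * ln h)) (e2 j h h0) -!expRD; congr expR.
  rewrite !lnM ?posrE ?mulr_gt0 ?exprn_gt0 ?invr_gt0// !lnV ?posrE//.
  rewrite -exprM !lnXn ?invr_gt0// lnV ?posrE//.
  have -> : ln h = - ln 2 by rewrite /h lnV ?posrE.
  by rewrite -!(mulr_natr (- - ln 2)) natrM -natr1; ring.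
have intW J : (\int[mu]_(x in D) (W J x)%:E <=
    (C * (\sum_(j < J) h ^+ j * (B * t j `^ eps) + h ^+ J * G))%:E)%E.
  have mg1 j : measurable_fun D (fun x => (h ^+ j * (g x * \1_(U j) x))%:E).
    apply/measurable_EFinP/measurable_funTS/measurable_funM => //.
    by apply: measurable_funM => //; exact: measurable_indic.
  have g10 j x : (0 <= (h ^+ j * (g x * \1_(U j) x))%:E)%E.
    by rewrite lee_fin !mulr_ge0 ?exprn_ge0 ?(ltW h0).
  have mg2 : measurable_fun D (fun x => (h ^+ J * g x)%:E).
    by apply/measurable_EFinP/measurable_funTS/measurable_funM.
  have g20 x : (0 <= (h ^+ J * g x)%:E)%E.
    by rewrite lee_fin !mulr_ge0 ?exprn_ge0 ?(ltW h0).
  rewrite (eq_integral (fun x => C%:E *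
      (\sum_(j < J) (h ^+ j * (g x * \1_(U j) x))%:E + (h ^+ J * g x)%:E))%E); last first.
    move=> x _; rewrite sumEFin -EFinD -EFinM; congr _%:E.
    rewrite /W -mulrA mulrDr (mulrC (g x) (h ^+ J)) mulr_sumr; congr (_ * (_ + _)).
    by apply: eq_bigr => j _; rewrite mulrCA.
  rewrite ge0_integralZl//; last 2 first.
  - apply: emeasurable_funD => //; apply: emeasurable_sum => j; exact: mg1.
  - by move=> x _; rewrite adde_ge0// sume_ge0.
  rewrite EFinM lee_wpmul2l ?lee_fin// ge0_integralD//; last 2 first.
  - by move=> x _; rewrite sume_ge0.
  - by apply: emeasurable_sum => j; exact: mg1.
  rewrite ge0_integral_sum// EFinD leeD//.
    rewrite -sumEFin; apply: lee_sum => j _.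
    under eq_integral do rewrite EFinM.
    rewrite ge0_integralZl_EFin ?exprn_ge0 ?(ltW h0)//; last 2 first.
    - by move=> x _; rewrite lee_fin mulr_ge0.
    - by apply/measurable_EFinP/measurable_funTS/measurable_funM => //; exact: measurable_indic.
    by rewrite EFinM lee_wpmul2l ?lee_fin ?exprn_ge0 ?(ltW h0).
  under eq_integral do rewrite EFinM.
  rewrite ge0_integralZl_EFin ?exprn_ge0 ?(ltW h0)//; last 2 first.
  - by move=> x _; rewrite lee_fin.
  - by apply/measurable_EFinP/measurable_funTS.
  by rewrite EFinM lee_wpmul2l ?lee_fin ?exprn_ge0 ?(ltW h0).
have T0J J : T0 <= C * (\sum_(j < J) h ^+ j * (B * t j `^ eps) + h ^+ J * G).
  rewrite -lee_fin; apply: le_trans (intW J).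
  by apply: (@le_integral_limit S (fun x => A * g x)) => // x; exact: SW.
(* [J] may depend on [L] and [G]; this choice accounts for the [+ 1] in the constant and keeps [G]
   out of it. *)
have [J hJ] : exists J, h ^+ J * G <= L `^ (- eps).
  have Le : 0 < L `^ (- eps) by exact: powR_gt0.
  have : h ^+ n * G @[n --> \oo] --> 0 * G.
    by apply: cvgMl; apply: cvg_expr; rewrite ger0_norm// ltW.
  rewrite mul0r => /cvgr0_norm_le/(_ _ Le) [J _ HJ]; exists J.
  by apply: le_trans (ler_norm _) (HJ J _); rewrite /=.
apply: le_trans (T0J J) _; rewrite -mulrA ler_wpM2l// mulrDl mul1r lerD//.
rewrite (eq_bigr (fun j : 'I_J => B * ((C0 * 2 ^+ K) `^ eps * L `^ (- eps)) * r ^+ j)); last first.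
  by move=> j _; rewrite mulrCA tE !mulrA.
rewrite -mulr_sumr -/r.
have le_sum : \sum_(j < J) r ^+ j <= (1 - r)^-1.
  rewrite -[leRHS]mul1r ler_pdivlMr ?subr_gt0// mulrC.
  have := subrX1 r J; have := exprn_ge0 J r0; lra.
rewrite (_ : B * (C0 * 2 ^+ K) `^ eps / (1 - r) * L `^ (- eps) =
  B * ((C0 * 2 ^+ K) `^ eps * L `^ (- eps)) * (1 - r)^-1); last by ring.
by rewrite ler_wpM2l// !mulr_ge0 ?powR_ge0.
Qed.

End dyadic.

(** * Integrals of [g] over sets of small measure *)

Section small_sets.
Context d {T : measurableType d} {R : realType}.
Variable mu : {measure set T -> \bar R}.
Variables (D : set T) (g : T -> R) (p : \bar R) (G s : R).
Hypothesis mD : measurable D.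
Hypothesis g_ge0 : forall x, 0 <= g x.
Hypothesis g_meas : measurable_fun [set: T] g.
Hypothesis g_int : (\int[mu]_(x in D) (g x)%:E <= G%:E)%E.

(** Lowers the exponent from [r] to [s]: for [M <= 1] one has [M^r <= M^s], and for [M > 1] the
    total mass [G] is already enough. *)
Lemma integral_small_sets_of_conjugate (r N : R) : 0 < s -> s <= r -> 0 <= N -> 0 <= G ->
  (forall (A : set T) (M : R), measurable A -> A `<=` D -> 0 < M -> (mu A <= M%:E)%E ->
    (\int[mu]_(x in A) (g x)%:E <= (N * M `^ r)%:E)%E) ->
  exists2 C, 0 <= C & forall (A : set T) (M : R), measurable A -> A `<=` D ->
    0 < M -> (mu A <= M%:E)%E -> (\int[mu]_(x in A) (g x)%:E <= (C * M `^ s)%:E)%E.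
Proof.
move=> s0 sr N0 G0 H; exists (N + G); first exact: addr_ge0.
move=> A M mA AD M0 AM; have [M1|M1] := leP M 1.
  apply: le_trans (H A M mA AD M0 AM) _; rewrite lee_fin.
  apply: (@le_trans _ _ (N * M `^ s)).
    by rewrite ler_wpM2l// ger_powR// M0.
  by rewrite ler_wpM2r ?powR_ge0// lerDl.
apply: (@le_trans _ _ G%:E).
  apply: le_trans g_int; apply: ge0_subset_integral => //.
    by apply/measurable_EFinP; exact: measurable_funTS.
  by move=> x _; rewrite lee_fin.
rewrite lee_fin mulrDl ler_wpDl ?mulr_ge0 ?powR_ge0// ler_peMr//.
by rewrite -(powRr0 M) ler_powR// ltW.
Qed.

(** Hoelder's inequality against the indicator of [A] gives the exponent [1 / p'], which is then
    lowered to [s]. *)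
Lemma integral_small_sets : (1 <= p)%E -> 0 < s -> (s%:E < (hoelder_conjugate p)^-1)%E ->
  (Lnorm mu p (EFin \o (g \_ D)) < +oo)%E ->
  exists2 C, 0 <= C & forall (A : set T) (M : R), measurable A -> A `<=` D ->
    0 < M -> (mu A <= M%:E)%E -> (\int[mu]_(x in A) (g x)%:E <= (C * M `^ s)%:E)%E.
Proof.
move=> p1 s0 sp gp.
have G0 : 0 <= G.
  by rewrite -lee_fin; apply: le_trans g_int; apply: integral_ge0 => x _; rewrite lee_fin.
have gD_ge0 x : 0 <= (g \_ D) x by rewrite patchE; case: ifP.
have mgD : measurable_fun [set: T] (g \_ D).
  by apply/(measurable_restrictT _ _).1 => //; exact: measurable_funTS.
have gDA (A : set T) x : A `<=` D -> A x -> (g \_ D) x = g x.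
  by move=> AD Ax; rewrite patchE mem_set//; exact: AD.
(* For [p = +oo] an essential bound of [g] replaces Hoelder's inequality. *)
case: p p1 sp gp => [q|_|//]; last first.
  rewrite hoelder_conjugatey inve1 lte_fin => s1 gp.
  suff [N N0 HN] : exists2 N, 0 <= N & \forall x \ae mu, (g \_ D) x <= N.
    apply: (integral_small_sets_of_conjugate s0 (ltW s1) N0 G0) => A M mA AD M0 AM.
    rewrite powRr1 ?(ltW M0)//.
    apply: (@le_trans _ _ (\int[mu]_(x in A) (cst N%:E) x)%E).
      apply: ae_ge0_le_integral => //.
      - by move=> x _; rewrite lee_fin.
      - by apply/measurable_EFinP; exact: measurable_funTS.
      - by apply: filterS HN => x hx Ax; rewrite lee_fin -(gDA A x AD Ax).
    by rewrite integral_cst//= EFinM lee_wpmul2l ?lee_fin.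
  move: gp; rewrite unlock; case: ifPn => [_ gp|].
    have /ess_supP h : (ess_sup mu (abse \o (EFin \o g \_ D)) <=
        (Num.max 0 (fine (ess_sup mu (abse \o (EFin \o g \_ D)))))%:E)%E.
      case: ess_sup gp => [r _|//|_] /=; last exact: leNye.
      by rewrite lee_fin le_max lexx orbT.
    eexists; last first.
      apply: filterS h => x /=; rewrite ger0_norm// lee_fin; exact.
    by rewrite le_max lexx.
  rewrite -leNgt => muT; exists 0 => //; exists setT; split => //.
  by apply/eqP; rewrite eq_le muT measure_ge0.
(* The case [p = 1] is contradictory: there [1 / p' = 0], against [0 < s < 1 / p']. *)
rewrite lee_fin le_eqVlt => /predU1P[<-|q1].
  by rewrite hoelder_conjugate1 invey lte_fin ltNge (ltW s0).
have q0 : 0 < q := lt_trans ltr01 q1.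
have := @hoelder_conjugate_eq1 R q%:E (ltNyr _); rewrite eqe gt_eqF// => /(_ isT) conj sp gp.
pose r := 1 - q^-1.
have r0 : 0 < r by rewrite subr_gt0 invf_lt1.
have sr : s < r.
  rewrite -lte_fin; apply: lt_le_trans sp _.
  move: conj; rewrite inver gt_eqF//; case: (_^-1)%E => [z|//|//].
  by rewrite -EFinD => -[zE]; rewrite lee_fin /r -zE addrC addKr.
pose N := fine (Lnorm mu q%:E (EFin \o (g \_ D))).
have N0 : 0 <= N by rewrite fine_ge0// Lnorm_ge0.
apply: (integral_small_sets_of_conjugate s0 (ltW sr) N0 G0) => A M mA AD M0 AM.
have q'0 : 0 < r^-1 by rewrite invr_gt0.
have mI : measurable_fun [set: T] (\1_A : T -> R) by exact: measurable_indic.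
have := @hoelder _ T R mu (g \_ D) \1_A q r^-1 mgD mI q0 q'0.
rewrite invrK /r addrC subrK => /(_ erefl).
have -> : Lnorm mu 1 (EFin \o (g \_ D \* \1_A)) = (\int[mu]_(x in A) (g x)%:E)%E.
  rewrite Lnorm1 [RHS]integral_mkcond; apply: eq_integral => x _.
  rewrite /= indicE [RHS]patchE; case: ifPn => xA /=; last by rewrite mulr0 normr0.
  by rewrite mulr1 ger0_norm// (gDA A)//; rewrite inE in xA.
move=> h; apply: le_trans h _; rewrite EFinM lee_pmul ?Lnorm_ge0//.
  by rewrite /N fineK// ge0_fin_numE// Lnorm_ge0.
rewrite unlock invrK (eq_integral (fun x => (\1_A x)%:E)); last first.
  move=> x _; rewrite /= ger0_norm// indicE; case: (x \in A) => /=.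
    by rewrite powR1.
  by rewrite powR0// gt_eqF.
rewrite integral_indic// setIT -/r -[leRHS]poweR_EFin.
apply: gt0_ler_poweR => //; first exact: ltW.
- by rewrite in_itv/= measure_ge0 leey.
- by rewrite in_itv/= lee_fin (ltW M0) leey.
Qed.

End small_sets.

Section linear_sublevel.
Context {R : realType} {n : nat}.
Local Notation T := (lebesgue_rV R n).
Local Notation mu := (lebesgue_measure_rV R n).

Lemma linear_measurable (w : 'I_n -> R) :
  measurable_fun [set: T] (fun x : T => \sum_i w i * x ord0 i).
Proof.
by apply: measurable_sum => i; apply: measurable_funM => //; exact: coord_measurable.
Qed.

(* Translating the slab by multiples of [2 t] in the direction of the [i]-th
   axis yields about [1 / t] disjoint copies inside a fixed cube. *)
Lemma linear_sublevel (w : 'I_n -> R) (i : 'I_n) (t : R) : `|w i| = 1 -> 0 < t ->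
  (leb (@cube R n `&` [set x | (`|\sum_j w j * x ord0 j| < t)%R]) <= (2 * 7 ^+ n * t)%:E)%E.
Proof.
move=> wi t0; pose F (x : 'rV[R]_n) := \sum_j w j * x ord0 j.
pose A : set T := @cube R n `&` [set x | `|F x| < t].
have mA : measurable A.
  apply: measurableI; first exact: cube_measurable.
  apply: measurable_sublevel; apply: measurableT_comp => //.
  exact: linear_measurable.
have wi2 : w i * w i = 1 by rewrite -expr2 -real_normK ?num_real// wi expr1n.
have [t1|t1] := leP 1 t.
  apply: (@le_trans _ _ (leb (@cube R n))); first by apply: le_outer_measure => x [].
  apply: le_trans (leb_scaled_cube_le _) _ => //.
  rewrite lee_fin; apply: (@le_trans _ _ (1 * 7 ^+ n * 1)).
    by rewrite mul1r mulr1 lerXn2r// ?nnegrE//; lra.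
  by rewrite ler_pM// ?mulr_ge0 ?exprn_ge0// ler_wpM2r ?exprn_ge0//; lra.
pose N := Num.truncn t^-1.
have tV1 : 1 <= t^-1 by rewrite invf_ge1// ltW.
have /andP[Nt tN] : N%:R <= t^-1 < N.+1%:R by apply: truncn_itv; rewrite invr_ge0 ltW.
have N0 : (0 < N)%N by rewrite truncn_gt0.
pose v (k : nat) : 'rV[R]_n := \row_j (if j == i then - (2 * k%:R * t * w i) else 0).
pose B (k : nat) : set T := diag_affine (const_mx 1) (v k) @^-1` A.
have one0 j : 0 < (const_mx 1 : 'rV[R]_n) ord0 j by rewrite mxE.
have mB k : measurable (B k).
  by rewrite /B -[X in measurable X]setTI; exact: diag_affine_measurable.
have muB k : mu (B k) = mu A.
  rewrite -[RHS]mul1e -invr1; have := leb_diag_affine (v k) A one0.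
  by rewrite [X in X^-1](_ : _ = 1)// big1// => j _; rewrite mxE.
have FB k x : F (diag_affine (const_mx 1) (v k) x) = F x - 2 * k%:R * t.
  rewrite /F (eq_bigr (fun j => w j * x ord0 j + w j * v k ord0 j)); last first.
    by move=> j _; rewrite !mxE mul1r mulrDr.
  rewrite big_split/=; congr (_ + _); rewrite (bigD1 i)//= big1 ?addr0.
    rewrite mxE eqxx (_ : w i * _ = - (2 * k%:R * t) * (w i * w i)); last by ring.
    by rewrite wi2 mulr1.
  by move=> j /negbTE ji; rewrite mxE ji mulr0.
have tB : trivIset `I_N B.
  apply/trivIsetP => j k _ _ jk; apply/seteqP; split => // x [[_ /=] + [_ /=]].
  rewrite !FB !ltr_norml => /andP[h1 h2] /andP[h3 h4].
  have jk1 : `|j%:R - k%:R| < 1 :> R.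
    rewrite -(ltr_pM2r t0) -[X in _ * X < _](gtr0_norm t0) -normrM ltr_norml.
    by apply/andP; split; lra.
  case/negP: jk; apply/eqP.
  have [jlek|/ltnW klej] := leqP j k.
    apply/eqP; rewrite eqn_leq jlek /= -ltnS -(ltr_nat R) -natr1.
    by move: jk1; rewrite ltr_norml => /andP[]; lra.
  apply/eqP; rewrite eqn_leq klej andbT -ltnS -(ltr_nat R) -natr1.
  by move: jk1; rewrite ltr_norml => /andP[]; lra.
have mUB : measurable (\big[setU/set0]_(k < N) B k) by apply: bigsetU_measurable.
have := measure_semi_additive_ord_I mu (fun k _ => mB k) tB mUB.
rewrite (eq_bigr (fun=> mu A)); last by move=> k _; exact: muB.
move=> sumB.
(* For [k < N <= 1 / t] the translation is by at most 2, so all copies lie in [[-3, 3]^n], which a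
   box of side 7 contains. *)
have : (\sum_(k < N) mu A <= (7 ^+ n)%:E)%E.
  rewrite -sumB.
  rewrite [X in (X ^+ n)%:E](_ : _ = 2 * 3 + 1); last by ring.
  apply: le_trans (leb_scaled_cube_le _) => //.
  apply: le_outer_measure => x; rewrite -bigcup_mkord => -[k /= kN [xk _]] j.
  have := xk j; rewrite !mxE mul1r; case: eqP => [_|_]; last by rewrite addr0 => /andP[]; lra.
  have : `|2 * k%:R * t * w i| <= 2.
    rewrite normrM wi mulr1 ger0_norm ?mulr_ge0 ?(ltW t0)// -mulrA ler_piMr//.
    rewrite -ler_pdivlMr// div1r; apply: le_trans Nt; rewrite ler_nat; exact: ltnW.
  rewrite ler_norml => /andP[? ?] /andP[? ?]; apply/andP; split; lra.
have Afin : mu A \is a fin_num.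
  rewrite ge0_fin_numE ?measure_ge0//.
  apply: (@le_lt_trans _ _ (leb (@cube R n))); first by apply: le_outer_measure => x [].
  by apply: le_lt_trans (leb_scaled_cube_le _) _; rewrite ?ltry.
move=> hA; change (mu A <= (2 * 7 ^+ n * t)%:E)%E; move: hA.
rewrite -(fineK Afin); set m := fine (mu A).
have m0 : 0 <= m by rewrite fine_ge0// measure_ge0.
rewrite sumEFin sumr_const card_ord -[X in (X%:E <= _)%E -> _]mulr_natl !lee_fin => hA.
have tN2 : 1 <= 2 * t * N%:R.
  move: tN; rewrite -div1r ltr_pdivrMr// -natr1 => h.
  have : 1 * t <= N%:R * t by rewrite ler_wpM2r ?(ltW t0)// ler1n.
  lra.
apply: (@le_trans _ _ (2 * t * N%:R * m)); first by rewrite ler_peMl.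
rewrite (_ : 2 * 7 ^+ n * t = 2 * t * 7 ^+ n); last by ring.
by rewrite -mulrA ler_wpM2l// mulr_ge0// ltW.
Qed.

End linear_sublevel.

(** * Decay from sublevel estimates *)

Section curve_averages.
Context {R : realType} {n : nat}.
Local Notation T := (lebesgue_rV R n).
Local Notation mu := (lebesgue_measure_rV R n).
Variable a : 'I_n -> R.
Hypothesis a_gt0 : forall i, 0 < a i.
Hypothesis a_neq1 : forall i, a i != 1.
Local Notation Q := (homogeneous_dim a).

(* What is used of the real and imaginary parts of an admissible function. *)
Definition real_admissible (g phi : 'rV[R]_n -> R) : Prop :=
  [/\ mu.-integrable setT (EFin \o phi),
      forall x : 'rV[R]_n, 1 < euclid x -> phi x = 0,
      forall x : 'rV[R]_n, x != 0 -> derivable (fun t => phi (dilate a t x)) 1 1,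
      forall x : 'rV[R]_n, x != 0 -> `|phi x| <= g x
    & forall x : 'rV[R]_n, x != 0 -> `|derive1 (fun t => phi (dilate a t x)) 1| <= g x].

(* The exponents of the phase along a curve: 1 from [f], and the distinct
   [1 / a i] from the linear part. *)
Definition exponents : seq R := 1 :: [seq x^-1 | x <- undup (codom a)].

Definition exponent (k : 'I_(num_distinct a).+1) : R := exponents`_k.

Lemma size_exponents : size exponents = (num_distinct a).+1.
Proof. by rewrite /= size_map. Qed.

(** The leading 1 differs from every [1 / a i] because [a i != 1]. *)
Lemma exponent_inj : injective exponent.
Proof.
have u : uniq exponents.
  rewrite /= map_inj_uniq ?undup_uniq ?andbT; last exact: invr_inj.
  apply/mapP => -[x]; rewrite mem_undup => /codomP[i ->] /eqP.
  by rewrite eq_sym invr_eq1 (negbTE (a_neq1 i)).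
move=> j k /eqP; rewrite /exponent nth_uniq ?size_exponents// => /eqP; exact: val_inj.
Qed.

Lemma exponent_neq0 k : exponent k != 0.
Proof.
have : exponent k \in exponents by rewrite mem_nth// size_exponents.
rewrite inE => /predU1P[->|/mapP[x]]; first exact: oner_neq0.
by rewrite mem_undup => /codomP[i ->] ->; rewrite invr_eq0 gt_eqF.
Qed.

Lemma exponent_codom i : exists k, exponent k = (a i)^-1.
Proof.
have : (a i)^-1 \in exponents.
  by rewrite inE map_f ?orbT// mem_undup codom_f.
move=> /[dup] h /nthP => /(_ 0)[k]; rewrite size_exponents => kK e.
by exists (Ordinal kK).
Qed.

(** Coordinates with the same [a i] share an exponent, so their linear terms are collected in a
    single coefficient. *)
Definition phase_coef (f : 'rV[R]_n -> R) (lambda : 'rV[R]_n.+1) (x : 'rV[R]_n)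
    (k : 'I_(num_distinct a).+1) : R :=
  (if k == ord0 then lambda ord0 ord0 * f x else 0) +
  \sum_(i | (a i)^-1 == exponent k) lambda ord0 (lift ord0 i) * x ord0 i.

Lemma phase_coef0 f lambda x : phase_coef f lambda x ord0 = lambda ord0 ord0 * f x.
Proof.
rewrite /phase_coef eqxx big_pred0 ?addr0// => i.
by rewrite /exponent/= invr_eq1 (negbTE (a_neq1 i)).
Qed.

Lemma phase_dilate f lambda x s : mixed_homogeneous a f ->
  phase f lambda (dilate a (expR s) x) =
  \sum_k phase_coef f lambda x k * expR (exponent k * s).
Proof.
move=> fh; rewrite /phase fh ?expR_gt0//.
under [RHS]eq_bigr do rewrite mulrDl.
rewrite big_split/=; congr (_ + _).
  rewrite (bigD1 ord0)//= big1 ?addr0; last by move=> k /negbTE ->; rewrite mul0r.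
  by rewrite /exponent/= mul1r; ring.
under [RHS]eq_bigr do rewrite mulr_suml.
rewrite (exchange_big_dep predT)//=; apply: eq_bigr => i _.
have [k ek] := exponent_codom i.
rewrite (big_pred1 k) ?ek ?mxE ?expR_powR; first by ring.
move=> j /=; apply/eqP/eqP => [h|->]; last by rewrite ek.
by apply: exponent_inj; rewrite ek.
Qed.

Lemma dilate_expR_add s r x : dilate a (expR s) (dilate a (expR r) x) = dilate a (expR (s + r)) x.
Proof.
by apply/rowP => i; rewrite !mxE !expR_powR mulrDr expRD mulrA.
Qed.

Lemma dilate0 x : dilate a (expR 0) x = x.
Proof. by apply/rowP => i; rewrite !mxE expR_powR mulr0 expR0 mul1r. Qed.

Lemma dilate_neq0 s x : x != 0 -> dilate a (expR s) x != 0.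
Proof.
apply: contra => /eqP xs0; apply/eqP; rewrite -(dilate0 x) -(addNr s) -dilate_expR_add xs0.
by apply/rowP => i; rewrite !mxE mulr0.
Qed.

Lemma le_euclid (m : nat) (x : 'rV[R]_m) i : `|x ord0 i| <= euclid x.
Proof.
rewrite /euclid -sqrtr_sqr ler_sqrt; last by apply: sumr_ge0 => j _; exact: sqr_ge0.
by rewrite (bigD1 i)//= lerDl sumr_ge0// => j _; exact: sqr_ge0.
Qed.

(** For [s >= 0] no coordinate shrinks, so a point outside the cube stays outside the unit ball. *)
Lemma supported_dilate (phi : 'rV[R]_n -> R) x s :
  (forall y : 'rV[R]_n, 1 < euclid y -> phi y = 0) -> 0 <= s -> ~ cube x ->
  phi (dilate a (expR s) x) = 0.
Proof.
move=> supp s0 xcube; apply: supp.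
have [i xi] : exists i, 1 < `|x ord0 i|.
  apply: contrapT => h; apply: xcube => i; rewrite -ler_norml leNgt.
  by apply/negP => xi; apply: h; exists i.
apply: lt_le_trans (le_euclid _ i); rewrite mxE expR_powR normrM.
apply: lt_le_trans xi _; rewrite ler_peMl// ger0_norm ?expR_ge0//.
by rewrite -expR0 ler_expR mulr_ge0// invr_ge0 ltW.
Qed.

Lemma homogeneous_dim_ge0 : 0 <= Q.
Proof. by apply: sumr_ge0 => i _; rewrite invr_ge0 ltW. Qed.

Section along_curves.
Variables (g phi : 'rV[R]_n -> R) (rho : R).
Hypothesis g_ge0 : forall x, 0 <= g x.
Hypothesis g_hom : mixed_homogeneous_off0 a rho g.
Hypothesis phi_adm : real_admissible g phi.

(** The factor [expR (Q * s)] is the Jacobian that makes the integral over [x] independent of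
    [s]. *)
Definition curve_amplitude (x : 'rV[R]_n) (s : R) : R :=
  phi (dilate a (expR s) x) * expR (Q * s).

(* By the group law of the dilations the derivative at [s] is a derivative at
   [t = 1] along the curve of the point [dilate a (expR s) x], where [phi_adm]
   bounds it. *)
Definition curve_amplitude_derivative (x : 'rV[R]_n) (s : R) : R :=
  (derive1 (fun t => phi (dilate a t (dilate a (expR s) x))) 1 +
   Q * phi (dilate a (expR s) x)) * expR (Q * s).

Lemma is_derive_curve_amplitude x (s : R) : x != 0 ->
  is_derive s 1 (curve_amplitude x) (curve_amplitude_derivative x s).
Proof.
move=> x0; have [_ _ der _ _] := phi_adm.
pose y := dilate a (expR s) x; have y0 : y != 0 by exact: dilate_neq0.
pose p t := phi (dilate a t y).
have dp : is_derive (expR (s - s)) 1 p (derive1 p 1).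
  by rewrite subrr expR0 derive1E; apply: DeriveDef => //; exact: der.
have dsh : is_derive s 1 (fun r : R => r - s) 1.
  by rewrite -[X in is_derive _ _ _ X]subr0; apply: is_deriveB.
have dexp : is_derive s 1 (expR \o (fun r : R => r - s)) (expR (s - s) * 1).
  exact: is_derive1_comp.
have dq : is_derive s 1 (p \o (expR \o (fun r : R => r - s))) (derive1 p 1 * (expR (s - s) * 1)).
  exact: is_derive1_comp.
have dQ : is_derive s 1 (fun r : R => Q * r) Q.
  by rewrite -[X in is_derive _ _ _ X]mulr1; apply: is_deriveZ.
have dE : is_derive s 1 (expR \o (fun r : R => Q * r)) (expR (Q * s) * Q).
  exact: is_derive1_comp.
have -> : curve_amplitude x =
    (p \o (expR \o (fun r : R => r - s))) * (expR \o (fun r : R => Q * r)).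
  apply/funext => r; rewrite /curve_amplitude fctE /= /p /y dilate_expR_add.
  by rewrite subrK.
apply: is_derive_eq.
rewrite /curve_amplitude_derivative -/y /p /= subrr dilate0 expR0 /GRing.scale/=.
ring.
Qed.

(** [1 + Q] comes from the product rule, [exp |rho|] from the growth of [g] along the curve, and
    [exp Q] from the Jacobian, all for [0 <= s <= 1]. *)
Definition curve_constant : R := (1 + Q) * (expR `|rho| * expR Q).

Lemma curve_constant_ge0 : 0 <= curve_constant.
Proof. by rewrite mulr_ge0 ?mulr_ge0 ?expR_ge0// addr_ge0// homogeneous_dim_ge0. Qed.

Lemma curve_amplitude_le x (s : R) : x != 0 -> 0 <= s <= 1 ->
  `|curve_amplitude x s| <= curve_constant * g x /\
  `|curve_amplitude_derivative x s| <= curve_constant * g x.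
Proof.
move=> x0 /andP[s0 s1]; have [_ _ _ phi_g dphi_g] := phi_adm.
pose y := dilate a (expR s) x; have y0 : y != 0 by exact: dilate_neq0.
have Q0 := homogeneous_dim_ge0.
have gy : g y <= expR `|rho| * g x.
  rewrite /y g_hom ?expR_gt0// ler_wpM2r// expR_powR ler_expR.
  apply: le_trans (ler_norm _) _; rewrite normrM (ger0_norm s0).
  by rewrite ler_piMr.
have eQ : expR (Q * s) <= expR Q by rewrite ler_expR ler_piMr.
have bound : (1 + Q) * g y * expR (Q * s) <= curve_constant * g x.
  rewrite (_ : curve_constant * g x = (1 + Q) * (expR `|rho| * g x) * expR Q); last first.
    by rewrite /curve_constant; ring.
  rewrite ler_pM ?expR_ge0 ?mulr_ge0 ?addr_ge0//.
  by rewrite ler_wpM2l ?addr_ge0.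
split; apply: le_trans bound.
  rewrite normrM (ger0_norm (expR_ge0 _)) ler_wpM2r ?expR_ge0//.
  apply: le_trans (phi_g _ y0) _; rewrite ler_peMl//; lra.
rewrite normrM (ger0_norm (expR_ge0 _)) ler_wpM2r ?expR_ge0//.
apply: le_trans (ler_normD _ _) _; rewrite mulrDl mul1r lerD ?dphi_g//.
by rewrite normrM (ger0_norm Q0) ler_wpM2l// phi_g.
Qed.

End along_curves.
End curve_averages.

Section decay_core.
Context {R : realType} {n : nat}.
Local Notation T := (lebesgue_rV R n).
Local Notation mu := (lebesgue_measure_rV R n).
Variable a : 'I_n -> R.
Hypothesis n_gt0 : (0 < n)%N.
Hypothesis a_gt0 : forall i, 0 < a i.
Hypothesis a_neq1 : forall i, a i != 1.
Local Notation Q := (homogeneous_dim a).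

Lemma phase_measurable (f : 'rV[R]_n -> R) lambda : lebesgue_measurable f ->
  measurable_fun [set: T] (phase f lambda).
Proof.
move=> mf; apply: measurable_funD; first exact: measurable_funM.
by apply: measurable_sum => i; apply: measurable_funM => //; exact: coord_measurable.
Qed.

Lemma oscillation_integrable (f phi : 'rV[R]_n -> R) theta lambda :
  lebesgue_measurable f -> mu.-integrable setT (EFin \o phi) ->
  mu.-integrable setT (EFin \o (fun x => cos (theta + phase f lambda x) * phi x)).
Proof.
move=> mf iphi; have /integrableP[/measurable_EFinP mphi _] := iphi.
apply: (le_integrable measurableT _ _ iphi).
  apply/measurable_EFinP/measurable_funM => //.
  apply: (measurableT_comp (continuous_measurable_fun (@continuous_cos R))).
  apply: measurable_funD => //.
  exact: phase_measurable.
move=> x _ /=; rewrite lee_fin normrM ler_piMl//.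
by rewrite ler_norml cos_geN1 cos_le1.
Qed.

Lemma origin_measurable : measurable ([set 0] : set T).
Proof.
rewrite (_ : [set 0] = \bigcap_i [set x : T | x ord0 i = 0]); last first.
  apply/seteqP; split => [x -> i _|x x0]; first by rewrite /= mxE.
  by apply/rowP => i; rewrite mxE; exact: x0.
apply: fin_bigcap_measurable => // i _.
rewrite [X in measurable X](_ : _ = [set: T] `&` (fun x : T => x ord0 i) @^-1` [set 0]).
  exact: coord_measurable.
by rewrite setTI.
Qed.

(** The bounds on an admissible function hold off the origin only, which is a null set as
    [n > 0]. *)
Lemma integral_off_origin (F : T -> R) : measurable_fun [set: T] F ->
  (forall x : 'rV[R]_n, ~ cube x -> F x = 0) ->
  (\int[mu]_x `|F x|%:E = \int[mu]_(x in @cube R n `\` [set 0%R]) `|F x|%:E)%E.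
Proof.
move=> mF F0.
have mFe : measurable_fun [set: T] (fun x => `|F x|%:E).
  by apply/measurable_EFinP; exact: measurableT_comp.
rewrite -ge0_negligible_integral//.
- rewrite integral_mkcond [RHS]integral_mkcond; apply: eq_integral => x _.
  rewrite !patchE in_setT; case: ifPn => //; rewrite notin_setE => /F0 ->.
  by rewrite normr0.
- exact: origin_measurable.
- exact: cube_measurable.
- exact: measurable_funTS.
- exact: leb_set1_0.
Qed.

Variables (f g : 'rV[R]_n -> R) (rho : R).
Hypothesis f_meas : lebesgue_measurable f.
Hypothesis f_hom : mixed_homogeneous a f.
Hypothesis g_ge0 : forall x, 0 <= g x.
Hypothesis g_meas : lebesgue_measurable g.
Hypothesis g_hom : mixed_homogeneous_off0 a rho g.
Variable G : R.
Hypothesis g_int : (\int[mu]_(x in @cube R n) (g x)%:E <= G%:E)%E.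

(** Each dilated copy, with its Jacobian, has the integral of [F], and the weights add up to
    [kappa]; the identity is exact for every [N]. *)
Lemma curve_average (kappa : R) (N : nat) (F : T -> R) : (0 < N)%N ->
  mu.-integrable setT (EFin \o F) ->
  let S (x : T) := riemann_sum (fun s => F (dilate a (expR s) x) * expR (Q * s)) kappa N in
  mu.-integrable setT (EFin \o S) /\ \int[mu]_x S x = kappa * \int[mu]_x F x.
Proof.
move=> N0 iF S.
pose t (k : nat) : R := kappa * k%:R / N%:R.
pose h k (x : T) := F (dilate a (expR (t k)) x) * expR (Q * t k).
have ih k : mu.-integrable setT (EFin \o h k) := (integral_dilate a (t k) iF).1.
have SE : EFin \o S = fun x => ((kappa / N%:R)%:E * \sum_(k < N) (h k x)%:E)%E.
  by apply/funext => x; rewrite sumEFin -EFinM.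
have isum : mu.-integrable setT (fun x => (\sum_(k < N) (h k x)%:E)%E).
  by apply: integrable_sum => // k _; exact: ih.
split; first by rewrite SE; exact: integrableZl.
rewrite /Rintegral -[X in fine (integral _ _ X)]/(EFin \o S) SE integralZl//.
rewrite fineM//; last exact: integrable_fin_num.
rewrite integral_sum//; last by move=> k; exact: ih.
rewrite (eq_bigr (fun=> (\int[mu]_x F x)%:E)); last first.
  move=> k _; rewrite -(integral_dilate a (t k) iF).2 /Rintegral fineK//.
  exact: integrable_fin_num (ih k).
rewrite sumEFin sumr_const card_ord /= -[X in _ * X = _]mulr_natl mulrA divfK//.
by rewrite pnatr_eq0 -lt0n.
Qed.

(** The index [k] and the factorisation [|c_k| = L u] are left open so that one statement serves
    both [c_0 = lambda_0 f] and the linear forms. The constant is chosen before [phi], [lambda], [u]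
    and [L]. *)
Lemma oscillatory_decay_core (eps B : R) :
  0 < eps -> eps < (num_distinct a).+1%:R^-1 -> 0 <= B ->
  exists2 C, 0 < C & forall (phi : 'rV[R]_n -> R) (lambda : 'rV[R]_n.+1)
      (theta : R) (k : 'I_(num_distinct a).+1) (u : 'rV[R]_n -> R) (L : R),
    real_admissible a g phi -> 0 < L ->
    lebesgue_measurable u ->
    (forall x, `|phase_coef f lambda x k| = L * u x) ->
    (forall t : R, 0 < t ->
      (\int[mu]_(x in @cube R n `&` [set x | (u x < t)%R]) (g x)%:E <= (B * t `^ eps)%:E)%E) ->
    `|\int[mu]_x (cos (theta + phase f lambda x) * phi x)| <= C * L `^ (- eps).
Proof.
move=> eps0 epsK B0.
have [kappa [C [C0 [/andP[k0 k1] Cp C0p osc]]]] :=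
  averaged_oscillation (exponent_inj a_neq1) (exponent_neq0 a_gt0) (ltn0Sn _).
set K := (num_distinct a).+1 in epsK osc.
pose A := curve_constant a rho.
have A0 : 0 <= A := curve_constant_ge0 a_gt0 rho.
pose D := @cube R n `\` [set 0].
(* [C * A + A] exceeds both the trivial bound [A] and the oscillation bound [C * A], as
   [dyadic_average] asks. *)
pose Cd := (C * A + A) * (B * (C0 * 2 ^+ K) `^ eps / (1 - 2^-1 `^ (1 - K%:R * eps)) + 1).
exists (kappa^-1 * `|Cd| + 1).
  by apply: ltr_wpDl => //; apply: mulr_ge0 => //; rewrite invr_ge0 ltW.
move=> phi lambda theta k u L phi_adm L0 mu_ ck ut.
have [iphi supp der phi_g dphi_g] := phi_adm.
pose F x := cos (theta + phase f lambda x) * phi x.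
have iF : mu.-integrable setT (EFin \o F) by exact: oscillation_integrable.
pose S N (x : T) := if N == 0%N then 0
  else riemann_sum (fun s => F (dilate a (expR s) x) * expR (Q * s)) kappa N.
have curveE x s : F (dilate a (expR s) x) * expR (Q * s) =
    cos (theta + \sum_k phase_coef f lambda x k * expR (exponent (a := a) k * s)) *
    curve_amplitude a phi x s.
  by rewrite /F phase_dilate// -mulrA.
have mS N : measurable_fun [set: T] (S N).
  rewrite /S; case: eqP => [_|/eqP N0]; first exact: measurable_cst.
  have N0' : (0 < N)%N by rewrite lt0n.
  by have [/integrableP[/measurable_EFinP]] := curve_average kappa N0' iF.
have T0_le N : (0 < N)%N -> ((kappa * `|\int[mu]_x F x|)%:E <= \int[mu]_(x in D) `|S N x|%:E)%E.
  move=> N0; have [iS eS] := curve_average kappa N0 iF.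
  rewrite -integral_off_origin//; last first.
    move=> x xcube; rewrite /S gtn_eqF// /riemann_sum big1 ?mulr0// => j _.
    have t0 : 0 <= kappa * j%:R / N%:R by rewrite divr_ge0// mulr_ge0// ltW.
    by rewrite /F (supported_dilate a_gt0 supp t0 xcube) mulr0 mul0r.
  have -> : kappa * `|\int[mu]_x F x| = `|\int[mu]_x S N x|.
    by rewrite /S gtn_eqF//= eS normrM (gtr0_norm k0).
  have iSN : mu.-integrable setT (EFin \o S N) by rewrite /S gtn_eqF.
  rewrite -[leRHS]fineK; last first.
    by have /integrable_abse/integrable_fin_num := iSN; exact.
  by rewrite lee_fin; exact: le_normr_Rintegral.
have mcube : measurable (@cube R n : set T) := cube_measurable.
have mD : measurable (D : set T).
  by apply: measurableD => //; exact: origin_measurable.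
have := @dyadic_average _ T R mu D mD S g u A B (C * A + A) C0 L G eps
  (kappa * `|\int[mu]_x F x|) K g_meas g_ge0 mu_.
move=> /(_ _ _ eps0 _ A0 _ B0 C0p L0 mS _ _ T0_le) H.
suff : kappa * `|\int[mu]_x F x| <= Cd * L `^ (- eps).
  move=> h; rewrite -ler_pdivlMl// in h; apply: le_trans h _.
  rewrite mulrA ler_wpM2r ?powR_ge0// ler_wpDr// ler_wpM2l ?invr_ge0 ?(ltW k0)//.
  exact: ler_norm.
apply: H.
- apply: le_trans g_int; apply: ge0_subset_integral => //.
  + by apply/measurable_EFinP; exact: measurable_funTS.
  + by move=> x _; rewrite lee_fin.
  + by move=> x [].
- move=> t t0; apply: le_trans (ut t t0); apply: ge0_subset_integral => //.
  + by apply: measurableI => //; exact: measurable_sublevel.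
  + by apply: measurableI => //; exact: measurable_sublevel.
  + by apply/measurable_EFinP; exact: measurable_funTS.
  + by move=> x _; rewrite lee_fin.
  + by move=> x [[]].
- by rewrite mulrC -ltr_pdivlMr ?ltr0n// div1r.
- by rewrite lerDr mulr_ge0// ltW.
- move=> N x [_ /eqP x0]; rewrite /S; case: eqP => [_|/eqP N0].
    by rewrite normr0 mulr_ge0.
  have NR : 0 < N%:R :> R by rewrite ltr0n lt0n.
  rewrite /riemann_sum normrM ger0_norm ?divr_ge0 ?(ltW k0)//.
  rewrite -ler_pdivlMl ?divr_gt0//; apply: le_trans (ler_norm_sum _ _ _) _.
  apply: (@le_trans _ _ (\sum_(j < N) A * g x)).
    apply: ler_sum => j _; rewrite curveE normrM -[leRHS]mul1r ler_pM//.
      by rewrite ler_norml cos_geN1 cos_le1.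
    apply: (curve_amplitude_le a_gt0 g_ge0 g_hom phi_adm x0 _).1.
    rewrite divr_ge0 ?mulr_ge0 ?(ltW k0)//= ler_pdivrMr// mul1r.
    by rewrite (le_trans (ler_piMl _ k1))// ler_nat ltnW.
  rewrite sumr_const card_ord -[leLHS]mulr_natl invf_div.
  rewrite ler_wpM2r//; first exact: mulr_ge0.
  by rewrite ler_pdivlMr// ler_piMr// ltW.
- move=> x [_ /eqP x0].
  have unit_itv (s : R) : 0 <= s <= kappa -> 0 <= s <= 1.
    by move=> /andP[-> /le_trans]; apply.
  have [|||I SI HI] := osc (phase_coef f lambda x) theta (A * g x)
    (curve_amplitude a phi x) (curve_amplitude_derivative a phi x).
  + by move=> s; exact: is_derive_curve_amplitude phi_adm _ _ x0.
  + by move=> s /unit_itv s01; exact: (curve_amplitude_le a_gt0 g_ge0 g_hom phi_adm x0 s01).1.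
  + by move=> s /unit_itv s01; exact: (curve_amplitude_le a_gt0 g_ge0 g_hom phi_adm x0 s01).2.
  exists I.
    apply: cvg_trans SI; apply: near_eq_cvg; near=> N.
    have N0 : (0 < N)%N by near: N; exists 1%N.
    rewrite /S gtn_eqF//; congr (_ * _); apply: eq_bigr => j _.
    by rewrite curveE.
  move=> r r01; rewrite -ck => hr; apply: le_trans (HI k r r01 hr) _.
  have /andP[r0 _] := r01.
  by rewrite ler_wpM2r ?(ltW r0)// mulrA ler_wpM2r// lerDl.
Unshelve. all: by end_near. Qed.

End decay_core.

Section complex_parts.
Context {R : rcfType}.

Lemma normc_le_parts (z : R[i]) (r : R) : `|z| <= r%:C%C ->
  `|complex.Re z| <= r /\ `|complex.Im z| <= r.
Proof.
rewrite normc_def lecR => h; split; apply: le_trans h; rewrite -sqrtr_sqr.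
  by rewrite ler_sqrt ?addr_ge0 ?sqr_ge0// lerDl sqr_ge0.
by rewrite ler_sqrt ?addr_ge0 ?sqr_ge0// lerDr sqr_ge0.
Qed.

Lemma normc_le_sum (z : R[i]) (r1 r2 : R) :
  `|complex.Re z| <= r1 -> `|complex.Im z| <= r2 -> `|z| <= (r1 + r2)%:C%C.
Proof.
move=> h1 h2; rewrite normc_def lecR.
have r10 : 0 <= r1 := le_trans (normr_ge0 _) h1.
have r20 : 0 <= r2 := le_trans (normr_ge0 _) h2.
rewrite -(ger0_norm (addr_ge0 r10 r20)) -sqrtr_sqr ler_sqrt ?sqr_ge0//.
rewrite -(real_normK (num_real (complex.Re z))) -(real_normK (num_real (complex.Im z))).
rewrite sqrrD -addrA (addrC (_ *+ 2)) addrA ler_wpDr ?mulrn_wge0 ?mulr_ge0//.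
by rewrite lerD// lerXn2r// nnegrE.
Qed.

End complex_parts.

Section decay.
Context {R : realType} {n : nat}.
Local Notation T := (lebesgue_rV R n).
Local Notation mu := (lebesgue_measure_rV R n).
Variable a : 'I_n -> R.
Hypothesis n_gt0 : (0 < n)%N.
Hypothesis a_gt0 : forall i, 0 < a i.
Hypothesis a_neq1 : forall i, a i != 1.

Lemma admissible_parts (g : 'rV[R]_n -> R) (phi : 'rV[R]_n -> R[i]) :
  admissible a g phi ->
  real_admissible a g (fun x => complex.Re (phi x)) /\
  real_admissible a g (fun x => complex.Im (phi x)).
Proof.
move=> [[iRe iIm] supp C1 phi_g dphi_g].
split; split => //.
- by move=> x /supp ->.
- by move=> x /C1[h _]; exact: (h 1 ltr01).1.
- by move=> x /phi_g /normc_le_parts[].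
- by move=> x /dphi_g /normc_le_parts[].
- by move=> x /supp ->.
- by move=> x /C1[_ h]; exact: (h 1 ltr01).1.
- by move=> x /phi_g /normc_le_parts[].
- by move=> x /dphi_g /normc_le_parts[].
Qed.

Lemma compact_cube : compact (@cube R n).
Proof.
rewrite (_ : @cube R n = [set x : 'rV[R]_n | forall i, `[-1, 1]%classic (x ord0 i)]).
  by apply: (@rV_compact R n (fun=> `[-1, 1]%classic)) => i; exact: segment_compact.
by apply/seteqP; split => x /= h i; have := h i; rewrite /= in_itv.
Qed.

(** Here [1 + |x| <= 2 |x|], and if all [m + 1] coordinates were below [|x| / (m + 1)], their
    squares would sum to less than [|x|^2]. *)
Lemma euclid_coord_large (m : nat) (x : 'rV[R]_m.+1) : 1 <= euclid x ->
  exists i, (1 + euclid x) / (2 * m.+1%:R) <= `|x ord0 i|.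
Proof.
move=> x1; apply: contrapT => h.
have {}h i : `|x ord0 i| < (1 + euclid x) / (2 * m.+1%:R).
  by rewrite ltNge; apply/negP => hi; apply: h; exists i.
have m0 : 0 < m.+1%:R :> R by rewrite ltr0n.
have {}h i : `|x ord0 i| < euclid x / m.+1%:R.
  apply: lt_le_trans (h i) _; rewrite invfM mulrA ler_wpM2r ?invr_ge0 ?(ltW m0)//.
  by rewrite ler_pdivrMr//; lra.
have e0 : 0 < euclid x by lra.
have : euclid x ^+ 2 < \sum_(i < m.+1) euclid x ^+ 2 / m.+1%:R.
  have e2 : euclid x ^+ 2 = \sum_i x ord0 i ^+ 2.
    by rewrite sqr_sqrtr// sumr_ge0// => i _; exact: sqr_ge0.
  rewrite {1}e2.
  apply: ltr_sum; first by apply/hasP; exists ord0 => //; rewrite mem_index_enum.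
  move=> i _; apply: (@lt_le_trans _ _ ((euclid x / m.+1%:R) ^+ 2)).
    by rewrite -real_normK ?num_real// ltrXn2r// nnegrE ?divr_ge0// ltW.
  rewrite expr_div_n ler_wpM2l ?sqr_ge0// lef_pV2 ?posrE ?exprn_gt0//.
  by rewrite expr2 ler_peMl ?(ltW m0)// ler1n.
by rewrite sumr_const card_ord -[X in _ < X]mulr_natr divfK ?gt_eqF// ltxx.
Qed.

Variables (f g : 'rV[R]_n -> R) (rho : R) (p : \bar R).
Hypothesis f_meas : lebesgue_measurable f.
Hypothesis f_hom : mixed_homogeneous a f.
Hypothesis g_ge0 : forall x, 0 <= g x.
Hypothesis g_locint : locally_integrable_rV g.
Hypothesis g_hom : mixed_homogeneous_off0 a rho g.

Lemma integral_cube_finite :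
  exists2 G, 0 <= G & (\int[mu]_(x in @cube R n) (g x)%:E <= G%:E)%E.
Proof.
have := g_locint.2 _ compact_cube.
under eq_integral do rewrite ger0_norm//.
move=> h; exists (fine (\int[mu]_(x in @cube R n) (g x)%:E)%E).
  by rewrite fine_ge0// integral_ge0// => x _; rewrite lee_fin.
by rewrite fineK// ge0_fin_numE// integral_ge0// => x _; rewrite lee_fin.
Qed.

Hypothesis p_ge1 : (1 <= p)%E.
Hypothesis g_Lp : Lp_on_cube p g.

Lemma real_decay_of_sublevel (eps : R) :
  0 < eps -> eps < (num_distinct a).+1%:R^-1 ->
  (((num_distinct a).+1%:R^-1)%:E < (hoelder_conjugate p)^-1)%E ->
  sublevel_estimate f g eps ->
  exists2 M, 0 < M & forall phi theta (lambda : 'rV[R]_n.+1), real_admissible a g phi ->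
    `|\int[mu]_x (cos (theta + phase f lambda x) * phi x)| <=
      M * (1 + euclid lambda) `^ (- eps).
Proof.
move=> eps0 epsK Kp [B0 B00 subf].
have g_meas := g_locint.1.
have [G G0 gG] := integral_cube_finite.
have epsp : (eps%:E < (hoelder_conjugate p)^-1)%E by apply: lt_trans Kp; rewrite lte_fin.
have [Cs Cs0 small] := integral_small_sets cube_measurable g_ge0 g_meas gG p_ge1 eps0 epsp g_Lp.2.
have subf' (t : R) : 0 < t ->
    (\int[mu]_(x in @cube R n `&` [set x | (`|f x| < t)%R]) (g x)%:E <= (B0 * t `^ eps)%:E)%E.
  move=> t0; apply: le_trans (subf t t0); rewrite /weighted_measure.
  by under [leRHS]eq_integral do rewrite ger0_norm//.
have subl (w : 'I_n -> R) (i : 'I_n) (t : R) : `|w i| = 1 -> 0 < t ->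
    (\int[mu]_(x in @cube R n `&` [set x | (`|\sum_j w j * x ord0 j| < t)%R]) (g x)%:E <=
     (Cs * (2 * 7 ^+ n) `^ eps * t `^ eps)%:E)%E.
  move=> wi t0.
  have := small (@cube R n `&` [set x | `|\sum_j w j * x ord0 j| < t]) (2 * 7 ^+ n * t).
  rewrite powRM ?mulr_ge0 ?exprn_ge0 ?(ltW t0)// mulrA; apply.
  - apply: measurableI; first exact: cube_measurable.
    apply: measurable_sublevel; apply: measurableT_comp => //.
    exact: linear_measurable.
  - by move=> x [].
  - by rewrite mulr_gt0// mulr_gt0// exprn_gt0.
  - exact: (linear_sublevel wi t0).
have Bl0 : 0 <= Cs * (2 * 7 ^+ n) `^ eps by rewrite mulr_ge0// powR_ge0.
have [Cf Cf0 coref] := oscillatory_decay_core n_gt0 a_gt0 a_neq1 f_meas f_hom g_ge0 g_meas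
  g_hom gG eps0 epsK (ltW B00).
have [Cl Cl0 corel] := oscillatory_decay_core n_gt0 a_gt0 a_neq1 f_meas f_hom g_ge0 g_meas
  g_hom gG eps0 epsK Bl0.
pose M := (Cf + Cl) * (2 * n.+1%:R) `^ eps + (G + 1) * 2 `^ eps.
have n2 : 0 < 2 * n.+1%:R :> R by rewrite mulr_gt0// ltr0n.
have Mp1 : 0 < (Cf + Cl) * (2 * n.+1%:R) `^ eps by rewrite mulr_gt0 ?addr_gt0 ?powR_gt0.
have Mp2 : 0 < (G + 1) * 2 `^ eps by rewrite mulr_gt0 ?powR_gt0//; lra.
exists M; first by rewrite addr_gt0.
move=> phi theta lambda phi_adm; have [iphi supp _ phi_g _] := phi_adm.
have e0 : 0 <= euclid lambda by exact: sqrtr_ge0.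
have e1 : 0 < 1 + euclid lambda by lra.
(* For [|lambda| < 1] the mass [G] of [g] on the cube is a sufficient bound; since
   [1 + |lambda| <= 2], it costs a factor [2^eps]. *)
have [lam1|lam1] := ltP (euclid lambda) 1.
  have triv : `|\int[mu]_x (cos (theta + phase f lambda x) * phi x)| <= G.
    have iF := oscillation_integrable theta lambda f_meas iphi.
    apply: le_trans (le_normr_Rintegral measurableT iF) _.
    have iN : mu.-integrable setT (EFin \o (fun x => `|cos (theta + phase f lambda x) * phi x|)).
      exact: integrable_abse iF.
    rewrite -lee_fin /Rintegral fineK; last exact: integrable_fin_num iN.
    have /integrableP[/measurable_EFinP mF _] := iF.
    rewrite (integral_off_origin n_gt0 mF); last first.
      move=> x xcube; rewrite (_ : phi x = 0) ?mulr0// -(dilate0 a x).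
      by apply: supported_dilate; rewrite ?lexx.
    apply: le_trans gG; have m0 := @origin_measurable R n.
    have mc := @cube_measurable R n.
    apply: (@le_trans _ _ (\int[mu]_(x in @cube R n `\` [set 0%R]) (g x)%:E)%E).
      apply: ge0_le_integral => //.
      - exact: measurableD.
      - by apply/measurable_EFinP; apply: measurable_funTS; apply: measurableT_comp.
      - by apply/measurable_EFinP; exact: measurable_funTS.
      - move=> x [_ /eqP x0]; rewrite lee_fin normrM; apply: le_trans (phi_g x x0).
        by rewrite ler_piMl// ler_norml cos_geN1 cos_le1.
    apply: ge0_subset_integral => //.
    - exact: measurableD.
    - by apply/measurable_EFinP; exact: measurable_funTS.
    - by move=> x _; rewrite lee_fin.
  apply: le_trans triv _.
  apply: (@le_trans _ _ ((G + 1) * 2 `^ eps * (1 + euclid lambda) `^ (- eps))); last first.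
    by rewrite ler_wpM2r ?powR_ge0// lerDr ltW.
  rewrite -mulrA; apply: (@le_trans _ _ (G + 1)); first by lra.
  rewrite ler_peMr//; first by lra.
  rewrite powRN ler_pdivlMr ?powR_gt0// mul1r.
  by apply: ge0_ler_powR; rewrite ?nnegrE; lra.
have [j hj] := euclid_coord_large lam1.
have large (L : R) : (1 + euclid lambda) / (2 * n.+1%:R) <= L ->
    0 < L /\ L `^ (- eps) <= (2 * n.+1%:R) `^ eps * (1 + euclid lambda) `^ (- eps).
  move=> hL; have q0 : 0 < (1 + euclid lambda) / (2 * n.+1%:R) by rewrite divr_gt0.
  have L0 : 0 < L := lt_le_trans q0 hL; split => //.
  rewrite !powRN ler_pdivlMr ?powR_gt0// mulrC ler_pdivrMr ?powR_gt0//.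
  rewrite -powRM ?(ltW n2) ?(ltW L0)//; apply: ge0_ler_powR; rewrite ?nnegrE ?(ltW e1)//.
  - exact: ltW.
  - by rewrite mulr_ge0// ltW.
  - by move: hL; rewrite ler_pdivrMr// mulrC.
have finish (C L I : R) : 0 <= C -> C <= Cf + Cl -> I <= C * L `^ (- eps) ->
    (1 + euclid lambda) / (2 * n.+1%:R) <= L -> I <= M * (1 + euclid lambda) `^ (- eps).
  move=> C0 CC hI /large[L0 hL]; apply: le_trans hI _.
  apply: (@le_trans _ _ ((Cf + Cl) * (2 * n.+1%:R) `^ eps * (1 + euclid lambda) `^ (- eps))).
    by rewrite -mulrA ler_pM ?powR_ge0.
  by rewrite ler_wpM2r ?powR_ge0// lerDl ltW.
have [i ji|j0] := unliftP ord0 j.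
  rewrite ji in hj; have [L0 _] := large _ hj.
  have [k ek] := exponent_codom a i.
  have k0 : k != ord0.
    apply/eqP => k0; move: ek; rewrite k0 /exponent/= => /esym/eqP.
    by rewrite invr_eq1 (negbTE (a_neq1 i)).
  (* Dividing [c_k] by [L] gives a linear form whose [i]-th coefficient has modulus 1, which makes
     the slab estimate uniform in [lambda]. *)
  pose L := `|lambda ord0 (lift ord0 i)|.
  pose w j := if (a j)^-1 == exponent k then lambda ord0 (lift ord0 j) / L else 0.
  have wi : `|w i| = 1.
    by rewrite /w ek eqxx normrM normfV normr_id divff// gt_eqF.
  apply: (finish Cl L) => //; [exact: ltW|by rewrite lerDr ltW|].
  apply: (corel phi lambda theta k (fun x => `|\sum_j w j * x ord0 j|)) => //.
  - by apply: measurableT_comp => //; exact: linear_measurable.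
  - move=> x; rewrite /phase_coef (negbTE k0) add0r.
    rewrite -[X in _ = X * _]normr_id -normrM; congr `|_|.
    rewrite mulr_sumr big_mkcond; apply: eq_bigr => l _; rewrite /w.
    case: ifP => _; last by rewrite mul0r mulr0.
    by rewrite mulrA mulrCA divff ?mulr1// gt_eqF.
  - by move=> t t0; exact: (subl w i).
rewrite j0 in hj; have [L0 _] := large _ hj.
apply: (finish Cf `|lambda ord0 ord0|) => //; [exact: ltW|by rewrite lerDl ltW|].
apply: (coref phi lambda theta ord0 (fun x => `|f x|)) => //.
- exact: measurableT_comp.
- by move=> x; rewrite phase_coef0// normrM.
Qed.

(** Real and imaginary parts of the integral involve four real integrals, the sine being a cosine
    shifted by [- pi / 2]; hence the constant [4 M]. *)
Lemma decay_of_sublevel (eps : R) :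
  0 < eps -> eps < (num_distinct a).+1%:R^-1 ->
  (((num_distinct a).+1%:R^-1)%:E < (hoelder_conjugate p)^-1)%E ->
  sublevel_estimate f g eps -> uniform_decay a f g eps.
Proof.
move=> eps0 epsK Kp subf.
have [M M0 HM] := real_decay_of_sublevel eps0 epsK Kp subf.
exists (M + M + (M + M)); first by lra.
move=> phi /[dup] phi_adm /admissible_parts[admRe admIm] lambda.
have [[iRe iIm] _ _ _ _] := phi_adm.
set X := (1 + euclid lambda) `^ (- eps).
have parts psi1 psi2 : real_admissible a g psi1 -> real_admissible a g psi2 ->
    `|\int[mu]_x (cos (0 + phase f lambda x) * psi1 x)| +
    `|\int[mu]_x (cos (- (pi / 2) + phase f lambda x) * psi2 x)| <= (M + M) * X.
  by move=> h1 h2; rewrite [leRHS]mulrDl; apply: lerD; exact: HM.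
have iosc theta psi : mu.-integrable setT (EFin \o psi) ->
    mu.-integrable setT (EFin \o (fun x => cos (theta + phase f lambda x) * psi x)).
  exact: oscillation_integrable.
rewrite mulrDl; apply: normc_le_sum.
- rewrite /osc_integral /complex_integral/=.
  rewrite (@eq_Rintegral _ T R mu setT (fun x => cos (0 + phase f lambda x) * complex.Re (phi x) -
      cos (- (pi / 2) + phase f lambda x) * complex.Im (phi x))); last first.
    move=> x _; rewrite add0r (addrC (- (pi / 2))) cosBpihalf /expi.
    by case: (phi x) => u v.
  rewrite RintegralB//; [|exact: iosc|exact: iosc].
  by apply: le_trans (ler_normB _ _) _; exact: parts.
- rewrite /osc_integral /complex_integral/=.
  rewrite (@eq_Rintegral _ T R mu setT (fun x => cos (0 + phase f lambda x) * complex.Im (phi x) +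
      cos (- (pi / 2) + phase f lambda x) * complex.Re (phi x))); last first.
    move=> x _; rewrite add0r (addrC (- (pi / 2))) cosBpihalf /expi.
    by case: (phi x) => u v /=; rewrite addrC.
  rewrite RintegralD//; [|exact: iosc|exact: iosc].
  by apply: le_trans (ler_normD _ _) _; exact: parts.
Qed.

End decay.

(** * Sublevel estimates from decay *)

Section bump_calculus.
Context {R : realType}.

Lemma is_derive_quadratic_remainder (F : R -> R) (u l C : R) :
  (forall h, `|F (h + u) - F u - h * l| <= C * h ^+ 2) -> is_derive u 1 F l.
Proof.
move=> H; have C0 : 0 <= C by have := H 1; rewrite expr1n mulr1; exact: le_trans.
have cvF : (fun h => h^-1 *: (F (h *: 1 + u) - F u)) @ (0 : R)^' --> l.
  apply/cvgrPdist_le => e e0; near=> h.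
  have h0 : h != 0 by near: h; exact: nbhs_dnbhs_neq.
  rewrite [h *: 1](_ : _ = h); last by rewrite /GRing.scale/= mulr1.
  rewrite (_ : l - _ = - h^-1 * (F (h + u) - F u - h * l)); last first.
    by rewrite /GRing.scale/=; field.
  rewrite normrM normrN normfV ler_pdivrMl ?normr_gt0//.
  apply: le_trans (H h) _; rewrite -(real_normK (num_real h)).
  rewrite expr2 mulrCA ler_wpM2l//.
  have : `|h| <= e / (C + 1).
    by near: h; apply: dnbhs0_le; rewrite divr_gt0//; lra.
  rewrite ler_pdivlMr; last by lra.
  have := normr_ge0 h; lra.
apply: DeriveDef; first by apply/cvg_ex; exists l.
exact: (cvg_lim _ cvF).
Unshelve. all: by end_near. Qed.

(** Squaring makes the positive part [C^1], the regularity that admissibility asks for along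
    curves. *)
Definition sqr_pos_part (u : R) : R := Num.max 0 u ^+ 2.

Lemma is_derive_sqr_pos_part (u : R) :
  is_derive u 1 sqr_pos_part (2 * Num.max 0 u).
Proof.
apply: (@is_derive_quadratic_remainder _ _ _ 1) => h.
rewrite mul1r /sqr_pos_part.
have [u0|u0] := leP 0 u; have [hu|hu] := leP 0 (h + u).
- rewrite (_ : _ - _ = h ^+ 2); last by ring.
  by rewrite ger0_norm ?sqr_ge0.
- rewrite ler_norml; apply/andP; split; nra.
- rewrite ler_norml; apply/andP; split; nra.
- by rewrite !expr0n/= !(subr0, mulr0) normr0 sqr_ge0.
Qed.

(** Passes from the multiplicative parameter [t] of the curves to [s = ln t], in which the
    derivatives are computed. *)
Lemma C1_pos_comp_ln (h J dJ : R -> R) :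
  (forall t : R, 0 < t -> h t = J (ln t)) ->
  (forall s : R, is_derive s 1 J (dJ s)) -> continuous dJ ->
  C1_pos h /\ derive1 h 1 = dJ 0.
Proof.
move=> hJ dJP cdJ.
have near_pos (t : R) : 0 < t -> \forall r \near t, 0 < r by exact: lt_nbhsr.
have dh (t : R) : 0 < t -> is_derive t 1 h (dJ (ln t) * t^-1).
  move=> t0; have ? := dJP (ln t); have ? := is_derive1_ln t0.
  have eJ : \forall r \near t, (J \o @ln R) r = h r.
    by near=> r; rewrite /= hJ//; near: r; exact: near_pos.
  have dJln : is_derive t 1 (J \o @ln R) (dJ (ln t) * t^-1) by exact: is_derive1_comp.
  exact: (near_eq_is_derive eJ dJln).
have eh (t : R) : 0 < t -> derive1 h t = dJ (ln t) * t^-1.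
  by move=> t0; rewrite derive1E; have [_ ->] := dh t t0.
split; last by rewrite eh// ln1 invr1 mulr1.
move=> t t0; split; first by have [] := dh t t0.
have : {for t, continuous (fun r => dJ (ln r) * r^-1)}.
  apply: cvgM; last by apply: cvgV => //; rewrite gt_eqF.
  by apply: continuous_comp; [exact: continuous_ln|exact: cdJ].
rewrite /prop_for /continuous_at eh//; apply: cvg_trans; apply: near_eq_cvg.
by near=> r; rewrite eh//; near: r; exact: near_pos.
Unshelve. all: by end_near. Qed.

End bump_calculus.

Section test_function.
Context {R : realType} {n : nat}.
Local Notation T := (lebesgue_rV R n).
Local Notation mu := (lebesgue_measure_rV R n).
Variable a : 'I_n -> R.
Hypothesis n_gt0 : (0 < n)%N.
Hypothesis a_gt0 : forall i, 0 < a i.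
Variables (g : 'rV[R]_n -> R) (rho : R).
Hypothesis g_ge0 : forall x, 0 <= g x.
Hypothesis g_locint : locally_integrable_rV g.
Hypothesis g_hom : mixed_homogeneous_off0 a rho g.
Local Notation Q := (homogeneous_dim a).

Definition sqnorm (x : 'rV[R]_n) : R := \sum_i x ord0 i ^+ 2.

(** Along a curve at [t = 1], differentiating [g] costs [|rho|] and differentiating the cutoff at
    most [4 Q]; the 1 makes the constant at most 1, so that the bump is below [g]. *)
Definition bump_constant : R := (1 + `|rho| + 4 * Q)^-1.

Definition bump_fun (x : 'rV[R]_n) : R :=
  bump_constant * g x * sqr_pos_part (1 - sqnorm x).

Lemma bump_constant_gt0 : 0 < bump_constant.
Proof.
have := homogeneous_dim_ge0 a_gt0; have := normr_ge0 rho.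
by move=> ? ?; rewrite invr_gt0; lra.
Qed.

Lemma sqnorm_ge0 x : 0 <= sqnorm x.
Proof. by apply: sumr_ge0 => i _; exact: sqr_ge0. Qed.

Lemma sqr_pos_part_sqnorm x : 0 <= sqr_pos_part (1 - sqnorm x) <= 1.
Proof.
rewrite sqr_ge0/= exprn_ile1// ?le_max ?lexx// ge_max ler01/=.
by have := sqnorm_ge0 x; lra.
Qed.

Lemma bump_ge0 x : 0 <= bump_fun x.
Proof. by rewrite mulr_ge0 ?sqr_ge0// mulr_ge0// ltW// bump_constant_gt0. Qed.

Lemma bump_le x : bump_fun x <= g x.
Proof.
have /andP[h0 h1] := sqr_pos_part_sqnorm x.
have b0 := bump_constant_gt0.
have b1 : bump_constant <= 1.
  rewrite invf_le1; have := homogeneous_dim_ge0 a_gt0; have := normr_ge0 rho; lra.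
rewrite /bump_fun -[leRHS]mulr1 ler_pM//; first by rewrite mulr_ge0// ltW.
by rewrite ler_piMl.
Qed.

Lemma bump_lower x : sqnorm x <= 2^-1 -> bump_constant / 4 * g x <= bump_fun x.
Proof.
move=> x2; rewrite /bump_fun mulrAC ler_wpM2l ?mulr_ge0 ?(ltW bump_constant_gt0)//.
rewrite /sqr_pos_part max_r; last by lra.
nra.
Qed.

Lemma bump_support x : 1 < euclid x -> bump_fun x = 0.
Proof.
move=> x1; rewrite /bump_fun /sqr_pos_part max_l ?expr0n ?mulr0//.
have : 1 < sqnorm x; last by lra.
rewrite -[sqnorm x]sqr_sqrtr ?sqnorm_ge0//; move: x1; rewrite /euclid => x1.
by rewrite expr_gt1// ltW// (lt_trans _ x1).
Qed.

Lemma bump_integrable : mu.-integrable setT (EFin \o bump_fun).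
Proof.
have [G G0 gG] := integral_cube_finite g_ge0 g_locint.
have gm := g_locint.1.
have mbump : measurable_fun [set: T] bump_fun.
  apply: measurable_funM; first exact: measurable_funM.
  apply: measurable_funX; apply: measurable_maxr => //.
  apply: measurable_funB => //; apply: measurable_sum => i.
  by apply: measurable_funX; exact: coord_measurable.
apply/integrableP; split; first exact/measurable_EFinP.
rewrite (integral_off_origin n_gt0 mbump); last first.
  move=> x xcube; rewrite -(dilate0 a x) supported_dilate//.
  exact: bump_support.
apply: (@le_lt_trans _ _ G%:E); last by rewrite ltry.
apply: le_trans gG; have mo := @origin_measurable R n; have mc := @cube_measurable R n.
apply: (@le_trans _ _ (\int[mu]_(x in @cube R n `\` [set 0%R]) (g x)%:E)%E).
  apply: ge0_le_integral => //.
  - exact: measurableD.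
  - by apply/measurable_EFinP; apply: measurable_funTS; apply: measurableT_comp.
  - by apply/measurable_EFinP; exact: measurable_funTS.
  - by move=> x _; rewrite lee_fin ger0_norm ?bump_ge0// bump_le.
apply: ge0_subset_integral => //.
- exact: measurableD.
- by apply/measurable_EFinP; exact: measurable_funTS.
- by move=> x _; rewrite lee_fin.
Qed.

(** With [t = exp s], homogeneity turns [g] into [exp(rho s) g x], and the squared norm is an
    exponential sum with exponents [2 / a i]; the bump is thus explicit along the curve. *)
Lemma bump_curve x : x != 0 ->
  C1_pos (fun t => bump_fun (dilate a t x)) /\
  `|derive1 (fun t => bump_fun (dilate a t x)) 1| <= g x.
Proof.
move=> x0.
pose b (i : 'I_n) := 2 * (a i)^-1; pose c (i : 'I_n) := x ord0 i ^+ 2.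
pose q := expsum b 0 c 0; pose dq := expsum b 0 c 1.
have dqP (s : R) : is_derive s 1 q (dq s) by exact: derivatives_expsum.
have qE (s : R) : q s = sqnorm (dilate a (expR s) x).
  rewrite /q /expsum/= add0r; apply: eq_bigr => i _.
  rewrite /c expr0 mulr1 mxE expR_powR exprMn mulrC; congr (_ * _).
  by rewrite -expRM_natl /b mulrA.
pose J (s : R) := bump_constant * g x * (expR (rho * s) * sqr_pos_part (1 - q s)).
pose dJ (s : R) := bump_constant * g x *
  (rho * expR (rho * s) * sqr_pos_part (1 - q s) -
   expR (rho * s) * (2 * Num.max 0 (1 - q s)) * dq s).
have dexp (s : R) : is_derive s 1 (fun s : R => expR (rho * s)) (rho * expR (rho * s)).
  have dl : is_derive s 1 (fun s : R => rho * s) rho.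
    by rewrite -[X in is_derive _ _ _ X]mulr1; apply: is_deriveZ.
  have := @is_derive1_comp R expR (fun s : R => rho * s) s _ _ (is_derive_expR _) dl.
  by rewrite mulrC.
have dJP (s : R) : is_derive s 1 J (dJ s).
  have ? := dqP s; have ? := dexp s.
  have d1 : is_derive s 1 (fun s : R => 1 - q s) (- dq s).
    by rewrite -[X in is_derive _ _ _ X]add0r; apply: is_deriveB.
  have d2 := @is_derive1_comp R sqr_pos_part (fun s : R => 1 - q s) s _ _
    (is_derive_sqr_pos_part _) d1.
  have -> : J = (bump_constant * g x) *:
      ((fun s : R => expR (rho * s)) * (sqr_pos_part \o (fun s : R => 1 - q s))) by [].
  by apply: is_derive_eq; rewrite /dJ /GRing.scale/=; ring.
have der_cont (F dF : R -> R) : (forall s : R, is_derive s 1 F (dF s)) -> continuous F.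
  by move=> dFP s; apply/differentiable_continuous/derivable1_diffP; have [] := dFP s.
have cq : continuous q := der_cont _ _ dqP.
have cdq : continuous dq by apply: der_cont => s; exact: derivatives_expsum.
have cexp : continuous (fun s : R => expR (rho * s)) := der_cont _ _ dexp.
have cmax : continuous (fun s : R => Num.max 0 (1 - q s)).
  move=> s; apply: (@continuous_max R R (cst 0) (fun s => 1 - q s)); first exact: cvg_cst.
  by apply: cvgB; [exact: cvg_cst|exact: cq].
have cdJ : continuous dJ.
  move=> s; apply: cvgMr; apply: cvgB.
    apply: cvgM; first by apply: cvgMr; exact: cexp.
    by rewrite /sqr_pos_part; apply: cvgM; exact: cmax.
  apply: cvgM; last exact: cdq.
  by apply: cvgM; [exact: cexp|apply: cvgMr; exact: cmax].
have hJ (t : R) : 0 < t -> bump_fun (dilate a t x) = J (ln t).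
  by move=> t0; rewrite /J qE lnK// /bump_fun g_hom// /powR gt_eqF//; ring.
have [C1 ->] := C1_pos_comp_ln hJ dJP cdJ; split => //.
rewrite /dJ mulr0 expR0 mulr1 !mul1r qE dilate0.
have dq0 : dq 0 = \sum_i c i * b i.
  by rewrite /dq /expsum/= add0r; apply: eq_bigr => i _; rewrite expr1 mulr0 expR0 mulr1.
have Q0 := homogeneous_dim_ge0 a_gt0.
have b0 := bump_constant_gt0.
have dq_ge0 : 0 <= dq 0.
  by rewrite dq0 sumr_ge0// => i _; rewrite mulr_ge0 ?sqr_ge0// /b mulr_ge0// invr_ge0 ltW.
have /andP[h0 h1] := sqr_pos_part_sqnorm x.
(* The left side vanishes outside the unit ball; inside, every [x_i^2] is at most 1 and so
   [dq 0 <= 2 Q]. *)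
have key : `|2 * Num.max 0 (1 - sqnorm x) * dq 0| <= 4 * Q.
  have [le1|lt1] := leP (1 - sqnorm x) 0.
    by rewrite mulr0 mul0r normr0; lra.
  have m1 : 1 - sqnorm x <= 1 by have := sqnorm_ge0 x; lra.
  have dq2 : dq 0 <= 2 * Q.
    rewrite dq0 mulr_sumr; apply: ler_sum => i _; rewrite ler_piMl//.
      by rewrite /b mulr_ge0// invr_ge0 ltW.
    apply: (@le_trans _ _ (sqnorm x)); last by lra.
    by rewrite /sqnorm (bigD1 i)//= lerDl sumr_ge0// => j _; exact: sqr_ge0.
  rewrite ger0_norm; last by rewrite mulr_ge0// mulr_ge0// ltW.
  apply: (@le_trans _ _ (2 * 1 * (2 * Q))); last by lra.
  by rewrite ler_pM// ?mulr_ge0 ?(ltW lt1)// ler_wpM2l.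
rewrite normrM (ger0_norm (_ : 0 <= bump_constant * g x)); last by rewrite mulr_ge0// ltW.
rewrite mulrAC ler_piMl//.
rewrite mulrC /bump_constant ler_pdivrMr ?mul1r; last by rewrite -invr_gt0.
apply: le_trans (ler_normB _ _) _; rewrite lerD// normrM (ger0_norm h0).
by have := normr_ge0 rho; nra.
Qed.

Lemma bump_admissible : admissible a g (fun x => (bump_fun x)%:C%C).
Proof.
split.
- split; first exact: bump_integrable.
  by apply: integrable0.
- by move=> x /bump_support ->.
- move=> x x0; split; first exact: (bump_curve x0).1.
  move=> t t0; split; first exact: derivable_cst.
  rewrite (_ : derive1 _ = cst 0); first exact: cvg_cst.
  by apply/funext => s; rewrite derive1_cst.
- by move=> x x0; rewrite normc_def/= expr0n addr0 sqrtr_sqr lecR ger0_norm ?bump_ge0// bump_le.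
- move=> x x0; rewrite /euler_derivative/= derive1_cst normc_def/= expr0n addr0 sqrtr_sqr lecR.
  exact: (bump_curve x0).2.
Qed.

End test_function.

(** * The Fejer kernel *)

Section fejer.
Context {R : realType}.

(* [|\sum_(j < N) exp(i j u)|^2], that is [N] times the Fejer kernel. *)
Definition fejer (N : nat) (u : R) : R :=
  (\sum_(j < N) cos (j%:R * u)) ^+ 2 + (\sum_(j < N) sin (j%:R * u)) ^+ 2.

(** Adding the term of index [N] to the exponential sum raises its squared modulus by 1 plus twice
    the sum of the [cos((N - j) u)], which is then summed in reverse order. *)
Lemma fejer_cos (N : nat) (u : R) :
  fejer N u = \sum_(M < N) (1 + 2 * \sum_(m < M) cos (m.+1%:R * u)).
Proof.
elim: N => [|N IH]; first by rewrite /fejer !big_ord0 expr0n addr0.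
rewrite big_ord_recr/= -IH /fejer !big_ord_recr/=.
set C := \sum_(j < N) _; set S := \sum_(j < N) _.
have -> : \sum_(m < N) cos (m.+1%:R * u) = cos (N%:R * u) * C + sin (N%:R * u) * S.
  rewrite !mulr_sumr -big_split/= (reindex_inj rev_ord_inj)/=; apply: eq_bigr => j _.
  by rewrite -cosB -mulrBl subnSK// natrB// ltnW.
have := cos2Dsin2 (N%:R * u); set c := cos _; set s := sin _ => cs.
rewrite (_ : _ + _ = (c ^+ 2 + s ^+ 2) + 2 * (c * C + s * S) + (C ^+ 2 + S ^+ 2)); last by ring.
by rewrite cs; ring.
Qed.

Lemma fejer_ge0 (N : nat) (u : R) : 0 <= fejer N u.
Proof. by rewrite addr_ge0 ?sqr_ge0. Qed.

(** All the angles [j u] are at most [1/2] in modulus, so each cosine is at least [1/2]. *)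
Lemma fejer_lower (N : nat) (u : R) : (0 < N)%N -> `|u| < (2 * N%:R)^-1 ->
  N%:R ^+ 2 / 4 <= fejer N u.
Proof.
move=> N0 uN; have NR : 0 < N%:R :> R by rewrite ltr0n.
have : N%:R / 2 <= \sum_(j < N) cos (j%:R * u).
  apply: (@le_trans _ _ (\sum_(j < N) 2^-1)).
    by rewrite sumr_const card_ord -[leRHS]mulr_natl.
  apply: ler_sum => j _.
  have := cos_lipschitz 0 (j%:R * u); rewrite cos0 sub0r normrN.
  have : `|j%:R * u| <= 2^-1.
    rewrite normrM ger0_norm//.
    apply: (@le_trans _ _ (N%:R * (2 * N%:R)^-1)).
      by rewrite ler_pM ?ler_nat ?(ltW uN)// ltnW.
    by rewrite invfM mulrCA divff ?mulr1// gt_eqF.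
  by move=> ? /(le_trans (ler_norm _)); lra.
rewrite /fejer; set C := \sum_(j < N) _ => hC.
rewrite ler_wpDr ?sqr_ge0//.
rewrite (_ : N%:R ^+ 2 / 4 = (N%:R / 2) ^+ 2); last by field.
by rewrite lerXn2r// nnegrE ?divr_ge0// ?(le_trans _ hC) ?divr_ge0// ltW.
Qed.

(** Each term is at most the increment of [x^(1-eta) / (1-eta)] over [[m + 1, m + 2]], and these
    telescope. *)
Lemma sum_powRN_le (N : nat) (eta : R) : 0 < eta < 1 ->
  \sum_(m < N) m.+2%:R `^ (- eta) <= (N.+1%:R `^ (1 - eta)) / (1 - eta).
Proof.
move=> /andP[eta0 eta1]; pose sg := 1 - eta; have sg0 : 0 < sg by rewrite /sg; lra.
rewrite -/sg.
suff : \sum_(m < N) m.+2%:R `^ (- eta) <= (N.+1%:R `^ sg - 1) / sg.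
  move=> h; apply: le_trans h _; rewrite ler_wpM2r ?invr_ge0 ?(ltW sg0)//; lra.
elim: N => [|N IH]; first by rewrite big_ord0 powR1 subrr mul0r.
rewrite big_ord_recr/=; apply: le_trans (lerD IH (lexx _)) _.
have NN : N.+1%:R <= N.+2%:R :> R by rewrite ler_nat.
have pos (x : R) : N.+1%:R <= x <= N.+2%:R -> 0 < x.
  by move=> /andP[+ _]; apply: lt_le_trans; rewrite ltr0n.
have [c /andP[c1 c2] e] : exists2 c, N.+1%:R <= c <= N.+2%:R &
    N.+2%:R `^ sg - N.+1%:R `^ sg = (sg * c `^ (sg - 1)) * (N.+2%:R - N.+1%:R).
  apply: (@is_derive_MVT _ (fun x => x `^ sg) (fun x => sg * x `^ (sg - 1))) => //.
  by move=> x xN; apply: is_derive1_powR; exact: pos.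
have cN : N.+2%:R `^ (- eta) <= c `^ (sg - 1).
  have -> : sg - 1 = - eta by rewrite /sg; ring.
  have c0 : 0 < c by apply: pos; rewrite c1.
  rewrite !powRN lef_pV2 ?posrE ?powR_gt0 ?ltr0n//.
  by apply: ge0_ler_powR; rewrite ?nnegrE ?(ltW eta0) ?(ltW c0).
have d1 : N.+2%:R - N.+1%:R = 1 :> R by rewrite -natrB// subSnn.
rewrite d1 mulr1 in e.
rewrite ler_pdivlMr// mulrDl divfK ?gt_eqF//.
have : N.+2%:R `^ (- eta) * sg <= c `^ (sg - 1) * sg by rewrite ler_wpM2r// ltW.
lra.
Qed.

End fejer.

Lemma Rintegral_sum_ord d (T : measurableType d) (R : realType)
    (mu : {measure set T -> \bar R}) (N : nat) (h : nat -> T -> R) :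
  (forall k, mu.-integrable setT (EFin \o h k)) ->
  mu.-integrable setT (EFin \o (fun x => \sum_(k < N) h k x)) /\
  \int[mu]_x (\sum_(k < N) h k x) = \sum_(k < N) \int[mu]_x h k x.
Proof.
move=> ih; elim: N => [|N [IH1 IH2]].
  rewrite big_ord0; under [X in integrable _ _ (_ \o X)]eq_fun do rewrite big_ord0.
  split; first exact: integrable0.
  by under eq_Rintegral do rewrite big_ord0; rewrite Rintegral_cst// mul0r.
rewrite big_ord_recr/= -IH2.
under [X in integrable _ _ (_ \o X)]eq_fun do rewrite big_ord_recr/=.
split; first exact: (integrableD measurableT IH1 (ih N)).
by under eq_Rintegral do rewrite big_ord_recr/=; rewrite RintegralD.
Qed.

Section sublevel.
Context {R : realType} {n : nat}.
Local Notation T := (lebesgue_rV R n).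
Local Notation mu := (lebesgue_measure_rV R n).
Variable a : 'I_n -> R.
Hypothesis n_gt0 : (0 < n)%N.
Hypothesis a_gt0 : forall i, 0 < a i.
Variables (f g : 'rV[R]_n -> R) (rho : R).
Hypothesis f_meas : lebesgue_measurable f.
Hypothesis f_hom : mixed_homogeneous a f.
Hypothesis g_ge0 : forall x, 0 <= g x.
Hypothesis g_locint : locally_integrable_rV g.
Hypothesis g_hom : mixed_homogeneous_off0 a rho g.
Local Notation Q := (homogeneous_dim a).
Local Notation psi := (bump_fun a g rho).

Lemma euclid_delta (t : R) : euclid (\row_j (if j == ord0 then t else 0) : 'rV[R]_n.+1) = `|t|.
Proof.
rewrite /euclid (bigD1 ord0)//= big1 ?addr0.
  by rewrite mxE eqxx sqrtr_sqr.
by move=> j /negbTE j0; rewrite mxE j0 expr0n.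
Qed.

Lemma bump_cosine_decay (eta C t : R) :
  (forall phi, admissible a g phi -> forall lambda : 'rV[R]_n.+1,
    `|osc_integral f phi lambda| <= (C * (1 + euclid lambda) `^ (- eta))%:C%C) ->
  `|\int[mu]_x (cos (t * f x) * psi x)| <= C * (1 + `|t|) `^ (- eta).
Proof.
move=> H; have := H _ (bump_admissible n_gt0 a_gt0 g_ge0 g_locint g_hom)
  (\row_j (if j == ord0 then t else 0)).
rewrite euclid_delta => /normc_le_parts[+ _]; apply: le_trans.
rewrite /osc_integral /complex_integral/= le_eqVlt; apply/orP; left; apply/eqP; congr `|_|.
apply: eq_Rintegral => x _; rewrite /= mulr0 subr0; congr (cos _ * _).
rewrite /phase mxE eqxx big1 ?addr0// => i _.
by rewrite mxE /= mul0r.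
Qed.

Lemma cosine_integrable (t : R) :
  mu.-integrable setT (EFin \o (fun x => cos (t * f x) * psi x)).
Proof.
have ip := bump_integrable n_gt0 a_gt0 rho g_ge0 g_locint.
have /integrableP[/measurable_EFinP mp _] := ip.
apply: (le_integrable measurableT _ _ ip).
  apply/measurable_EFinP/measurable_funM => //.
  apply: (measurableT_comp (continuous_measurable_fun (@continuous_cos R))).
  exact: measurable_funM.
move=> x _ /=; rewrite lee_fin normrM ler_piMl//.
by rewrite ler_norml cos_geN1 cos_le1.
Qed.

(** In the cosine expansion the frequency [m] contributes at most [C (1 + m)^(-eta)], so each of the
    [N] inner sums is [O(N^(1-eta))]. *)
Lemma fejer_integral_le (eta C : R) (N : nat) : 0 < eta < 1 -> 0 <= C -> (0 < N)%N ->
  (forall t : R, `|\int[mu]_x (cos (t * f x) * psi x)| <= C * (1 + `|t|) `^ (- eta)) ->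
  mu.-integrable setT (EFin \o (fun x => fejer N (f x) * psi x)) /\
  \int[mu]_x (fejer N (f x) * psi x) <=
    C * (1 + 2 / (1 - eta)) * N%:R `^ (1 - eta) * N%:R.
Proof.
move=> eta01 C0 N0 H; have /andP[eta0 eta1] := eta01.
pose h (m : nat) (x : T) := cos (m%:R * f x) * psi x.
have ih m : mu.-integrable setT (EFin \o h m) := cosine_integrable m%:R.
pose s (M : nat) (x : T) := \sum_(m < M) h m.+1 x.
have is_ M := Rintegral_sum_ord M (fun m => ih m.+1).
pose k (M : nat) (x : T) := h 0%N x + 2 * s M x.
have i2s M : mu.-integrable setT (EFin \o (fun x => 2 * s M x)).
  exact: (integrableZl measurableT 2 (is_ M).1).
have ik M : mu.-integrable setT (EFin \o k M).
  exact: (integrableD measurableT (ih 0%N) (i2s M)).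
have -> : (fun x => fejer N (f x) * psi x) = (fun x => \sum_(M < N) k M x).
  apply/funext => x; rewrite fejer_cos mulr_suml; apply: eq_bigr => M _.
  rewrite /k /h mul0r cos0 mulrDl -mulrA mulr_suml; congr (_ + _ * _).
have [isum ->] := Rintegral_sum_ord N ik; split => //.
apply: (@le_trans _ _ (\sum_(M < N) C * (1 + 2 / (1 - eta)) * N%:R `^ (1 - eta))); last first.
  by rewrite sumr_const card_ord mulr_natr.
apply: ler_sum => M _.
rewrite /k (RintegralD measurableT (ih 0%N) (i2s M)) (RintegralZl 2 measurableT (is_ M).1).
rewrite (is_ M).2.
have h0 : \int[mu]_x h 0%N x <= C.
  apply: le_trans (ler_norm _) _; have := H 0.
  by rewrite normr0 addr0 powR1 mulr1.
have hS : \sum_(m < M) \int[mu]_x h m.+1 x <= C * (N%:R `^ (1 - eta) / (1 - eta)).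
  apply: (@le_trans _ _ (\sum_(m < M) C * m.+2%:R `^ (- eta))).
    apply: ler_sum => m _; apply: le_trans (ler_norm _) _.
    by have := H m.+1%:R; rewrite (ger0_norm (ler0n R m.+1)) nat1r.
  rewrite -mulr_sumr ler_wpM2l//; apply: le_trans (sum_powRN_le M eta01) _.
  rewrite ler_wpM2r ?invr_ge0//; first lra.
  by apply: ge0_ler_powR; rewrite ?nnegrE ?ler_nat//; lra.
have N1 : 1 <= N%:R `^ (1 - eta).
  by rewrite -[leLHS](powRr0 N%:R) ler_powR// ?ler1n//; lra.
have : C <= C * N%:R `^ (1 - eta) by rewrite ler_peMr.
rewrite (_ : C * (1 + 2 / (1 - eta)) * N%:R `^ (1 - eta) =
  C * N%:R `^ (1 - eta) + 2 * (C * (N%:R `^ (1 - eta) / (1 - eta)))); last by ring.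
lra.
Qed.

(** On this set the kernel is at least [N^2 / 4], while its whole integral is [O(N^(2-eta))]. *)
Lemma bump_sublevel_le (eta C : R) (N : nat) : 0 < eta < 1 -> 0 <= C -> (0 < N)%N ->
  (forall t : R, `|\int[mu]_x (cos (t * f x) * psi x)| <= C * (1 + `|t|) `^ (- eta)) ->
  (\int[mu]_(x in [set x | (`|f x| < (2 * N%:R)^-1)%R]) (psi x)%:E <=
    (4 * C * (1 + 2 / (1 - eta)) * N%:R `^ (- eta))%:E)%E.
Proof.
move=> eta01 C0 N0 H.
have [iF leF] := fejer_integral_le eta01 C0 N0 H.
have NR : 0 < N%:R :> R by rewrite ltr0n.
have ip := bump_integrable n_gt0 a_gt0 rho g_ge0 g_locint.
have /integrableP[/measurable_EFinP mp _] := ip.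
have psi0 x : 0 <= psi x by exact: bump_ge0.
have mE : measurable ([set x | `|f x| < (2 * N%:R)^-1] : set T).
  by apply: measurable_sublevel; exact: measurableT_comp.
have /integrableP[/measurable_EFinP mF _] := iF.
have N4 : 0 < N%:R ^+ 2 / 4 :> R by rewrite divr_gt0// exprn_gt0.
have : ((N%:R ^+ 2 / 4)%:E * \int[mu]_(x in [set x | (`|f x| < (2 * N%:R)^-1)%R]) (psi x)%:E <=
    (C * (1 + 2 / (1 - eta)) * N%:R `^ (1 - eta) * N%:R)%:E)%E.
  rewrite -ge0_integralZl_EFin ?(ltW N4)//; last 2 first.
  - by move=> x _; rewrite lee_fin.
  - by apply/measurable_EFinP; exact: measurable_funTS.
  apply: (@le_trans _ _ (\int[mu]_(x in [set x | (`|f x| < (2 * N%:R)^-1)%R])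
      (fejer N (f x) * psi x)%:E)%E).
    apply: ge0_le_integral => //.
    - by move=> x _; rewrite mule_ge0 ?lee_fin// ltW.
    - by apply: measurable_funeM; apply/measurable_EFinP; exact: measurable_funTS.
    - by apply/measurable_EFinP; exact: measurable_funTS.
    - by move=> x fx; rewrite -EFinM lee_fin ler_wpM2r// fejer_lower.
  apply: (@le_trans _ _ (\int[mu]_x (fejer N (f x) * psi x)%:E)%E).
    apply: ge0_subset_integral => //; first exact/measurable_EFinP.
    by move=> x _; rewrite lee_fin mulr_ge0// fejer_ge0.
  have fin := integrable_fin_num measurableT iF.
  by move: leF; rewrite -lee_fin /Rintegral fineK.
rewrite -lee_pdivlMl// -EFinM => h; apply: le_trans h _; rewrite lee_fin.
rewrite le_eqVlt; apply/orP; left; apply/eqP.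
rewrite powRD; last by rewrite (gt_eqF NR) implybT.
have /andP[_ eta1] := eta01.
by rewrite powRr1 ?(ltW NR)//; field; rewrite !gt_eqF ?subr_gt0.
Qed.

(** Moves the cube into the ball where the cutoff is bounded below. With [A] the sum of the [a i],
    [A / a i >= 1], so [s = - A ln(2n)] brings every squared coordinate below [1 / (2n)]. *)
Lemma contraction_exists : exists2 s : R, s <= 0 &
  forall x : 'rV[R]_n, cube x -> sqnorm (dilate a (expR s) x) <= 2^-1.
Proof.
have n2 : 1 <= (2 * n)%:R :> R by rewrite ler1n muln_gt0.
have l0 : 0 <= ln (2 * n)%:R :> R by exact: ln_ge0.
pose A := \sum_i a i.
have aA i : a i <= A.
  by rewrite /A (bigD1 i)//= lerDl sumr_ge0// => j _; exact: ltW.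
have A0 : 0 <= A by apply: sumr_ge0 => j _; exact: ltW.
exists (- (A * ln (2 * n)%:R)); first by rewrite oppr_le0 mulr_ge0.
move=> x xc; rewrite /sqnorm.
apply: (@le_trans _ _ (\sum_(i < n) (2 * n)%:R^-1)); last first.
  rewrite sumr_const card_ord -[leLHS]mulr_natl natrM invfM mulrCA divff ?mulr1//.
  by rewrite pnatr_eq0 -lt0n.
apply: ler_sum => i _; rewrite mxE expR_powR exprMn.
have x1 : x ord0 i ^+ 2 <= 1.
  have := xc i; rewrite -ler_norml => h.
  by rewrite -(real_normK (num_real _)) exprn_ile1.
rewrite -[leRHS]mulr1 ler_pM ?sqr_ge0//.
rewrite -expRM_natl -[leRHS]lnK ?posrE ?invr_gt0; last by rewrite ltr0n muln_gt0.
rewrite ler_expR lnV ?posrE; last by rewrite ltr0n muln_gt0.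
set l := ln _ in l0 *.
rewrite (_ : _ * _ = - (2 * (A * (a i)^-1) * l)); last by ring.
rewrite lerN2 ler_peMl//.
have : 1 <= A * (a i)^-1 by rewrite ler_pdivlMr// mul1r.
lra.
Qed.

Lemma sublevel_of_decay (eta : R) : 0 < eta < 1 -> uniform_decay a f g eta ->
  sublevel_estimate f g eta.
Proof.
move=> eta01 [C C0 H]; have /andP[eta0 eta1] := eta01.
have cosd (t : R) := bump_cosine_decay t H.
have [G G0 gG] := integral_cube_finite g_ge0 g_locint.
have gm := g_locint.1.
have [s s0 contr] := contraction_exists.
pose c0 := bump_constant a rho; have c00 : 0 < c0 by exact: bump_constant_gt0.
pose D := 4 * C * (1 + 2 / (1 - eta)).
have D0 : 0 < D by rewrite mulr_gt0 ?mulr_gt0// ltr_pwDl// divr_ge0//; lra.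
(* The factors undo, in turn, the lower bound of the cutoff, the scaling of [g] and the Jacobian of
   the contraction. *)
pose k := (c0 / 4)^-1 * expR (- (rho * s)) * expR (- (Q * s)).
have k0 : 0 < k by rewrite !mulr_gt0 ?expR_gt0 ?invr_gt0 ?divr_gt0.
have mE (r : R) : measurable ([set x | `|f x| < r] : set T).
  by apply: measurable_sublevel; exact: measurableT_comp.
have ip := bump_integrable n_gt0 a_gt0 rho g_ge0 g_locint.
have /integrableP[/measurable_EFinP mp _] := ip.
have psi0 x : 0 <= psi x by exact: bump_ge0.
have mo := @origin_measurable R n; have mc := @cube_measurable R n.
have transfer (t : R) : 0 < t ->
    (\int[mu]_(x in @cube R n `&` [set x | (`|f x| < t)%R]) (g x)%:E <=
     k%:E * \int[mu]_(x in [set x | (`|f x| < expR s * t)%R]) (psi x)%:E)%E.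
  move=> t0.
  pose E : set T := [set x | `|f x| < expR s * t].
  pose F (x : T) : \bar R := ((EFin \o psi) \_ E) x.
  have mF : measurable_fun [set: T] F.
    apply/(measurable_restrictT _ _).1; first exact: mE.
    by apply/measurable_EFinP; exact: measurable_funTS.
  have F0 x : (0 <= F x)%E by rewrite /F patchE; case: ifP => // _; rewrite lee_fin.
  rewrite [X in (_ <= _ * X)%E]integral_mkcond -/F.
  rewrite (ge0_integral_dilate a s mF F0) muleA -EFinM.
  rewrite (_ : k * expR (Q * s) = (c0 / 4)^-1 * expR (- (rho * s))); last first.
    by rewrite /k -mulrA -expRD addNr expR0 mulr1.
  have kk : 0 <= (c0 / 4)^-1 * expR (- (rho * s)).
    by rewrite mulr_ge0 ?expR_ge0// invr_ge0 divr_ge0// ltW.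
  have mFd : measurable_fun [set: T] (fun x => F (dilate a (expR s) x)).
    by apply: (measurableT_comp mF); exact: dilate_measurable.
  rewrite -ge0_integralZl_EFin//.
  have mA := measurableI _ _ mc (mE t).
  have mge (X : set T) : measurable_fun X (fun x => (g x)%:E).
    by apply/measurable_EFinP; exact: measurable_funTS.
  have g0e x : (0 <= (g x)%:E)%E by rewrite lee_fin.
  have mu00 : mu [set 0] = 0%E by exact: leb_set1_0.
  rewrite (ge0_negligible_integral mo mA (mge _) (fun x _ => g0e x) mu00).
  apply: (@le_trans _ _ (\int[mu]_(x in (@cube R n `&` [set x | (`|f x| < t)%R]) `\` [set 0%R])
     (((c0 / 4)^-1 * expR (- (rho * s)))%:E * F (dilate a (expR s) x)))%E).
    apply: ge0_le_integral => //.
    - exact: measurableD.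
    - by apply: measurable_funeM; exact: measurable_funTS.
    - move=> x [[xc /= fx] /eqP x0].
      have -> : F (dilate a (expR s) x) = (psi (dilate a (expR s) x))%:E.
        rewrite /F patchE mem_set// /E/= f_hom ?expR_gt0// normrM ger0_norm ?expR_ge0//.
        by rewrite ltr_pM2l ?expR_gt0.
      rewrite -EFinM lee_fin.
      have := bump_lower a_gt0 rho g_ge0 (contr x xc).
      rewrite g_hom ?expR_gt0// expR_powR -/c0 => h.
      rewrite -mulrA ler_pdivlMl ?divr_gt0//.
      rewrite mulrC -ler_pdivrMl ?expR_gt0// -expRN opprK.
      by apply: le_trans h; rewrite mulrCA mulrA mulrC (mulrC (expR _)).
  apply: ge0_subset_integral => //.
  - exact: measurableD.
  - exact: measurable_funeM.
  - by move=> x _; rewrite mule_ge0.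
have B1 : 0 < k * D * (4 * expR s) `^ eta.
  by apply: mulr_gt0; [exact: mulr_gt0|apply: powR_gt0; rewrite mulr_gt0 ?expR_gt0].
have B2 : 0 < (G + 1) * (2 * expR s) `^ eta.
  by apply: mulr_gt0; [exact: ltr_wpDl|apply: powR_gt0; rewrite mulr_gt0 ?expR_gt0].
exists (k * D * (4 * expR s) `^ eta + (G + 1) * (2 * expR s) `^ eta).
  exact: addr_gt0.
move=> t t0; rewrite /weighted_measure.
under eq_integral do rewrite ger0_norm//.
change (\int[mu]_(x in @cube R n `&` [set x | (`|f x| < t)%R]) (g x)%:E <=
  ((k * D * (4 * expR s) `^ eta + (G + 1) * (2 * expR s) `^ eta) * t `^ eta)%:E)%E.
pose r := 2 * (expR s * t).
have r0 : 0 < r by rewrite !mulr_gt0 ?expR_gt0.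
have [r1|r1] := leP 1 r.
  apply: (@le_trans _ _ G%:E).
    apply: le_trans gG; apply: ge0_subset_integral => //.
    - exact: measurableI.
    - by apply/measurable_EFinP; exact: measurable_funTS.
    - by move=> x _; rewrite lee_fin.
  rewrite lee_fin; apply: (@le_trans _ _ ((G + 1) * r `^ eta)).
    apply: (@le_trans _ _ (G + 1)); first by lra.
    by rewrite ler_peMr ?addr_ge0// -[leLHS](powRr0 r) ler_powR// ltW.
  rewrite /r (mulrA 2) powRM ?mulr_ge0 ?expR_ge0 ?(ltW t0)// mulrA.
  by rewrite ler_wpM2r ?powR_ge0// lerDr ltW.
(* With [r = 2 exp(s) t < 1], this [N] satisfies [exp(s) t <= 1 / (2N)], so the kernel bound covers
   the contracted sublevel set, and [1 / N <= 2 r], which turns [N^(-eta)] into a multiple of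
   [t^eta]. *)
pose N := Num.truncn r^-1.
have rV1 : 1 <= r^-1 by rewrite invf_ge1// ltW.
have /andP[Nr rN] : N%:R <= r^-1 < N.+1%:R by apply: truncn_itv; rewrite invr_ge0 ltW.
have N0 : (0 < N)%N by rewrite truncn_gt0.
have NR : 0 < N%:R :> R by rewrite ltr0n.
apply: le_trans (transfer t t0) _.
have Eint : (\int[mu]_(x in [set x | (`|f x| < expR s * t)%R]) (psi x)%:E <=
    (D * N%:R `^ (- eta))%:E)%E.
  apply: le_trans (bump_sublevel_le eta01 (ltW C0) N0 cosd).
  apply: ge0_subset_integral => //.
  - by apply/measurable_EFinP; exact: measurable_funTS.
  - by move=> x _; rewrite lee_fin.
  - move=> x /= fx; apply: lt_le_trans fx _.
    rewrite invfM -ler_pdivrMl ?invr_gt0// invrK -/r.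
    by rewrite -[leLHS]invrK lef_pV2 ?posrE ?invr_gt0.
apply: le_trans (lee_wpmul2l _ Eint) _; first by rewrite lee_fin ltW.
rewrite -EFinM lee_fin mulrA.
apply: (@le_trans _ _ (k * D * ((4 * expR s) `^ eta * t `^ eta))); last first.
  by rewrite mulrA ler_wpM2r ?powR_ge0// lerDl mulr_ge0 ?powR_ge0// addr_ge0.
apply: ler_wpM2l; first by apply: mulr_ge0; exact: ltW.
rewrite -powRM ?mulr_ge0 ?expR_ge0 ?(ltW t0)//.
rewrite (_ : - eta = -1 * eta) ?mulN1r// -mulN1r powRrM powR_inv1 ?(ltW NR)//.
apply: ge0_ler_powR; rewrite ?nnegrE ?invr_ge0 ?(ltW eta0) ?(ltW NR)//.
  by rewrite !mulr_ge0 ?expR_ge0// ltW.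
rewrite (_ : 4 * expR s * t = 2 * r); last by rewrite /r; ring.
rewrite -div1r ler_pdivrMr//.
have : r * r^-1 <= r * N.+1%:R by rewrite ler_pM2l ?(ltW rN).
rewrite divff ?gt_eqF// -natr1.
have : r * 1 <= r * N%:R by rewrite ler_wpM2l ?(ltW r0)// ler1n.
lra.
Qed.

End sublevel.

Lemma uniform_decay_le (R : realType) (n : nat) (a : 'I_n -> R) (f g : 'rV[R]_n -> R)
    (eta eta' : R) :
  eta' <= eta -> uniform_decay a f g eta -> uniform_decay a f g eta'.
Proof.
move=> le_eta [C C0 H]; exists C => // phi phi_adm lambda.
apply: le_trans (H phi phi_adm lambda) _; rewrite lecR ler_wpM2l ?(ltW C0)//.
by rewrite ler_powR ?lerN2// lerDl sqrtr_ge0.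
Qed.

(** Exponent 0 only asks for finite mass on the cube; this gives [delta >= 0]. *)
Lemma sublevel_estimate0 (R : realType) (n : nat) (f g : 'rV[R]_n -> R) :
  lebesgue_measurable f -> (forall x, 0 <= g x) -> locally_integrable_rV g ->
  sublevel_estimate f g 0.
Proof.
move=> f_meas g_ge0 g_locint; have [G G0 gG] := integral_cube_finite g_ge0 g_locint.
exists (G + 1); first by rewrite ltr_wpDl.
move=> t t0; rewrite powRr0 mulr1 /weighted_measure.
under eq_integral do rewrite ger0_norm//.
apply: (@le_trans _ _ G%:E); last by rewrite lee_fin lerDl.
apply: le_trans gG; apply: ge0_subset_integral => //.
- apply: measurableI; first exact: cube_measurable.
  by apply: measurable_sublevel; exact: measurableT_comp.
- exact: cube_measurable.
- by apply/measurable_EFinP; apply: measurable_funTS; exact: g_locint.1.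
- by move=> x _; rewrite lee_fin.
- by move=> x [].
Qed.

Lemma num_distinct_gt0 (R : realType) (n : nat) (a : 'I_n -> R) :
  (0 < n)%N -> (0 < num_distinct a)%N.
Proof.
move=> n0; rewrite /num_distinct -has_predT; apply/hasP; exists (a (Ordinal n0)) => //.
by rewrite mem_undup codom_f.
Qed.


Unset Implicit Arguments.

Theorem corollary1p3 (R : realType) (n : nat) (n_ge1 : (1 <= n)%N)
  (a : 'I_n -> R) (a_gt0 : forall i, 0 < a i) (a_neq1 : forall i, a i != 1)
  (f : 'rV[R]_n -> R) (f_meas : lebesgue_measurable f)
  (f_hom : mixed_homogeneous a f)
  (g : 'rV[R]_n -> R) (g_ge0 : forall x : 'rV[R]_n, 0 <= g x)
  (g_locint : locally_integrable_rV g)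
  (rho : R) (g_hom : mixed_homogeneous_off0 a rho g)
  (p : \bar R) (p_ge1 : (1 <= p)%E) (g_Lp : Lp_on_cube p g) :
  (forall eps : R,
     0 < eps -> eps < (num_distinct a).+1%:R^-1 ->
     (((num_distinct a).+1%:R^-1)%:E < (hoelder_conjugate p)^-1)%E ->
     sublevel_estimate f g eps ->
     uniform_decay a f g eps) /\
  (forall delta : R,
     ereal_sup [set eps%:E | eps in [set eps : R | sublevel_estimate f g eps]]
       = delta%:E ->
     delta <= (num_distinct a).+1%:R^-1 ->
     ~ exists2 eta : R, delta < eta & uniform_decay a f g eta).
Proof.
split=> [eps eps0 epsK Kp subf|delta supE delta_le [eta delta_eta decay]].
  exact: (decay_of_sublevel n_ge1 a_gt0 a_neq1 f_meas f_hom g_ge0 g_locint g_hom p_ge1 g_Lp).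
have le_delta e : sublevel_estimate f g e -> e <= delta.
  by move=> he; rewrite -lee_fin -supE; apply: ereal_sup_ubound; exists e.
have delta0 : 0 <= delta by apply: le_delta; exact: sublevel_estimate0.
have delta2 : delta <= 2^-1.
  apply: le_trans delta_le _; rewrite lef_pV2 ?posrE ?ltr0n// ler_nat ltnS.
  exact: num_distinct_gt0.
(* The Fejer argument requires an exponent below 1. As [v >= 1] gives [delta <= 1/2], capping at
   [3/4] keeps the exponent above [delta]. *)
pose eta' := Num.min eta (3 / 4).
have delta_eta' : delta < eta' by rewrite lt_min delta_eta/=; lra.
have eta'1 : eta' < 1 by rewrite gt_min; apply/orP; right; lra.
have eta'01 : 0 < eta' < 1 by rewrite eta'1 andbT (le_lt_trans delta0).
have eta'_le : eta' <= eta by rewrite ge_min lexx.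
have := le_delta eta' (sublevel_of_decay n_ge1 a_gt0 f_meas f_hom g_ge0 g_locint g_hom
  eta'01 (uniform_decay_le eta'_le decay)).
by rewrite leNgt delta_eta'.
Qed.
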